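(* Let $G$ be a finite group, let $\mathcal{V}=\mathsf{sSet}$ or $\mathsf{Top}$, and let $\mathcal{F}=\{\mathcal{F}_n\}_{n\geq0}$ be any weak indexing system. Then $N\mathcal{F}$-operads exist. That is, there exists an (explicitly constructible) operad $\mathcal{O}\in\mathsf{Op}^G(\mathcal{V})$ such that, for all $n\geq0$ and $\Gamma\leq G\times\Sigma_n$, $$\mathcal{O}(n)^\Gamma\sim\begin{cases}*&\text{if }\Gamma\in\mathcal{F}_n,\\ \emptyset&\text{otherwise.}\end{cases}\qquad(\star)$$ In particular, the map $\mathrm{Ho}(N_\infty\text{-}\mathsf{Op})\to\mathcal{I}$ from the homotopy category of $N_\infty$-operads to the poset of indexing systems is an equivalence of categories. Moreover, if $\mathcal{O}'\in\mathsf{Op}^G(\mathcal{V})$ has fixed points as in $(\star)$ for some collection of graph subgroups $\mathcal{F}=\{\mathcal{F}_n\}_{n\geq0}$, then $\mathcal{F}$ must be a weak indexing system.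
   Context: $\mathsf{Op}^G(\mathcal{V})$ is the category of $G$-objects in single-colored symmetric operads in $(\mathcal{V},\times)$; $\mathcal{O}(n)$ has a $G\times\Sigma_n$-action (right $\Sigma_n$-actions converted by inversion). $X\sim *$ means $X$ is weakly contractible, and $X\sim\emptyset$ means $X$ is empty. A *graph subgroup* of $G\times\Sigma_n$ is a subgroup $\Gamma$ with $\Gamma\cap\Sigma_n=\{*\}$, equivalently $\Gamma=\{(h,\phi(h)):h\in H\}$ for some $H\leq G$ and homomorphism $\phi\colon H\to\Sigma_n$. **Trees and $G$-trees.** $\Omega$ is the Moerdijk–Weiss category of finite rooted trees. A tree $T$ has edges, a root edge, and a set $V(T)$ of vertices; each vertex is written $e^\uparrow\leq e$, where $e$ is the output edge and $e^\uparrow$ the (possibly empty) collection of input edges; leaves are edges with no vertex above them. A corolla is a tree with exactly one vertex; $C_n$ is the corolla with $n$ leaves. $T_{e^\uparrow\leq e}$ is the one-vertex subtree at a vertex. $\mathsf{lr}(T)$ is the corolla with the same leaves and root as $T$. A *$G$-tree* is a tuple $T=(T_x)_{x\in X}$ of trees indexed by a transitive finite $G$-set $X$ with associative unital isomorphisms $T_x\to T_{gx}$; a quotient map $(S_y)_Y\to(T_x)_X$ is a $G$-map $\phi\colon Y\to X$ with compatible isomorphisms $S_y\to T_{\phi(y)}$. $\Sigma_G$ is the category of $G$-corollas (all $T_x$ corollas) and quotients. $\mathsf{lr}((T_x)_X)=(\mathsf{lr}(T_x))_X$. $V_G(T)=(\coprod_xV(T_x))/G$; for a $G$-vertex $v$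 with edge orbit $Ge$, $T_v=(T_{f^\uparrow\leq f})_{f\in Ge}\in\Sigma_G$. **(Weak) indexing systems.** A family of $G$-corollas is a sieve $\Sigma_{\mathcal{F}}\subset\Sigma_G$ (any arrow of $\Sigma_G$ with target in $\Sigma_{\mathcal F}$ lies in it, together with its source). Equivalently it is a collection $\mathcal{F}=\{\mathcal{F}_n\}_{n\geq0}$ of families (closed under subgroups and conjugation) $\mathcal{F}_n$ of graph subgroups of $G\times\Sigma_n$: the graph of $\phi\colon H\to\Sigma_n$ is in $\mathcal{F}_n$ iff the $G$-corolla $G\cdot_HC_n$ (indexed by $G/H$, with $H$ acting on $C_n$ via $\phi$) is in $\Sigma_{\mathcal{F}}$. An $\mathcal{F}$-tree is a $G$-tree $T$ with $T_v\in\Sigma_{\mathcal{F}}$ for all $v\in V_G(T)$. $\mathcal{F}$ is a *weak indexing system* if $\mathsf{lr}(T)\in\Sigma_{\mathcal{F}}$ for every $\mathcal{F}$-tree $T$; it is an *indexing system* if moreover all trivial corollas $(C_n)_{G/H}$ (i.e. all subgroups $H\times\{e\}\leq G\times\Sigma_n$) belong to it, for all $n\geq0$, $H\leq G$. $\mathcal{I}$ is the poset of indexing systems ordered by inclusion, viewed as a category. **$N_\infty$-operads (Blumberg–Hill).** An $N_\infty$-operad is a $G$-operad $\mathcal{O}$ in spaces such that $\mathcal{O}(0)$ is $G$-contractible, each $\Sigma_n$-action on $\mathcal{O}(n)$ is free, and $\mathcal{O}(n)$ is a universal space for a family $\mathcal{F}_n(\mathcal{O})$ of subgroups of $G\times\Sigma_n$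 containing all $H\times\{e\}$, $H\leq G$. $\mathrm{Ho}(N_\infty\text{-}\mathsf{Op})$ is the localization of the category of $N_\infty$-operads at the maps $\mathcal{O}\to\mathcal{O}'$ for which $\mathcal{O}(n)^\Gamma\to\mathcal{O}'(n)^\Gamma$ is a weak equivalence for all $n$ and $\Gamma\leq G\times\Sigma_n$. The map to $\mathcal{I}$ sends $\mathcal{O}$ to $\{\mathcal{F}_n(\mathcal{O})\}_{n\geq0}$. *)

(* Defs.v *)
From HB Require Import structures.
From Stdlib Require Import Relation_Operators.
From mathcomp Require Import all_boot all_order all_algebra all_fingroup.
From mathcomp Require Import all_classical all_reals all_analysis.

Set Implicit Arguments.
Unset Strict Implicit.
Unset Printing Implicit Defensive.

Import Order.TTheory GRing.Theory Num.Theory numFieldNormedType.Exports.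

Declare Scope cat_scope.
Delimit Scope cat_scope with cat.
Local Open Scope cat_scope.

Record category := Category {
  ob :> Type;
  hom : ob -> ob -> Type;
  idm : forall a, hom a a;
  compm : forall a b c, hom b c -> hom a b -> hom a c;
  compmA : forall a b c d (h : hom c d) (g : hom b c) (f : hom a b),
    compm h (compm g f) = compm (compm h g) f;
  comp1m : forall a b (f : hom a b), compm (idm b) f = f;
  compm1 : forall a b (f : hom a b), compm f (idm a) = f }.

Notation "g ∘ f" := (compm g f) (at level 40, left associativity) : cat_scope.

Record functor (C D : category) := Functor {
  fob :> C -> D;
  fmap : forall a b, hom a b -> hom (fob a) (fob b);
  fmap1 : forall a, fmap (idm a) = idm (fob a);
  fmapM : forall a b c (g : hom b c) (f : hom a b),
    fmap (g ∘ f) = fmap g ∘ fmap f }.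

Definition is_iso (C : category) (a b : C) (f : hom a b) :=
  exists g : hom b a, g ∘ f = idm a /\ f ∘ g = idm b.

Definition id_functor (C : category) : functor C C :=
  @Functor C C id (fun _ _ => id) (fun _ => erefl) (fun _ _ _ _ _ => erefl).

Definition comp_functor (C D E : category) (G : functor D E) (F : functor C D) :
  functor C E.
Proof.
refine (@Functor C E (fun a => G (F a)) (fun a b f => fmap G (fmap F f)) _ _).
- by move=> a; rewrite !fmap1.
- by move=> a b c g f; rewrite !fmapM.
Defined.

Definition nat_isomorphic (C D : category) (F G : functor C D) :=
  exists t : forall a, hom (F a) (G a),
    (forall a, is_iso (t a)) /\
    (forall a b (f : hom a b), t b ∘ fmap F f = fmap G f ∘ t a).

Definition is_equivalence (C D : category) (F : functor C D) :=
  exists G : functor D C,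
    nat_isomorphic (comp_functor G F) (id_functor C) /\
    nat_isomorphic (comp_functor F G) (id_functor D).

Definition full_subcategory (C : category) (P : C -> Prop) : category :=
  @Category {a : C | P a} (fun a b => hom (sval a) (sval b))
    (fun a => idm (sval a)) (fun _ _ _ g f => g ∘ f)
    (fun _ _ _ _ h g f => compmA h g f) (fun _ _ f => comp1m f)
    (fun _ _ f => compm1 f).

Section GObjects.
Context (gT : finGroupType) (C : category).

Record gobject := GObject {
  gobj :> C;
  gact : gT -> hom gobj gobj;
  gact1 : gact 1%g = idm gobj;
  gactM : forall g h, gact (g * h)%g = gact g ∘ gact h }.

Definition ghom (X Y : gobject) :=
  {f : hom X Y | forall g, gact Y g ∘ f = f ∘ gact X g}.

Lemma ghom_id_subproof (X : gobject) g :
  gact X g ∘ idm X = idm X ∘ gact X g.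
Proof. by rewrite comp1m compm1. Qed.

Lemma ghom_comp_subproof (X Y Z : gobject) (k : ghom Y Z) (f : ghom X Y) g :
  gact Z g ∘ (sval k ∘ sval f) = sval k ∘ sval f ∘ gact X g.
Proof.
by case: k f => [k kP] [f fP] /=; rewrite compmA kP -compmA fP compmA.
Qed.

Lemma ghomP (X Y : gobject) (f g : ghom X Y) : sval f = sval g -> f = g.
Proof. by move=> fg; apply: eq_sig_hprop => // h; exact: Prop_irrelevance. Qed.

Definition gobject_category : category.
Proof.
refine (@Category gobject ghom
  (fun X => exist _ (idm (gobj X)) (@ghom_id_subproof X))
  (fun X Y Z k f => exist _ (sval k ∘ sval f) (ghom_comp_subproof k f)) _ _ _).
- by move=> *; apply: ghomP; rewrite /= compmA.
- by move=> *; apply: ghomP; rewrite /= comp1m.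
- by move=> *; apply: ghomP; rewrite /= compm1.
Defined.

End GObjects.

(** The localization C[W^-1]: same objects as C; a morphism is a zigzag of
    morphisms of C and formal inverses of morphisms in W, up to the congruence
    generated by the relations of C and w^-1 w = 1, w w^-1 = 1. *)

Section Localization.
Context (C : category) (W : forall a b : C, hom a b -> Prop).

Inductive zigzag (a : C) : C -> Type :=
| zz_nil : zigzag a a
| zz_fwd b c (f : hom b c) (z : zigzag a b) : zigzag a c
| zz_bwd b c (w : hom c b) (Ww : W w) (z : zigzag a b) : zigzag a c.

Inductive zz_eq (a : C) : forall b, zigzag a b -> zigzag a b -> Prop :=
| zz_refl b (z : zigzag a b) : zz_eq z z
| zz_sym b (z z' : zigzag a b) : zz_eq z z' -> zz_eq z' z
| zz_trans b (z z' z'' : zigzag a b) : zz_eq z z' -> zz_eq z' z'' -> zz_eq z z''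
| zz_fwd_congr b c (f : hom b c) (z z' : zigzag a b) :
    zz_eq z z' -> zz_eq (zz_fwd f z) (zz_fwd f z')
| zz_bwd_congr b c (w : hom c b) (Ww : W w) (z z' : zigzag a b) :
    zz_eq z z' -> zz_eq (zz_bwd Ww z) (zz_bwd Ww z')
| zz_fwd_id b (z : zigzag a b) : zz_eq (zz_fwd (idm b) z) z
| zz_fwd_comp b c d (g : hom c d) (f : hom b c) (z : zigzag a b) :
    zz_eq (zz_fwd (g ∘ f) z) (zz_fwd g (zz_fwd f z))
| zz_fwd_bwd b c (w : hom c b) (Ww : W w) (z : zigzag a b) :
    zz_eq (zz_fwd w (zz_bwd Ww z)) z
| zz_bwd_fwd b c (w : hom b c) (Ww : W w) (z : zigzag a b) :
    zz_eq (zz_bwd Ww (zz_fwd w z)) z.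

Fixpoint zz_cat (a b c : C) (z : zigzag b c) (y : zigzag a b) : zigzag a c :=
  match z in zigzag _ c return zigzag a c with
  | zz_nil => y
  | zz_fwd _ _ f z' => zz_fwd f (zz_cat z' y)
  | zz_bwd _ _ _ Ww z' => zz_bwd Ww (zz_cat z' y)
  end.

Lemma zz_cat_congr (a b c : C) (z z' : zigzag b c) (y y' : zigzag a b) :
  zz_eq z z' -> zz_eq y y' -> zz_eq (zz_cat z y) (zz_cat z' y').
Proof.
move=> zz' yy'; apply: (@zz_trans _ _ _ (zz_cat z y')).
  elim: z {zz'} => [|? ? f z IH|? ? w Ww z IH] //=.
  - exact: zz_fwd_congr.
  - exact: zz_bwd_congr.
elim: zz' => {c z z'} /=; first by move=> *; exact: zz_refl.
- by move=> *; exact: zz_sym.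
- by move=> *; apply: zz_trans; eassumption.
- by move=> *; exact: zz_fwd_congr.
- by move=> *; exact: zz_bwd_congr.
- by move=> *; exact: zz_fwd_id.
- by move=> *; exact: zz_fwd_comp.
- by move=> *; exact: zz_fwd_bwd.
- by move=> *; exact: zz_bwd_fwd.
Qed.

Lemma zz_catA (a b c d : C) (z : zigzag c d) (y : zigzag b c) (x : zigzag a b) :
  zz_cat z (zz_cat y x) = zz_cat (zz_cat z y) x.
Proof. by elim: z => [|? ? f z IH|? ? w Ww z IH] //=; rewrite IH. Qed.

Lemma zz_cat_nil (a b : C) (z : zigzag a b) : zz_cat z (zz_nil a) = z.
Proof. by elim: z => [|? ? f z IH|? ? w Ww z IH] //=; rewrite IH. Qed.

Section Hom.
Context (a b : C).

(** Equivalence classes of zigzags; the quotient types of the library would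
    bound the universe of C by that of choiceType. *)
Definition loc_hom := {P : zigzag a b -> Prop | exists z, P = zz_eq z}.

Definition loc_class (z : zigzag a b) : loc_hom :=
  exist _ (zz_eq z) (ex_intro _ z erefl).

Definition loc_repr (f : loc_hom) : zigzag a b := sval (cid (svalP f)).

Lemma loc_classP z z' : loc_class z = loc_class z' <-> zz_eq z z'.
Proof.
split=> [[->]|zz']; first exact: zz_refl.
apply: eq_sig_hprop => [h|/=]; first exact: Prop_irrelevance.
apply/funext => y; apply/propext; split; apply: zz_trans => //.
exact: zz_sym.
Qed.

Lemma loc_reprK f : loc_class (loc_repr f) = f.
Proof.
apply: eq_sig_hprop => [h|/=]; first exact: Prop_irrelevance.
by rewrite /loc_repr; case: cid.
Qed.

Lemma loc_repr_class z : zz_eq (loc_repr (loc_class z)) z.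
Proof. by apply/loc_classP; rewrite loc_reprK. Qed.

End Hom.

Definition localization : category.
Proof.
refine (@Category C loc_hom (fun a => loc_class (zz_nil a))
  (fun a b c g f => loc_class (zz_cat (loc_repr g) (loc_repr f))) _ _ _).
- move=> a b c d h g f; apply/loc_classP.
  apply: (@zz_trans _ _ _ (zz_cat (loc_repr h) (zz_cat (loc_repr g) (loc_repr f)))).
    by apply: zz_cat_congr; [exact: zz_refl|exact: loc_repr_class].
  rewrite zz_catA; apply: zz_cat_congr; last exact: zz_refl.
  by apply: zz_sym; exact: loc_repr_class.
- move=> a b f; rewrite -[RHS]loc_reprK; apply/loc_classP.
  rewrite -[X in zz_eq _ X]/(zz_cat (zz_nil b) (loc_repr f)).
  by apply: zz_cat_congr; [exact: loc_repr_class|exact: zz_refl].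
- move=> a b f; rewrite -[RHS]loc_reprK; apply/loc_classP.
  rewrite -[X in zz_eq _ X]zz_cat_nil.
  by apply: zz_cat_congr; [exact: zz_refl|exact: loc_repr_class].
Defined.

End Localization.

Record cartesian := Cartesian {
  cart :> category;
  one : cart;
  bang : forall X, hom X one;
  bang_uniq : forall X (f : hom X one), f = bang X;
  prd : cart -> cart -> cart;
  prd_fst : forall X Y, hom (prd X Y) X;
  prd_snd : forall X Y, hom (prd X Y) Y;
  prd_pair : forall T X Y, hom T X -> hom T Y -> hom T (prd X Y);
  prd_fstE : forall T X Y (f : hom T X) (g : hom T Y),
    prd_fst X Y ∘ prd_pair f g = f;
  prd_sndE : forall T X Y (f : hom T X) (g : hom T Y),
    prd_snd X Y ∘ prd_pair f g = g;
  prd_uniq : forall T X Y (f g : hom T (prd X Y)),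
    prd_fst X Y ∘ f = prd_fst X Y ∘ g -> prd_snd X Y ∘ f = prd_snd X Y ∘ g ->
    f = g;
  iprd : forall k, ('I_k -> cart) -> cart;
  iprd_proj : forall k (X : 'I_k -> cart) i, hom (iprd X) (X i);
  iprd_tuple : forall T k (X : 'I_k -> cart), (forall i, hom T (X i)) ->
    hom T (iprd X);
  iprd_projE : forall T k (X : 'I_k -> cart) (f : forall i, hom T (X i)) i,
    iprd_proj X i ∘ iprd_tuple f = f i;
  iprd_uniq : forall T k (X : 'I_k -> cart) (f g : hom T (iprd X)),
    (forall i, iprd_proj X i ∘ f = iprd_proj X i ∘ g) -> f = g }.

(** [fixp a] is the object of points fixed by all the endomorphisms [a i]. *)
Record spaces := Spaces {
  sp :> cartesian;
  fixp : forall (X : sp) (I : Type), (I -> hom X X) -> sp;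
  fixp_incl : forall (X : sp) I (a : I -> hom X X), hom (fixp a) X;
  fixp_inclE : forall (X : sp) I (a : I -> hom X X) i,
    a i ∘ fixp_incl a = fixp_incl a;
  fixp_lift : forall (T X : sp) I (a : I -> hom X X) (f : hom T X),
    (forall i, a i ∘ f = f) -> hom T (fixp a);
  fixp_liftE : forall (T X : sp) I (a : I -> hom X X) (f : hom T X)
    (af : forall i, a i ∘ f = f), fixp_incl a ∘ fixp_lift af = f;
  fixp_uniq : forall (T X : sp) I (a : I -> hom X X) (f g : hom T (fixp a)),
    fixp_incl a ∘ f = fixp_incl a ∘ g -> f = g;
  weq : forall X Y : sp, hom X Y -> Prop;
  is_empty : sp -> Prop;
  gcontractible : forall gT : finGroupType, gobject gT sp -> Prop }.

Definition weakly_contractible (V : spaces) (X : V) := weq (bang X).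

Definition simp_op (m n : nat) :=
  {f : 'I_m.+1 -> 'I_n.+1 | {homo f : i j / (i <= j)%N}}.

Lemma simp_opP m n (f g : simp_op m n) : sval f =1 sval g -> f = g.
Proof.
move=> fg; apply: eq_sig_hprop => [h|]; first exact: Prop_irrelevance.
exact/funext.
Qed.

Definition simp_id n : simp_op n n.
Proof. by exists id. Defined.

Definition simp_comp l m n (g : simp_op m n) (f : simp_op l m) : simp_op l n.
Proof.
by exists (fun i => sval g (sval f i)) => i j ij; apply: (svalP g); apply: (svalP f).
Defined.

Definition simp_const m n (k : 'I_n.+1) : simp_op m n.
Proof. by exists (fun _ => k). Defined.

Record sset := SSet {
  simplices :> nat -> Type;
  sact : forall m n, simp_op m n -> simplices n -> simplices m;
  sact1 : forall n x, sact (simp_id n) x = x;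
  sactM : forall l m n (g : simp_op m n) (f : simp_op l m) x,
    sact (simp_comp g f) x = sact f (sact g x) }.

Record smap (X Y : sset) := SMap {
  smap_fun :> forall n, X n -> Y n;
  smap_nat : forall m n (f : simp_op m n) x,
    smap_fun (sact f x) = sact f (smap_fun x) }.

Lemma smapP (X Y : sset) (f g : smap X Y) : (forall n, f n =1 g n) -> f = g.
Proof.
case: f g => [f fP] [g gP] /= fg.
have {}fg : f = g by apply: functional_extensionality_dep => n; exact/funext.
by rewrite fg in fP *; congr SMap; exact: Prop_irrelevance.
Qed.

Definition smap_id (X : sset) : smap X X :=
  @SMap X X (fun n x => x) (fun _ _ _ _ => erefl).

Definition smap_comp (X Y Z : sset) (g : smap Y Z) (f : smap X Y) : smap X Z.
Proof.
refine (@SMap X Z (fun n x => g n (f n x)) _).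
by move=> m n h x; rewrite !smap_nat.
Defined.

Definition sset_category : category.
Proof.
by refine (@Category sset smap smap_id smap_comp _ _ _); move=> *; apply: smapP.
Defined.

Definition sset_one : sset :=
  @SSet (fun _ => unit) (fun _ _ _ x => x) (fun _ _ => erefl)
    (fun _ _ _ _ _ _ => erefl).

Definition sset_prd (X Y : sset) : sset.
Proof.
refine (@SSet (fun n => (X n * Y n)%type)
  (fun m n f p => (sact f p.1, sact f p.2)) _ _).
- by move=> n [x y]; rewrite !sact1.
- by move=> l m n g f [x y]; rewrite !sactM.
Defined.

Definition sset_iprd k (X : 'I_k -> sset) : sset.
Proof.
refine (@SSet (fun n => forall i, X i n) (fun m n f p i => sact f (p i)) _ _).
- by move=> n x; apply: functional_extensionality_dep => i; rewrite sact1.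
- by move=> l m n g f x; apply: functional_extensionality_dep => i; rewrite sactM.
Defined.

Definition sset_bang (X : sset) : smap X sset_one :=
  @SMap X sset_one (fun _ _ => tt) (fun _ _ _ _ => erefl).

Definition sset_fst (X Y : sset) : smap (sset_prd X Y) X :=
  @SMap (sset_prd X Y) X (fun _ p => p.1) (fun _ _ _ _ => erefl).

Definition sset_snd (X Y : sset) : smap (sset_prd X Y) Y :=
  @SMap (sset_prd X Y) Y (fun _ p => p.2) (fun _ _ _ _ => erefl).

Definition sset_pair (T X Y : sset) (f : smap T X) (g : smap T Y) :
  smap T (sset_prd X Y).
Proof.
refine (@SMap T (sset_prd X Y) (fun n x => (f n x, g n x)) _).
by move=> m n h x; rewrite /= !smap_nat.
Defined.

Definition sset_proj k (X : 'I_k -> sset) i : smap (sset_iprd X) (X i) :=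
  @SMap (sset_iprd X) (X i) (fun _ p => p i) (fun _ _ _ _ => erefl).

Definition sset_tuple (T : sset) k (X : 'I_k -> sset) (f : forall i, smap T (X i)) :
  smap T (sset_iprd X).
Proof.
refine (@SMap T (sset_iprd X) (fun n x i => f i n x) _).
move=> m n h x; apply: functional_extensionality_dep => i.
by rewrite /= smap_nat.
Defined.

Definition sset_cartesian : cartesian.
Proof.
refine (@Cartesian sset_category sset_one sset_bang _
  sset_prd sset_fst sset_snd sset_pair _ _ _
  sset_iprd sset_proj sset_tuple _ _).
- by move=> X f; apply: smapP => n x /=; case: (f n x).
- by move=> *; apply: smapP.
- by move=> *; apply: smapP.
- move=> T X Y f g fg1 fg2; apply: smapP => n x.
  have := congr1 (fun h : smap T X => h n x) fg1.
  have := congr1 (fun h : smap T Y => h n x) fg2.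
  by rewrite /=; case: (f n x) (g n x) => [? ?] [? ?] /= -> ->.
- by move=> *; apply: smapP.
- move=> T k X f g fg; apply: smapP => n x; apply: functional_extensionality_dep => i.
  exact: (f_equal (fun h : smap T (X i) => h n x) (fg i)).
Defined.

Definition sset_sub (X : sset) (P : forall n, X n -> Prop)
  (Pact : forall m n (f : simp_op m n) x, P n x -> P m (sact f x)) : sset.
Proof.
refine (@SSet (fun n => {x : X n | P n x})
  (fun m n f x => exist _ (sact f (sval x)) (Pact _ _ f _ (svalP x))) _ _).
- move=> n [x Px]; apply: eq_sig_hprop => /=; last by rewrite sact1.
  by move=> ?; exact: Prop_irrelevance.
- move=> l m n g f [x Px]; apply: eq_sig_hprop => /=; last by rewrite sactM.
  by move=> ?; exact: Prop_irrelevance.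
Defined.

Lemma sset_fix_subproof (X : sset) I (a : I -> smap X X) m n (f : simp_op m n) x :
  (forall i, a i n x = x) -> forall i, a i m (sact f x) = sact f x.
Proof. by move=> ax i; rewrite smap_nat ax. Qed.

Definition sset_fix (X : sset) I (a : I -> smap X X) : sset :=
  @sset_sub X (fun n x => forall i, a i n x = x) (sset_fix_subproof (a := a)).

(** The standard simplex and its horns: the simplices of the horn omit some
    vertex other than [k]. *)
Definition simplex (n : nat) : sset.
Proof.
refine (@SSet (fun m => simp_op m n) (fun _ _ f x => simp_comp x f) _ _).
- by move=> m x; apply: simp_opP.
- by move=> k l m g f x; apply: simp_opP.
Defined.

Lemma horn_subproof n (k : 'I_n.+1) l m (f : simp_op l m) (x : simplex n m) :
  (exists2 i, i != k & forall j, sval x j != i) ->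
  exists2 i, i != k & forall j, sval (sact f x) j != i.
Proof. by case=> i ik xi; exists i => // j; apply: xi. Qed.

Definition horn n (k : 'I_n.+1) : sset :=
  @sset_sub (simplex n) (fun m x => exists2 i, i != k & forall j, sval x j != i)
    (@horn_subproof n k).

Definition kan_complex (K : sset) := forall n (k : 'I_n.+2) (u : smap (horn k) K),
  exists v : smap (simplex n.+1) K, forall m (x : horn k m), v m (sval x) = u m x.

Definition elementary_homotopy (X Y : sset) (f g : smap X Y) :=
  exists h : smap (sset_prd X (simplex 1)) Y, forall n (x : X n),
    h n (x, simp_const n ord0) = f n x /\ h n (x, simp_const n ord_max) = g n x.

(** Equality of classes in the set pi_0 Map(X, Y) of components of the mapping
    space *)
Definition same_component (X Y : sset) : smap X Y -> smap X Y -> Prop :=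
  clos_refl_sym_trans _ (@elementary_homotopy X Y).

(** Weak homotopy equivalences: pi_0 Map(Y, K) -> pi_0 Map(X, K) is a bijection
    for every Kan complex K. *)
Definition sset_weq (X Y : sset) (f : smap X Y) :=
  forall K, kan_complex K ->
    (forall a b : smap Y K, same_component (smap_comp a f) (smap_comp b f) ->
      same_component a b) /\
    (forall c : smap X K, exists a : smap Y K, same_component (smap_comp a f) c).

(** A simplicial G-set is called G-contractible when its fixed points by all
    subgroups are weakly contractible, i.e. when its realization, a G-CW-complex,
    is G-contractible. *)
Definition sset_gcontractible (gT : finGroupType) (X : gobject gT sset_category) :=
  forall H : {group gT},
    sset_weq (sset_bang
      (@sset_fix (gobj X) {g : gT | g \in H} (fun g => gact X (sval g)))).

Definition sset_fix_incl (X : sset) I (a : I -> smap X X) : smap (sset_fix a) X :=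
  @SMap (sset_fix a) X (fun n x => sval x) (fun _ _ _ _ => erefl).

Lemma sset_fix_lift_subproof (T X : sset) I (a : I -> smap X X) (f : smap T X)
  (af : forall i, smap_comp (a i) f = f) n (x : T n) i : a i n (f n x) = f n x.
Proof. exact: (f_equal (fun h : smap T X => h n x) (af i)). Qed.

Definition sset_fix_lift (T X : sset) I (a : I -> smap X X) (f : smap T X)
  (af : forall i, smap_comp (a i) f = f) : smap T (sset_fix a).
Proof.
refine (@SMap T (sset_fix a)
  (fun n x => exist _ (f n x) (sset_fix_lift_subproof af x)) _).
move=> m n h x; apply: eq_sig_hprop => /=; last exact: smap_nat.
by move=> ?; exact: Prop_irrelevance.
Defined.

Definition sSet : spaces.
Proof.
refine (@Spaces sset_cartesian sset_fix sset_fix_incl _ sset_fix_lift _ _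
  sset_weq (fun X : sset => forall n, X n -> False) sset_gcontractible).
- by move=> X I a i; apply: smapP => n [x ax] /=.
- by move=> T X I a f af; apply: smapP.
- move=> T X I a f g fg; apply: smapP => n x; apply: eq_sig_hprop => /=.
    by move=> ?; exact: Prop_irrelevance.
  exact: (f_equal (fun h : smap T X => h n x) fg).
Defined.

Definition top_comp (X Y Z : topologicalType) (g : continuousType Y Z)
  (f : continuousType X Y) : continuousType X Z := (g \o f)%FUN.

Definition top_id (X : topologicalType) : continuousType X X := @idfun X.

Definition mk_continuous (X Y : topologicalType) (f : X -> Y)
  (cf : continuous f) : continuousType X Y := mkcts cf.

Definition top_category : category.
Proof.
by refine (@Category topologicalType
  (fun X Y => continuousType X Y) top_id top_comp _ _ _);
  move=> *; apply/continuousEP.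
Defined.

Definition top_iprd k (X : 'I_k -> topologicalType) : topologicalType :=
  prod_topology (fun i => X i).

Lemma tuple_subproof (T : topologicalType) k (X : 'I_k -> topologicalType)
  (f : forall i, continuousType T (X i)) :
  continuous ((fun t i => f i t) : T -> top_iprd X).
Proof.
move=> t; apply/cvg_sup => i.
exact: (@continuous_comp_initial _ _ _ (fun h : forall i, X i => h i)
  (fun t i => f i t) (@cts_fun _ _ (f i)) t).
Qed.

Lemma fst_subproof (X Y : topologicalType) : continuous (@fst X Y).
Proof. by move=> p; exact: cvg_fst. Qed.

Lemma snd_subproof (X Y : topologicalType) : continuous (@snd X Y).
Proof. by move=> p; exact: cvg_snd. Qed.

Lemma pair_subproof (T X Y : topologicalType) (f : continuousType T X)
  (g : continuousType T Y) : continuous (fun t => (f t, g t)).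
Proof. by move=> t; apply: cvg_pair; exact: cts_fun. Qed.

Lemma proj_subproof k (X : 'I_k -> topologicalType) i :
  continuous (fun p : top_iprd X => p i).
Proof. exact: (@proj_continuous _ X i). Qed.

Definition top_one : topologicalType := discrete_topology unit.

Definition top_bang (X : topologicalType) : continuousType X top_one :=
  @cst X top_one tt.

Definition top_pair (T X Y : topologicalType) (f : continuousType T X)
  (g : continuousType T Y) : continuousType T (X * Y)%type :=
  mk_continuous (@pair_subproof _ _ _ f g).

Definition top_tuple (T : topologicalType) k (X : 'I_k -> topologicalType)
  (f : forall i, continuousType T (X i)) : continuousType T (top_iprd X) :=
  mk_continuous (@tuple_subproof _ _ X f).

Definition top_cartesian : cartesian.
Proof.
refine (@Cartesian top_category top_one top_bang _
  (fun X Y : topologicalType => (X * Y)%type : topologicalType)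
  (fun X Y => mk_continuous (@fst_subproof X Y))
  (fun X Y => mk_continuous (@snd_subproof X Y)) top_pair _ _ _
  top_iprd (fun k X i => mk_continuous (@proj_subproof k X i)) top_tuple _ _).
- by move=> X f; apply/continuousEP => x; case: (f x).
- by move=> T X Y f g; apply/continuousEP => x.
- by move=> T X Y f g; apply/continuousEP => x.
- move=> T X Y f g fg1 fg2; apply/continuousEP => x.
  have e1 := f_equal (fun h : continuousType T X => h x) fg1.
  have e2 := f_equal (fun h : continuousType T Y => h x) fg2.
  move: e1 e2; rewrite /= /mkcts /=.
  by case: (f x) (g x) => [? ?] [? ?] /= -> ->.
- by move=> T k X f i; apply/continuousEP => x.
- move=> T k X f g fg; apply/continuousEP => x; apply: functional_extensionality_dep => i.
  exact: (f_equal (fun h : continuousType T (X i) => h x) (fg i)).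
Defined.

Section HomotopyGroups.
Context (R : realType).

Definition unit_interval : topologicalType := set_type `[0%R : R, 1%R]%classic.

Lemma zero_in_unit_interval : (0%R : R) \in `[0%R : R, 1%R]%classic.
Proof. by rewrite inE /= in_itv /= lexx ler01. Qed.

Lemma one_in_unit_interval : (1%R : R) \in `[0%R : R, 1%R]%classic.
Proof. by rewrite inE /= in_itv /= lexx ler01. Qed.

Definition I0 : unit_interval := exist _ 0%R zero_in_unit_interval.
Definition I1 : unit_interval := exist _ 1%R one_in_unit_interval.

Definition path_connected_to (X : topologicalType) (x y : X) :=
  exists p : continuousType unit_interval X, p I0 = x /\ p I1 = y.

Definition cube n : topologicalType := top_iprd (fun _ : 'I_n => unit_interval).

Definition cube_boundary n (p : cube n) := exists i, p i = I0 \/ p i = I1.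

(** Representatives of the elements of pi_n(X, x) *)
Definition spheroid n (X : topologicalType) (x : X) (f : continuousType (cube n) X) :=
  forall p, cube_boundary p -> f p = x.

Definition homotopic_rel_boundary n (X : topologicalType)
    (f g : continuousType (cube n) X) :=
  exists h : continuousType (cube n * unit_interval)%type X,
    (forall p, h (p, I0) = f p /\ h (p, I1) = g p) /\
    (forall p t, cube_boundary p -> h (p, t) = f p).

(** Weak homotopy equivalences: bijections on pi_0 and on pi_n(-, x), for n >= 1
    and all basepoints x. *)
Definition top_weq (X Y : topologicalType) (f : continuousType X Y) :=
  [/\ forall x x' : X, path_connected_to (f x) (f x') -> path_connected_to x x',
      forall y : Y, exists x : X, path_connected_to (f x) y
    & forall n (x : X), (0 < n)%N ->
        (forall a b : continuousType (cube n) X, spheroid x a -> spheroid x b ->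
          homotopic_rel_boundary (top_comp f a) (top_comp f b) ->
          homotopic_rel_boundary a b) /\
        (forall c : continuousType (cube n) Y, spheroid (f x) c ->
          exists2 a : continuousType (cube n) X, spheroid x a &
            homotopic_rel_boundary (top_comp f a) c)].

Definition top_gcontractible (gT : finGroupType) (X : gobject gT top_category) :=
  let Y : topologicalType := gobj X in
  let act (g : gT) : continuousType Y Y := gact X g in
  exists (y0 : Y) (h : continuousType (Y * unit_interval)%type Y),
    [/\ forall g, act g y0 = y0,
        forall y, h (y, I0) = y /\ h (y, I1) = y0
      & forall g y t, h (act g y, t) = act g (h (y, t))].

Definition top_fix (X : topologicalType) I (a : I -> continuousType X X) :
  topologicalType := set_type [set x : X | forall i, a i x = x]%classic.

Definition top_fix_incl (X : topologicalType) I (a : I -> continuousType X X) :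
  continuousType (top_fix a) X :=
  mk_continuous (X := top_fix a) (f := set_val) (@initial_continuous _ _ set_val).

Lemma mem_fix_subproof (T X : topologicalType) I (a : I -> continuousType X X)
  (f : continuousType T X) (af : forall i, top_comp (a i) f = f) (x : T) :
  f x \in [set x : X | forall i, a i x = x]%classic.
Proof.
by apply: mem_set => i; exact: (f_equal (fun h : continuousType T X => h x) (af i)).
Qed.

Definition top_fix_lift_fun (T X : topologicalType) I (a : I -> continuousType X X)
  (f : continuousType T X) (af : forall i, top_comp (a i) f = f) (x : T) :
  top_fix a := exist _ (f x) (mem_fix_subproof af x).

Lemma top_fix_lift_subproof (T X : topologicalType) I (a : I -> continuousType X X)
  (f : continuousType T X) (af : forall i, top_comp (a i) f = f) :
  continuous (top_fix_lift_fun af).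
Proof.
apply: (@continuous_comp_initial (top_fix a) _ _ set_val).
exact: (@cts_fun _ _ f).
Qed.

Definition top_fix_lift (T X : topologicalType) I (a : I -> continuousType X X)
  (f : continuousType T X) (af : forall i, top_comp (a i) f = f) :
  continuousType T (top_fix a) := mk_continuous (@top_fix_lift_subproof _ _ _ _ _ af).

Definition Top : spaces.
Proof.
refine (@Spaces top_cartesian top_fix top_fix_incl _ top_fix_lift _ _
  top_weq (fun X : topologicalType => X -> False) top_gcontractible).
- by move=> X I a i; apply/continuousEP => -[x ax] /=; exact: (set_mem ax).
- by move=> T X I a f af; apply/continuousEP.
- move=> T X I a f g fg; apply/continuousEP => x; apply: val_inj.
  exact: (f_equal (fun h : continuousType T X => h x) fg).
Defined.

End HomotopyGroups.

Definition bijection (m n : nat) := {f : 'I_m -> 'I_n | bijective f}.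

Definition bijection_id n : bijection n n.
Proof. by exists id; exists id. Defined.

Definition bijection_comp l m n (t : bijection m n) (s : bijection l m) :
  bijection l n.
Proof.
by exists (fun i => sval t (sval s i)); apply: bij_comp (svalP t) (svalP s).
Defined.

(** A symmetric operad O with levels O(n). The Sigma_n-actions are written as left
    actions (x.s^-1 for the right action x.s) and are packaged as a functor
    [relabel] on finite ordinals and bijections: a bijection with source n has
    target n, and [relabel s] sends an operation with inputs labelled by i to the
    one with inputs labelled by s i.
    The composition gamma takes values in O(n_1 + ... + n_k); through [tagnat.Rank]
    the inputs of a composite are pairs (i, a) with a an input of the i-th operation,
    in lexicographic order. The laws are stated on generalized elements. In each law,
    [r] is the unique bijection with the specified values. *)
Section Operads.
Context (V : cartesian).

Definition elem_gamma (O : nat -> V)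
    (gamma : forall k (n : 'I_k -> nat),
      hom (prd (O k) (iprd (fun i => O (n i)))) (O (\sum_i n i)%N))
    (T : V) k (n : 'I_k -> nat) (x : hom T (O k)) (y : forall i, hom T (O (n i))) :
  hom T (O (\sum_i n i)%N) :=
  gamma k n ∘ prd_pair x (iprd_tuple y).

Record operad := Operad {
  level :> nat -> V;
  relabel : forall m n, bijection m n -> hom (level m) (level n);
  relabel1 : forall n, relabel (bijection_id n) = idm (level n);
  relabelM : forall l m n (t : bijection m n) (s : bijection l m),
    relabel (bijection_comp t s) = relabel t ∘ relabel s;
  op_unit : hom (one V) (level 1);
  op_gamma : forall k (n : 'I_k -> nat),
    hom (prd (level k) (iprd (fun i => level (n i)))) (level (\sum_i n i)%N);
  op_equivariance : forall (T : V) k k' (n : 'I_k -> nat) (n' : 'I_k' -> nat)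
      (s : bijection k k') (t : forall i, bijection (n i) (n' (sval s i)))
      (r : bijection (\sum_i n i)%N (\sum_i n' i)%N)
      (x : hom T (level k)) (y : forall i, hom T (level (n i)))
      (y' : forall i, hom T (level (n' i))),
    (forall i (a : 'I_(n i)),
      sval r (tagnat.Rank i a) = tagnat.Rank (sval s i) (sval (t i) a)) ->
    (forall i, y' (sval s i) = relabel (t i) ∘ y i) ->
    elem_gamma op_gamma (relabel s ∘ x) y' = relabel r ∘ elem_gamma op_gamma x y;
  op_unitl : forall (T : V) n (r : bijection (\sum_(i < 1) n)%N n)
      (y : hom T (level n)),
    (forall a : 'I_n, sval r (tagnat.Rank (p_ := fun _ : 'I_1 => n) ord0 a) = a) ->
    relabel r ∘ elem_gamma op_gamma (op_unit ∘ bang T) (fun _ : 'I_1 => y) = y;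
  op_unitr : forall (T : V) k (r : bijection (\sum_(i < k) 1)%N k)
      (x : hom T (level k)),
    (forall i, sval r (tagnat.Rank (p_ := fun _ : 'I_k => 1%N) i ord0) = i) ->
    relabel r ∘ elem_gamma op_gamma x (fun _ : 'I_k => op_unit ∘ bang T) = x;
  op_assoc : forall (T : V) k (n : 'I_k -> nat) (m : forall i, 'I_(n i) -> nat)
      (r : bijection
        (\sum_(p < \sum_i n i) m (tagnat.sig1 p) (tagnat.sig2 p))%N
        (\sum_(i < k) \sum_(a < n i) m i a)%N)
      (x : hom T (level k)) (y : forall i, hom T (level (n i)))
      (z : forall i (a : 'I_(n i)), hom T (level (m i a))),
    (forall p (b : 'I_(m (tagnat.sig1 p) (tagnat.sig2 p))),
      sval r (tagnat.Rank
                (p_ := fun p => m (tagnat.sig1 p) (tagnat.sig2 p)) p b) =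
      tagnat.Rank (p_ := fun i => (\sum_(a < n i) m i a)%N) (tagnat.sig1 p)
        (tagnat.Rank (p_ := m (tagnat.sig1 p)) (tagnat.sig2 p) b)) ->
    relabel r ∘ elem_gamma op_gamma (elem_gamma op_gamma x y)
                  (fun p => z (tagnat.sig1 p) (tagnat.sig2 p)) =
    elem_gamma op_gamma x (fun i => elem_gamma op_gamma (y i) (z i)) }.

Record is_operad_map (O P : operad) (f : forall n, hom (O n) (P n)) : Prop :=
  IsOperadMap {
    opmap_relabel : forall m n (s : bijection m n),
      f n ∘ relabel O s = relabel P s ∘ f m;
    opmap_unit : f 1%N ∘ op_unit O = op_unit P;
    opmap_gamma : forall (T : V) k (n : 'I_k -> nat) (x : hom T (O k))
        (y : forall i, hom T (O (n i))),
      f _ ∘ elem_gamma (op_gamma O) x y =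
      elem_gamma (op_gamma P) (f k ∘ x) (fun i => f (n i) ∘ y i) }.

Definition operad_map (O P : operad) :=
  {f : forall n, hom (O n) (P n) | is_operad_map f}.

Lemma operad_mapP (O P : operad) (f g : operad_map O P) :
  (forall n, sval f n = sval g n) -> f = g.
Proof.
move=> fg; apply: eq_sig_hprop => [h|]; first exact: Prop_irrelevance.
exact: functional_extensionality_dep.
Qed.

Lemma operad_id_subproof (O : operad) : is_operad_map (fun n => idm (O n)).
Proof.
split=> [m n s||T k n x y]; rewrite ?comp1m ?compm1 //.
by congr elem_gamma; apply: functional_extensionality_dep => i; rewrite comp1m.
Qed.

Lemma operad_comp_subproof (O P Q : operad) (g : operad_map P Q)
  (f : operad_map O P) : is_operad_map (fun n => sval g n ∘ sval f n).
Proof.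
case: f g => [f fP] [g gP] /=; split=> [m n s||T k n x y].
- by rewrite -compmA (opmap_relabel fP) compmA (opmap_relabel gP) -compmA.
- by rewrite -compmA (opmap_unit fP) (opmap_unit gP).
- rewrite -compmA (opmap_gamma fP) (opmap_gamma gP) compmA.
  by congr elem_gamma; apply: functional_extensionality_dep => i; rewrite compmA.
Qed.

Definition operad_category : category.
Proof.
refine (@Category operad operad_map
  (fun O => exist _ _ (@operad_id_subproof O))
  (fun O P Q g f => exist _ _ (operad_comp_subproof g f)) _ _ _).
- by move=> *; apply: operad_mapP => n; rewrite /= compmA.
- by move=> *; apply: operad_mapP => n; rewrite /= comp1m.
- by move=> *; apply: operad_mapP => n; rewrite /= compm1.
Defined.

End Operads.

(** The symmetric group with the usual product (s * t) i = s (t i); the product of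
    ['S_n] composes in the other order. *)
Definition symg (n : nat) := 'S_n.
HB.instance Definition _ n := Finite.on (symg n).

Definition sym_fun n (s : symg n) : 'I_n -> 'I_n := (s : 'S_n).

Definition sym_mul n (s t : symg n) : symg n := ((t : 'S_n) * (s : 'S_n))%g.
Definition sym_one n : symg n := (1 : 'S_n)%g.
Definition sym_inv n (s : symg n) : symg n := ((s : 'S_n)^-1)%g.

Lemma sym_mulA n : associative (@sym_mul n).
Proof. by move=> s t u; rewrite /sym_mul mulgA. Qed.

Lemma sym_mul1g n : left_id (sym_one n) (@sym_mul n).
Proof. by move=> s; rewrite /sym_mul /sym_one mulg1. Qed.

Lemma sym_mulVg n : left_inverse (sym_one n) (@sym_inv n) (@sym_mul n).
Proof. by move=> s; rewrite /sym_mul /sym_inv mulgV. Qed.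

HB.instance Definition _ n :=
  Finite_isGroup.Build (symg n) (@sym_mulA n) (@sym_mul1g n) (@sym_mulVg n).

Lemma sym_funM n (s t : symg n) i : sym_fun (s * t)%g i = sym_fun s (sym_fun t i).
Proof. by rewrite /sym_fun permM. Qed.

Lemma sym_fun1 n i : sym_fun (1%g : symg n) i = i.
Proof. by rewrite /sym_fun perm1. Qed.

Definition sym_bij n (s : symg n) : bijection n n :=
  exist _ (sym_fun s) (injF_bij (@perm_inj _ (s : 'S_n))).

Section GOperads.
Context (gT : finGroupType) (V : spaces).

(** Op^G(V) *)
Definition goperad_category : category := gobject_category gT (operad_category V).

Definition goperad := gobject gT (operad_category V).

Definition goperad_level (O : goperad) (n : nat) : V := level (gobj O) n.

Definition gsym_act (O : goperad) n (p : gT * symg n) :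
    hom (goperad_level O n) (goperad_level O n) :=
  sval (gact O p.1) n ∘ relabel (gobj O) (sym_bij p.2).

(** O(n)^Gamma *)
Definition fixed_points (O : goperad) n (Gamma : {set gT * symg n}) : V :=
  fixp (fun p : {p | p \in Gamma} => gsym_act O (sval p)).

Lemma gsym_act_natural (O P : goperad) (f : @hom goperad_category O P) n
    (p : gT * symg n) :
  gsym_act P p ∘ sval (sval f) n = sval (sval f) n ∘ gsym_act O p.
Proof.
rewrite /gsym_act -compmA -(opmap_relabel (svalP (sval f))) !compmA.
by congr (_ ∘ _); exact: (f_equal (fun h : operad_map _ _ => sval h n) (svalP f p.1)).
Qed.

Lemma fixed_map_subproof (O P : goperad) (f : @hom goperad_category O P) n
    (Gamma : {set gT * symg n}) (p : {p | p \in Gamma}) :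
  gsym_act P (sval p) ∘
    (sval (sval f) n ∘ fixp_incl (fun p : {p | p \in Gamma} => gsym_act O (sval p))) =
  sval (sval f) n ∘ fixp_incl (fun p : {p | p \in Gamma} => gsym_act O (sval p)).
Proof.
by rewrite compmA gsym_act_natural -compmA
  (fixp_inclE (fun p : {p | p \in Gamma} => gsym_act O (sval p))).
Qed.

Definition fixed_map (O P : goperad) (f : @hom goperad_category O P) n
    (Gamma : {set gT * symg n}) :
    hom (fixed_points O Gamma) (fixed_points P Gamma) :=
  fixp_lift (@fixed_map_subproof O P f n Gamma).

Definition has_fixed_points (F : forall n, {set {group gT * symg n}}) (O : goperad) :=
  forall n (Gamma : {group gT * symg n}),
    (Gamma \in F n -> weakly_contractible (fixed_points O Gamma)) /\
    (Gamma \notin F n -> is_empty (fixed_points O Gamma)).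

End GOperads.

(** A finite rooted tree, given by its edges. Vertices are identified with their
    output edges, so that the non-leaf edges are the vertices. [out e] is the output
    edge of the vertex of which e is an input; the root is an input of no vertex and
    [out root = root] by convention. *)
Record tree := Tree {
  edge :> finType;
  root : edge;
  leaves : {set edge};
  out : edge -> edge;
  out_root : out root = root;
  out_connected : forall e, exists k, iter k out e = root;
  out_notin_leaves : forall e, e != root -> out e \notin leaves }.

Definition inputs (T : tree) (e : T) : {set T} :=
  [set d | (d != root T) && (out d == e)].

Definition tree_iso (S T : tree) (f : S -> T) :=
  [/\ bijective f, f (root S) = root T, forall e, (f e \in leaves T) = (e \in leaves S)
    & forall e, f (out e) = out (f e)].

(** The corolla with set of leaves A; [None] is its root. *)
Definition corolla (A : finType) : tree.
Proof.
refine (@Tree (option A : finType) None [set Some a | a in A] (fun _ => None) erefl _ _).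
- by move=> e; exists 1%N.
- by move=> e _; apply/negP => /imsetP[].
Defined.

Definition edges (X : finType) (T : X -> tree) := {x : X & edge (T x)}.

Definition edge_in (X : finType) (T : X -> tree) (x : X) (e : T x) : edges T :=
  Tagged (fun x => edge (T x)) e.
Arguments edge_in {X} T {x} e.

(** G-trees: tuples of trees indexed by a transitive finite G-set, with associative
    and unital isomorphisms T_x -> T_gx. *)
Record gtree (gT : finGroupType) := GTree {
  gindex : finType;
  iact : gT -> gindex -> gindex;
  iact1 : forall x, iact 1%g x = x;
  iactM : forall g h x, iact (g * h)%g x = iact g (iact h x);
  iact_transitive : exists x, forall y, exists g, iact g x = y;
  component :> gindex -> tree;
  eact : forall g x, component x -> component (iact g x);
  eact_iso : forall g x, tree_iso (@eact g x);
  eact1 : forall x (e : component x),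
    edge_in component (eact 1%g e) = edge_in component e;
  eactM : forall g h x (e : component x),
    edge_in component (eact (g * h)%g e) =
    edge_in component (eact g (eact h e)) }.

Definition gtree_iso (gT : finGroupType) (S T : gtree gT) :=
  exists (phi : gindex S -> gindex T) (f : forall y, S y -> T (phi y)),
    [/\ bijective phi, forall g y, phi (iact g y) = iact g (phi y),
        forall y, tree_iso (f y)
      & forall g y (e : S y),
        edge_in T (f _ (eact g e)) =
        edge_in T (eact g (f y e))].

(** The G-corolla (C_(A x))_x determined by a transitive G-set X and a G-set over X
    with fibres A x *)
Section GCorolla.
Context (gT : finGroupType) (X : finType) (iact : gT -> X -> X).
Context (iact1 : forall x, iact 1%g x = x).
Context (iactM : forall g h x, iact (g * h)%g x = iact g (iact h x)).
Context (iact_transitive : exists x, forall y, exists g, iact g x = y).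
Context (A : X -> finType) (act : forall g x, A x -> A (iact g x)).
Context (act1 : forall x (a : A x),
  Tagged (fun x => A x : Type) (act 1%g a) = Tagged (fun x => A x : Type) a).
Context (actM : forall g h x (a : A x),
  Tagged (fun x => A x : Type) (act (g * h)%g a) =
  Tagged (fun x => A x : Type) (act g (act h a))).

Lemma gcorolla_act_inj g x : injective (@act g x).
Proof.
move=> a b ab.
have : Tagged (fun x => A x : Type) a = Tagged (fun x => A x : Type) b.
  by rewrite -act1 -[RHS]act1 -(mulVg g) !actM ab.
by move/eqP; rewrite eq_Tagged => /eqP.
Qed.

Lemma gcorolla_iso_subproof g x :
  @tree_iso (corolla (A x)) (corolla (A (iact g x))) (omap (@act g x)).
Proof.
split=> [||[a|]|] //=.
- apply: inj_card_bij.
    by move=> [a|] [b|] //= [/gcorolla_act_inj ->].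
  rewrite !card_option ltnS.
  have := leq_card _ (@gcorolla_act_inj g^-1%g (iact g x)).
  by rewrite -iactM mulVg iact1.
- by rewrite !mem_imset //; exact: Some_inj.
- by apply/imsetP/imsetP => -[].
Qed.

Definition gcorolla : gtree gT.
Proof.
refine (@GTree gT X iact iact1 iactM iact_transitive (fun x => corolla (A x))
  (fun g x => omap (@act g x)) gcorolla_iso_subproof _ _).
- move=> x [a|] /=; last by rewrite iact1.
  exact: (f_equal (fun u : {x & A x} =>
    Tagged (fun x => edge (corolla (A x))) (Some (tagged u))) (act1 a)).
- move=> g h x [a|] /=; last by rewrite iactM.
  exact: (f_equal (fun u : {x & A x} =>
    Tagged (fun x => edge (corolla (A x))) (Some (tagged u))) (actM g h a)).
Defined.

End GCorolla.

Section GTreeConstructions.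
Context (gT : finGroupType) (T : gtree gT).

Lemma edge_in_inj x (e d : T x) : edge_in T e = edge_in T d -> e = d.
Proof. by move/eqP; rewrite eq_Tagged => /eqP. Qed.

Lemma edge_in_sub (I : finType) (i : I -> gindex T) (P : forall j, {set T (i j)})
    j k (u : {d : T (i j) | d \in P j}) (v : {d : T (i k) | d \in P k}) :
  j = k -> edge_in T (sval u) = edge_in T (sval v) ->
  Tagged (fun j => {d : T (i j) | d \in P j} : Type) u =
  Tagged (fun j => {d : T (i j) | d \in P j} : Type) v.
Proof.
move=> jk; case: k / jk v => v uv; congr Tagged; apply: val_inj.
exact: edge_in_inj.
Qed.

(** lr(T) = (C_(leaves of T_x))_x *)

Lemma eact_leaves_subproof g x (e : {e : T x | e \in leaves (T x)}) :
  eact g (sval e) \in leaves (T (iact g x)).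
Proof. by case: (eact_iso g x) => _ _ -> _; exact: (svalP e). Qed.

Definition lr_act g x (e : {e : T x | e \in leaves (T x)}) :
    {e : T (iact g x) | e \in leaves (T (iact g x))} :=
  exist _ (eact g (sval e)) (eact_leaves_subproof g e).

Definition lr : gtree gT.
Proof.
refine (@gcorolla gT (gindex T) (@iact _ T) (@iact1 _ T) (@iactM _ T)
  (iact_transitive T) (fun x => {e : T x | e \in leaves (T x)} : finType)
  lr_act _ _).
- move=> x a; apply: (@edge_in_sub _ id (fun x => leaves (T x))).
    exact: iact1.
  exact: eact1.
- move=> g h x a; apply: (@edge_in_sub _ id (fun x => leaves (T x))).
    exact: iactM.
  exact: eactM.
Defined.

Definition edges_act (g : gT) (p : edges T) : edges T :=
  edge_in T (eact g (tagged p)).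

Lemma edges_act1 p : edges_act 1%g p = p.
Proof. by case: p => x e; exact: eact1. Qed.

Lemma edges_actM g h p : edges_act (g * h)%g p = edges_act g (edges_act h p).
Proof. by case: p => x e; exact: eactM. Qed.

(** The vertices of the trees T_x, as output edges; V_G(T) is the set of their
    G-orbits. *)
Definition is_vertex (p : edges T) : bool := tagged p \notin leaves (T (tag p)).

Context (v : edges T).

Definition edge_orbit : {set edges T} := [set edges_act g v | g in gT].

Lemma edge_orbit_subproof (g : gT) (p : {p | p \in edge_orbit}) :
  edges_act g (sval p) \in edge_orbit.
Proof.
case: p => p /= /imsetP[h _ ->].
by apply/imsetP; exists (g * h)%g; rewrite ?edges_actM.
Qed.

Definition orbit_act (g : gT) (p : {p | p \in edge_orbit}) : {p | p \in edge_orbit} :=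
  exist _ (edges_act g (sval p)) (edge_orbit_subproof g p).

Lemma orbit_act1 p : orbit_act 1%g p = p.
Proof. by apply: val_inj; exact: edges_act1. Qed.

Lemma orbit_actM g h p : orbit_act (g * h)%g p = orbit_act g (orbit_act h p).
Proof. by apply: val_inj; exact: edges_actM. Qed.

Lemma orbit_act_transitive : exists p, forall q, exists g, orbit_act g p = q.
Proof.
have v_orbit : v \in edge_orbit by apply/imsetP; exists 1%g; rewrite ?edges_act1.
exists (exist _ v v_orbit) => -[q /[dup] /imsetP[g _ qE] q_orbit].
by exists g; apply: val_inj.
Qed.

Definition orbit_inputs (p : {p | p \in edge_orbit}) : {set T (tag (sval p))} :=
  inputs (tagged (sval p)).

Lemma orbit_inputs_subproof g (p : {p | p \in edge_orbit})
    (d : {d : T (tag (sval p)) | d \in orbit_inputs p}) :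
  eact g (sval d) \in orbit_inputs (orbit_act g p).
Proof.
case: d => d /=; rewrite !inE => /andP[d_root /eqP d_out].
have [eact_bij eact_root _ eact_out] := eact_iso g (tag (sval p)).
rewrite -eact_root -eact_out d_out (inj_eq (bij_inj eact_bij)) d_root /=.
exact: eqxx.
Qed.

Definition orbit_inputs_act g (p : {p | p \in edge_orbit})
    (d : {d : T (tag (sval p)) | d \in orbit_inputs p}) :
    {d : T (tag (sval (orbit_act g p))) | d \in orbit_inputs (orbit_act g p)} :=
  exist _ (eact g (sval d)) (orbit_inputs_subproof g d).

(** T_v, indexed by the orbit of v, with at f the corolla on the inputs of f. *)
Definition vertex_gcorolla : gtree gT.
Proof.
refine (@gcorolla gT ({p | p \in edge_orbit} : finType)
  orbit_act orbit_act1 orbit_actM orbit_act_transitive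
  (fun p => {d : T (tag (sval p)) | d \in orbit_inputs p} : finType)
  orbit_inputs_act _ _).
- move=> p d; apply: (@edge_in_sub _ (fun p => tag (sval p)) orbit_inputs).
    exact: orbit_act1.
  exact: eact1.
- move=> g h p d; apply: (@edge_in_sub _ (fun p => tag (sval p)) orbit_inputs).
    exact: orbit_actM.
  exact: eactM.
Defined.

End GTreeConstructions.

Section InducedCorolla.
Context (gT : finGroupType) (H : {group gT}) (n : nat).
Context (phi : {morphism H >-> symg n}).
Local Open Scope group_scope.

Definition cosets := {A : {set gT} | A \in lcosets H [set: gT]}.

Lemma cosets_act_subproof (g : gT) (A : cosets) :
  g *: sval A \in lcosets H [set: gT].
Proof.
case: A => A /= /lcosetsP[x _ ->].
by apply/lcosetsP; exists (g * x); rewrite ?inE // -lcosetM.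
Qed.

Definition cosets_act (g : gT) (A : cosets) : cosets :=
  exist _ (g *: sval A) (cosets_act_subproof g A).

Lemma cosets_act1 A : cosets_act 1 A = A.
Proof. by apply: val_inj; rewrite /= lcoset1. Qed.

Lemma cosets_actM g h A : cosets_act (g * h) A = cosets_act g (cosets_act h A).
Proof. by apply: val_inj; rewrite /= lcosetM. Qed.

Lemma cosets_act_transitive : exists A, forall B, exists g, cosets_act g A = B.
Proof.
have H_coset : (H : {set gT}) \in lcosets H [set: gT].
  by apply/lcosetsP; exists 1; rewrite ?inE // lcoset1.
exists (exist _ (H : {set gT}) H_coset) => -[B /[dup] /lcosetsP[x _ BE] B_coset].
by exists x; apply: val_inj; rewrite /= BE.
Qed.

(** The component at the coset A is C_n; through the representatives of cosets, g acts
    as an element of H. In particular h in H acts on the component at H by phi(h). *)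
Definition induced_act g (A : cosets) (i : 'I_n) : 'I_n :=
  sym_fun (phi ((repr (sval (cosets_act g A)))^-1 * g * repr (sval A))) i.

Lemma repr_coset_act g (A : cosets) :
  (repr (sval (cosets_act g A)))^-1 * g * repr (sval A) \in H.
Proof.
case: A => A /= /lcosetsP[x _ AE].
have /lcosetP[h Hh rA] : repr A \in x *: H.
  by rewrite AE; apply: (mem_repr x); exact: lcoset_refl.
have gAE : g *: A = (g * x) *: H by rewrite AE -lcosetM.
have /lcosetP[k Hk rgA] : repr (g *: A) \in (g * x) *: H.
  by rewrite gAE; apply: (mem_repr (g * x)); exact: lcoset_refl.
by rewrite rA rgA !invMg !mulgA !mulgKV groupM ?groupV.
Qed.

(** G ._H C_n, with H acting on C_n through phi *)
Definition induced_gcorolla : gtree gT.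
Proof.
refine (@gcorolla gT (cosets : finType) cosets_act cosets_act1 cosets_actM
  cosets_act_transitive (fun _ => 'I_n : finType) induced_act _ _).
- move=> A i.
  have -> : induced_act 1 A i = i.
    by rewrite /induced_act cosets_act1 mulg1 mulVg morph1 sym_fun1.
  by rewrite cosets_act1.
- move=> g h A i.
  have -> : induced_act (g * h) A i = induced_act g (cosets_act h A) (induced_act h A i).
    rewrite /induced_act -sym_funM -morphM ?repr_coset_act // -cosets_actM.
    by rewrite !mulgA mulgK.
  by rewrite cosets_actM.
Defined.

End InducedCorolla.

Section Families.
Context (gT : finGroupType).

Definition is_family n (F : {set {group gT * symg n}}) :=
  (forall Gamma Delta : {group gT * symg n},
     Gamma \in F -> Delta \subset Gamma -> Delta \in F) /\
  (forall (Gamma : {group gT * symg n}) x, Gamma \in F -> (Gamma :^ x)%G \in F).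

Definition graph_subgroup n (Gamma : {group gT * symg n}) :=
  forall s : symg n, (1%g, s) \in Gamma -> s = 1%g.

Definition collection := forall n, {set {group gT * symg n}}.

Definition consists_of_graph_subgroups (F : collection) :=
  forall n (Gamma : {group gT * symg n}), Gamma \in F n -> graph_subgroup Gamma.

(** The G-corollas isomorphic to some G ._H C_n with H acting through phi, for phi with
    graph in F_n. *)
Definition in_sieve (F : collection) (T : gtree gT) :=
  exists n (H : {group gT}) (phi : {morphism H >-> symg n}) (Gamma : {group gT * symg n}),
    [/\ Gamma \in F n, (Gamma : {set _}) = [set (h, phi h) | h in H]
      & gtree_iso (induced_gcorolla phi) T].

Definition F_tree (F : collection) (T : gtree gT) :=
  forall v : edges T, is_vertex v -> in_sieve F (vertex_gcorolla v).

Definition weak_indexing_system (F : collection) :=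
  [/\ forall n, is_family (F n),
      consists_of_graph_subgroups F
    & forall T : gtree gT, F_tree F T -> in_sieve F (lr T)].

Definition trivial_graph n (H : {group gT}) : {group gT * symg n} := setX_group H 1%G.

Definition indexing_system (F : collection) :=
  weak_indexing_system F /\ forall n H, trivial_graph n H \in F n.

Definition indexing_category : category.
Proof.
refine (@Category {F : collection | indexing_system F}
  (fun F F' => forall n, sval F n \subset sval F' n)
  (fun F n => subxx _)
  (fun F F' F'' h k n => fintype.subset_trans (k n) (h n)) _ _ _);
  by move=> *; exact: Prop_irrelevance.
Defined.

End Families.

Section NInfinity.
Context (gT : finGroupType) (V : spaces).

Definition glevel (O : goperad gT V) (n : nat) : gobject gT V.
Proof.
refine (@GObject gT V (goperad_level O n) (fun g => sval (gact O g) n) _ _).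
- by rewrite gact1.
- by move=> g h; rewrite gactM.
Defined.

Definition is_Ninfty (O : goperad gT V) :=
  [/\ gcontractible (glevel O 0),
      forall n (s : symg n), s != 1%g ->
        is_empty (fixp (fun _ : unit => relabel (gobj O) (sym_bij s)))
    & exists F : collection gT,
        [/\ forall n, is_family (F n), forall n H, trivial_graph n H \in F n
          & has_fixed_points F O]].

Definition Ninfty_category : category :=
  full_subcategory (C := goperad_category gT V) is_Ninfty.

Definition Ninfty_weq (O P : Ninfty_category) (f : hom O P) :=
  forall n (Gamma : {group gT * symg n}), weq (fixed_map f Gamma).

Definition Ho_Ninfty : category := localization Ninfty_weq.

End NInfinity.

(* Main.v *)
(** The functor of points from V to sets has a right adjoint, given by the indiscrete
    topology if V = Top and by the 0-coskeleton if V = sSet. It preserves products and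
    fixed points, and its nonempty values are weakly contractible. Hence an operad P in
    G-sets such that P(n)^Gamma is nonempty exactly when Gamma is in F_n gives an
    NF-operad.

    For a weak indexing system F, take for P(n) the terms with variables 1, ..., n, each
    used once, built from Sigma-free symbols with stabilizers in F. A term fixed by Gamma
    with root symbol s and subterms x_i defines a two-level G-tree: its root vertex is
    controlled by the stabilizer of s, and by induction its upper vertices are controlled
    by the subgroups of Gamma which fix i. So Gamma is in F_n by closure under lr. The
    symbols themselves provide all the required fixed points.

    Conversely, let P(n)^Gamma be nonempty exactly when Gamma is in F_n, and let T be an
    F-tree. Operations fixed by the graph subgroups of the corollas T_v extend to an
    equivariant family of operations at the vertices of T; the composite along T is
    equivariant, and its stabilizer is the graph subgroup of lr(T).

    Let EU(O) be the codiscrete operad on the points of O. If O is N-infinity then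
    O -> EU(O) is a weak equivalence, and if F(O) is contained in F(P) then so is the
    left projection in EU(O) <- E(U(O) x U(P)) -> EU(P). A formal argument shows that the
    resulting zigzag is the only morphism from O to P in the homotopy category. *)

From Pilot Require Import Defs.
From Stdlib Require Eqdep_dec PeanoNat.
From mathcomp Require Import all_boot all_order all_algebra all_fingroup.
From mathcomp Require Import all_classical all_reals all_analysis.
Import Pilot.Defs.

Set Implicit Arguments.
Unset Strict Implicit.
Unset Printing Implicit Defensive.

Local Open Scope cat_scope.

(** * Points and codiscrete objects *)

(** The points [hom (one V) X], as a type in a universe small enough for [cod] below. *)
Record points (V : spaces) := Points {
  pts : V -> Type;
  pt : forall X : V, pts X -> hom (one V) X;
  unpt : forall X : V, hom (one V) X -> pts X;
  ptK : forall X, cancel (@pt X) (@unpt X);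
  unptK : forall X, cancel (@unpt X) (@pt X) }.

Section Points.
Context (V : spaces) (U : points V).

Definition pts_map (X Y : V) (f : hom X Y) (x : pts U X) : pts U Y :=
  unpt U (f ∘ pt x).

Lemma pt_pts_map (X Y : V) (f : hom X Y) (x : pts U X) :
  pt (pts_map f x) = f ∘ pt x.
Proof. exact: unptK. Qed.

Lemma pt_inj (X : V) : injective (@pt V U X).
Proof. exact: can_inj (@ptK V U X). Qed.

Lemma pts_map1 (X : V) (x : pts U X) : pts_map (idm X) x = x.
Proof. by apply: pt_inj; rewrite pt_pts_map comp1m. Qed.

Lemma pts_mapM (X Y Z : V) (g : hom Y Z) (f : hom X Y) (x : pts U X) :
  pts_map (g ∘ f) x = pts_map g (pts_map f x).
Proof. by apply: pt_inj; rewrite !pt_pts_map compmA. Qed.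

(** For V = Top these are the indiscrete spaces, for V = sSet the 0-coskeletal simplicial sets. *)
Definition codiscrete (Y : V) := forall (T : V) (phi : pts U T -> pts U Y),
  exists2 f : hom T Y, pts_map f =1 phi & forall g : hom T Y, pts_map g =1 phi -> g = f.

Lemma codiscrete_ext (T Y : V) (f g : hom T Y) :
  codiscrete Y -> pts_map f =1 pts_map g -> f = g.
Proof.
by move=> cY fg; have [h _ hu] := cY T (pts_map g); rewrite (hu f) // (hu g).
Qed.

Lemma pts_fixp (X : V) (I : Type) (a : I -> hom X X) :
  (exists x : pts U X, forall i, pts_map (a i) x = x) <-> inhabited (pts U (fixp a)).
Proof.
split=> [[x ax]|[y]].
- have aptx i : a i ∘ pt x = pt x by rewrite -pt_pts_map ax.
  by constructor; exact: (unpt U (fixp_lift aptx)).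
- exists (pts_map (fixp_incl a) y) => i; rewrite -pts_mapM.
  by congr (pts_map _ y); exact: fixp_inclE.
Qed.

(** A function into the points of [fixp a] extends to a map into X. Each [a i] fixes this map, since
    maps into X are determined on points, so the map lifts to [fixp a]. *)
Lemma codiscrete_fixp (X : V) (I : Type) (a : I -> hom X X) :
  codiscrete X -> codiscrete (fixp a).
Proof.
move=> cX T phi.
have [f fE _] := cX T (fun t => pts_map (fixp_incl a) (phi t)).
have af i : a i ∘ f = f.
  apply: codiscrete_ext => // t; rewrite pts_mapM fE -pts_mapM.
  by congr (pts_map _ _); exact: fixp_inclE.
have incl_inj (S : V) (g h : hom S (fixp a)) :
  pts_map (fixp_incl a ∘ g) =1 pts_map (fixp_incl a ∘ h) -> g = h.
  by move=> gh; apply: fixp_uniq; apply: codiscrete_ext.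
have lE : pts_map (fixp_lift af) =1 phi.
  move=> t; apply: pt_inj; apply: incl_inj => s.
  rewrite pt_pts_map compmA fixp_liftE -pt_pts_map fE pt_pts_map.
  by [].
exists (fixp_lift af) => // g gE; apply: incl_inj => t.
by rewrite !pts_mapM gE lE.
Qed.

End Points.

(** The interface between V and the rest of the proof: the right adjoint [cod] of the functor of
    points, together with the facts that reduce weak equivalence, emptiness and G-contractibility to
    the existence of points. *)
Record codisc (V : spaces) := Codisc {
  cpts :> points V;
  cod : Type -> V;
  cod_val : forall X, pts cpts (cod X) -> X;
  cod_elem : forall X, X -> pts cpts (cod X);
  cod_valK : forall X, cancel (@cod_val X) (@cod_elem X);
  cod_elemK : forall X, cancel (@cod_elem X) (@cod_val X);
  codiscrete_cod : forall X, codiscrete cpts (cod X);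
  weq_contractible : forall (X Y : V) (f : hom X Y),
    weakly_contractible X -> weakly_contractible Y -> weq f;
  weq_empty : forall (X Y : V) (f : hom X Y),
    (pts cpts X -> False) -> (pts cpts Y -> False) -> weq f;
  weq_pts : forall (X Y : V) (f : hom X Y),
    weq f -> inhabited (pts cpts Y) -> inhabited (pts cpts X);
  is_emptyE : forall X : V, is_empty X <-> ~ inhabited (pts cpts X);
  codiscrete_contractible : forall X : V,
    codiscrete cpts X -> pts cpts X -> weakly_contractible X;
  gcontractible_pts : forall (gT : finGroupType) (X : gobject gT V),
    gcontractible X ->
    exists x : pts cpts (gobj X), forall g, pts_map (gact X g) x = x;
  codiscrete_gcontractible : forall (gT : finGroupType) (X : gobject gT V),
    codiscrete cpts (gobj X) ->
    (exists x : pts cpts (gobj X), forall g, pts_map (gact X g) x = x) ->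
    gcontractible X }.

(** * The 0-coskeleton and weak equivalences of simplicial sets *)

Section SimplicialSets.

Definition sset_pt_map (X : sset) (x : X 0) : smap sset_one X.
Proof.
refine (@SMap sset_one X (fun n _ => sact (simp_const n (@ord0 0)) x) _).
by move=> m n f _ /=; rewrite -sactM; congr sact; apply: simp_opP.
Defined.

Definition sset_points : points sSet.
Proof.
refine (@Points sSet (fun X : sset => X 0) sset_pt_map
  (fun (X : sset) (f : smap sset_one X) => f 0 tt) _ _).
- move=> X x /=; rewrite -[RHS]sact1; congr sact; apply: simp_opP => i.
  by rewrite /= [i]ord1.
- move=> X f; apply: smapP => n [] /=.
  by rewrite -smap_nat.
Defined.

Definition sset_vertex (X : sset) n (x : X n) (i : 'I_n.+1) : X 0 :=
  sact (simp_const 0 i) x.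

(** The 0-coskeleton: an n-simplex is an arbitrary sequence of n + 1 vertices. *)
Definition sset_cod (X : Type) : sset.
Proof.
by refine (@SSet (fun n => 'I_n.+1 -> X) (fun m n f x i => x (sval f i)) _ _).
Defined.

Definition sset_cod_map (T : sset) (X : Type) (phi : T 0 -> X) : smap T (sset_cod X).
Proof.
refine (@SMap T (sset_cod X) (fun n t i => phi (sset_vertex t i)) _).
move=> m n f x; apply/funext => i /=; congr phi.
by rewrite /sset_vertex -sactM; congr sact; apply: simp_opP.
Defined.

Lemma sset_pts_mapE (X Y : sset) (f : smap X Y) (x : X 0) :
  @pts_map sSet sset_points X Y f x = f 0 x.
Proof.
rewrite /pts_map /=; congr (f 0 _).
exact: (@ptK sSet sset_points X x).
Qed.

Lemma sset_codiscrete_cod X : @codiscrete sSet sset_points (sset_cod X).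
Proof.
move=> T phi; exists (sset_cod_map (fun t => phi t ord0)) => [t|g gE].
  rewrite sset_pts_mapE; apply/funext => i /=; rewrite [i]ord1 /sset_vertex.
  congr (phi _ _); rewrite -[RHS]sact1; congr sact; apply: simp_opP => j.
  by rewrite /= [j]ord1.
apply: smapP => n t; apply/funext => i /=.
have := gE (sset_vertex t i); rewrite sset_pts_mapE /sset_vertex smap_nat.
by move/(congr1 (fun u => u ord0)).
Qed.

Lemma same_component_comp (X Y K : sset) (a b : smap Y K) (f : smap X Y) :
  same_component a b -> same_component (smap_comp a f) (smap_comp b f).
Proof.
elim=> [{a b}a b [h hP]|{a b}a|{a b}a b _|{a b}a b c _ ab _ bc].
- apply: Relation_Operators.rst_step.
  exists (smap_comp h (sset_pair (smap_comp f (sset_fst X (simplex 1))) (sset_snd _ _))).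
  by move=> n x /=; have [<- <-] := hP n (f n x).
- exact: Relation_Operators.rst_refl.
- exact: Relation_Operators.rst_sym.
- exact: Relation_Operators.rst_trans ab bc.
Qed.

(** Two out of three: for every Kan complex K, the maps to the point identify the components of
    Map(X, K) and of Map(Y, K) with those of K, compatibly with f. *)
Lemma sset_weq_contractible (X Y : sset) (f : smap X Y) :
  sset_weq (sset_bang X) -> sset_weq (sset_bang Y) -> sset_weq f.
Proof.
move=> wX wY K kK; have [iX sX] := wX K kK; have [iY sY] := wY K kK.
have bangE : smap_comp (sset_bang Y) f = sset_bang X by apply: smapP.
have compA (a : smap sset_one K) :
    smap_comp (smap_comp a (sset_bang Y)) f = smap_comp a (sset_bang X).
  by apply: smapP.
split=> [a b ab|c].
  have [a' aa'] := sY a; have [b' bb'] := sY b.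
  have a'b' : same_component a' b'.
    apply: iX; rewrite -!compA.
    apply: Relation_Operators.rst_trans; first exact: same_component_comp aa'.
    apply: Relation_Operators.rst_trans; first exact: ab.
    by apply: same_component_comp; exact: Relation_Operators.rst_sym.
  apply: Relation_Operators.rst_trans; first exact: Relation_Operators.rst_sym aa'.
  apply: Relation_Operators.rst_trans bb'.
  exact: same_component_comp.
have [c' c'c] := sX c; exists (smap_comp c' (sset_bang Y)).
by rewrite compA.
Qed.

Lemma sset_map0 (X : sset) : (X 0 -> False) -> forall n, X n -> False.
Proof. by move=> X0 n x; apply: X0; exact: (sset_vertex x ord0). Qed.

Lemma sset_weq_empty (X Y : sset) (f : smap X Y) :
  (X 0 -> False) -> (Y 0 -> False) -> sset_weq f.
Proof.
move=> /sset_map0 X0 /sset_map0 Y0 K kK; split=> [a b _|c].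
  have -> : a = b by apply: smapP => n y; case: (Y0 n y).
  exact: Relation_Operators.rst_refl.
exists (@SMap Y K (fun n y => match Y0 n y with end) (fun m n f y => match Y0 n y with end)).
set c' := smap_comp _ _; have -> : c' = c by apply: smapP => n x; case: (X0 n x).
exact: Relation_Operators.rst_refl.
Qed.

Definition sset_void : sset.
Proof.
by refine (@SSet (fun _ => void) (fun _ _ _ x => x) _ _).
Defined.

(** Horns are nonempty. *)
Lemma kan_void : kan_complex sset_void.
Proof.
move=> n k u; exfalso.
have hk : exists2 i, i != k & forall j : 'I_1, sval (simp_const 0 k) j != i.
  have [i ik] : exists i : 'I_n.+2, i != k.
    have [->|k0] := eqVneq k ord0; first by exists ord_max.
    by exists ord0; rewrite eq_sym.
  by exists i => // j; rewrite eq_sym.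
by case: (u 0 (exist _ (simp_const 0 k) hk)).
Qed.

(** The test object is the empty Kan complex: if X were empty it would map there, hence so would Y,
    by surjectivity on components. *)
Lemma sset_weq_pts (X Y : sset) (f : smap X Y) :
  sset_weq f -> inhabited (Y 0) -> inhabited (X 0).
Proof.
move=> /(_ _ kan_void)[_ s] [y]; apply: contrapT => nX.
have X0 : X 0 -> False by move=> x; apply: nX.
have [a _] := s (@SMap X sset_void (fun n x => match sset_map0 X0 x with end)
  (fun m n f x => match sset_map0 X0 x with end)).
by case: (a 0 y).
Qed.

Lemma sset_codiscrete_contractible (X : sset) :
  @codiscrete sSet sset_points X -> X 0 -> sset_weq (sset_bang X).
Proof.
move=> cX x0 K kK; pose p := sset_pt_map x0.
have pK (a : smap sset_one K) : smap_comp (smap_comp a (sset_bang X)) p = a.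
  by apply: smapP => n [].
split=> [a b ab|c]; first by rewrite -[a]pK -[b]pK; exact: same_component_comp.
exists (smap_comp c p).
(* The contraction is prescribed on vertices, as constant at x0 at the start of the interval and the
   identity at its end; codiscreteness extends it to all simplices. *)
have [h hE _] := cX (sset_prd X (simplex 1))
  (fun q : sset_prd X (simplex 1) 0 =>
     if sval (q.2 : simp_op 0 1) ord0 == ord0 then x0 else q.1).
have incl_nat (j : 'I_2) m n (f : simp_op m n) (x : X n) :
  ((sact f x, simp_const m j) : sset_prd X (simplex 1) m) =
  sact f ((x, simp_const n j) : sset_prd X (simplex 1) n).
  by congr pair; apply: simp_opP.
pose incl j := @SMap X (sset_prd X (simplex 1)) (fun n x => (x, simp_const n j)) (incl_nat j).
have h0 : smap_comp h (incl ord0) = smap_comp p (sset_bang X).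
  apply: (codiscrete_ext (U := sset_points) cX) => x.
  have := hE ((x, simp_const 0 ord0) : sset_prd X (simplex 1) 0).
  rewrite !sset_pts_mapE /= => ->.
  rewrite -[LHS]sact1; congr sact; apply: simp_opP => i; by rewrite /= [i]ord1.
have h1 : smap_comp h (incl ord_max) = smap_id X.
  apply: (codiscrete_ext (U := sset_points) cX) => x.
  have := hE ((x, simp_const 0 ord_max) : sset_prd X (simplex 1) 0).
  by rewrite !sset_pts_mapE /= => ->.
apply: Relation_Operators.rst_step; exists (smap_comp c h) => n x; split.
  exact: (congr1 (fun u : smap X X => c n (u n x)) h0).
exact: (congr1 (fun u : smap X X => c n (u n x)) h1).
Qed.

Definition sset_codisc : codisc sSet.
Proof.
refine (@Codisc sSet sset_points sset_cod (fun X x => x ord0) (fun X x _ => x) _ _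
  sset_codiscrete_cod sset_weq_contractible sset_weq_empty sset_weq_pts
  _ sset_codiscrete_contractible _ _).
- by move=> X x /=; apply/funext => i; rewrite [i]ord1.
- by [].
- move=> X; split=> [X0 [x]|X0 n x]; first exact: X0 x.
  by apply: X0; constructor; exact: (sset_vertex x ord0).
(* The fixed points of the whole group are weakly contractible, hence contain a vertex. *)
- move=> gT X gcX; have [[x xE]] := sset_weq_pts (gcX [set: gT]%G) (inhabits tt).
  exists x => g; rewrite sset_pts_mapE.
  have gin : g \in [set: gT]%G by rewrite inE.
  exact: (xE (exist _ g gin)).
- move=> gT X cX [x xE] H; apply: sset_codiscrete_contractible.
    exact: (codiscrete_fixp (U := sset_points)).
  by exists x => i; rewrite -[RHS](xE (sval i)) sset_pts_mapE.
Defined.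

End SimplicialSets.

Lemma contractible_pts (V : spaces) (C : codisc V) (X : V) :
  weakly_contractible X -> inhabited (pts C X).
Proof. by move/weq_pts; apply; constructor; exact: (unpt C (idm (one V))). Qed.

(** * Indiscrete spaces and weak equivalences of topological spaces *)

Section TopologicalSpaces.
Context (R : realType).

Lemma I01 : (I1 R == I0 R) = false.
Proof. by apply/eqP => /(congr1 sval) /eqP; rewrite /= GRing.oner_eq0. Qed.

Definition top_pt_map (X : topologicalType) (x : X) : continuousType top_one X :=
  @cst top_one X x.

Definition top_points : points (Top R).
Proof.
refine (@Points (Top R) (fun X : topologicalType => X) top_pt_map
  (fun (X : topologicalType) (f : continuousType top_one X) => f tt) _ _).
- by [].
- by move=> X f; apply/continuousEP => -[].
Defined.

(** The initial topology of a map to a point is the indiscrete one; [{classic X}] gives an arbitrary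
    type the choice structure that spaces carry. *)
Definition top_cod (X : Type) : topologicalType :=
  initial_topology (fun _ : {classic X} => tt : discrete_topology unit).

Lemma top_cod_continuous (T : topologicalType) (X : Type) (f : T -> top_cod X) :
  continuous f.
Proof.
apply: (@continuous_comp_initial (top_cod X)).
exact: (@cts_fun _ _ (@cst T (discrete_topology unit) tt)).
Qed.

Lemma top_codiscrete_cod X : @codiscrete (Top R) top_points (top_cod X).
Proof.
move=> T phi; exists (mk_continuous (@top_cod_continuous T X phi)) => [//|g gE].
exact/continuousEP.
Qed.

(** In a space weakly equivalent to the point, any two points are joined by a path and any two
    spheroids at the same base point are homotopic, so each condition on f holds. *)
Lemma top_weq_contractible (X Y : topologicalType) (f : continuousType X Y) :
  top_weq R (top_bang X) -> top_weq R (top_bang Y) -> top_weq R f.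
Proof.
have pathc (Z : topologicalType) : top_weq R (top_bang Z) ->
    forall z z' : Z, path_connected_to R z z'.
  case=> /[swap] _ pZ _ z z'; apply: pZ.
  by exists (@cst (unit_interval R) top_one tt).
have htpy (Z : topologicalType) n (a b : continuousType (cube R n) Z) z :
    top_weq R (top_bang Z) -> (0 < n)%N -> spheroid z a -> spheroid z b ->
    homotopic_rel_boundary a b.
  case=> _ _ iZ n0 za zb; apply: (iZ n z n0).1 => //.
  by exists (@cst _ top_one tt).
move=> wX wY; split=> [x x' _|y|n x n0]; first exact: pathc.
  have [_ /(_ tt)[x _] _] := wX.
  by exists x; exact: pathc.
split=> [a b xa xb _|c fxc]; first exact: htpy xa xb.
exists (@cst (cube R n) X x) => //.
exact: htpy fxc.
Qed.

Lemma top_weq_empty (X Y : topologicalType) (f : continuousType X Y) :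
  (X -> False) -> (Y -> False) -> top_weq R f.
Proof. by move=> X0 Y0; split=> [x|y|n x]; [case: (X0 x)|case: (Y0 y)|case: (X0 x)]. Qed.

Lemma top_codiscrete_continuous (X T : topologicalType) (phi : T -> X) :
  @codiscrete (Top R) top_points X -> continuous phi.
Proof.
move=> cX; have [f fE _] := cX T phi.
suff -> : phi = f by exact: (@cts_fun _ _ f).
by apply/funext => t; rewrite -fE.
Qed.

Lemma top_codiscrete_contractible (X : topologicalType) :
  @codiscrete (Top R) top_points X -> X -> top_weq R (top_bang X).
Proof.
move=> cX x0.
split=> [x x' _|[]|n x _].
(* Every function into X is continuous, so a path may jump from x to x' immediately after time 0. *)
- exists (mk_continuous (@top_codiscrete_continuous _ (unit_interval R)
    (fun t => if t == I0 R then x else x') cX)).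
  by rewrite /= /mkcts /= eqxx I01.
- by exists x0, (@cst (unit_interval R) top_one tt).
split=> [a b xa xb _|c _].
  (* The homotopy equals a until the last moment, when it jumps to b. *)
  exists (mk_continuous (@top_codiscrete_continuous _ (cube R n * unit_interval R)%type
    (fun q => if q.2 == I1 R then b q.1 else a q.1) cX)).
  rewrite /= /mkcts /=; split=> [p|p t pb]; first by rewrite eqxx eq_sym I01.
  by case: ifP => // _; rewrite xa // xb.
exists (@cst (cube R n) X x) => //.
by exists (@cst _ top_one tt); split=> [p|p t _]; rewrite /=; case: (c p).
Qed.

Definition top_codisc : codisc (Top R).
Proof.
refine (@Codisc (Top R) top_points top_cod (fun X x => x) (fun X x => x) _ _
  top_codiscrete_cod top_weq_contractible top_weq_empty _
  _ top_codiscrete_contractible _ _).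
- by [].
- by [].
- by move=> X Y f [_ s _] [y]; have [x _] := s y; constructor.
- move=> X; split=> [X0 [x]|X0 x]; first exact: X0 x.
  by apply: X0; constructor.
- by move=> gT X [y0 [h [yf _ _]]]; exists y0.
- move=> gT X cX [y0 yf]; exists y0.
  (* The identity at time 0 and constant at y0 afterwards; it is equivariant because y0 is fixed. *)
  exists (mk_continuous (@top_codiscrete_continuous (gobj X)
    ((gobj X : topologicalType) * unit_interval R)%type
    (fun q => if q.2 == I0 R then q.1 else y0) cX)).
  rewrite /= /mkcts /=; split=> [//|y|g y t]; first by rewrite eqxx I01.
  by case: ifP => // _; rewrite -[LHS](yf g).
Defined.

End TopologicalSpaces.

(** * Operads in G-sets *)

(** G-operads in sets, with the laws of [operad] and of [gobject] *)
Record dgop (gT : finGroupType) := DGop {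
  dlev :> nat -> Type;
  dact : gT -> forall n, dlev n -> dlev n;
  drel : forall m n, bijection m n -> dlev m -> dlev n;
  dunit : dlev 1;
  dgam : forall k (n : 'I_k -> nat),
    dlev k -> (forall i, dlev (n i)) -> dlev (\sum_i n i)%N;
  dact1 : forall n (x : dlev n), dact 1%g x = x;
  dactM : forall g h n (x : dlev n), dact (g * h)%g x = dact g (dact h x);
  drel1 : forall n (x : dlev n), drel (bijection_id n) x = x;
  drelM : forall l m n (t : bijection m n) (s : bijection l m) (x : dlev l),
    drel (bijection_comp t s) x = drel t (drel s x);
  dact_rel : forall g m n (s : bijection m n) (x : dlev m),
    dact g (drel s x) = drel s (dact g x);
  dact_unit : forall g, dact g dunit = dunit;
  dact_gam : forall g k (n : 'I_k -> nat) (x : dlev k) (y : forall i, dlev (n i)),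
    dact g (dgam x y) = dgam (dact g x) (fun i => dact g (y i));
  dequivariance : forall k k' (n : 'I_k -> nat) (n' : 'I_k' -> nat)
      (s : bijection k k') (t : forall i, bijection (n i) (n' (sval s i)))
      (r : bijection (\sum_i n i)%N (\sum_i n' i)%N)
      (x : dlev k) (y : forall i, dlev (n i)) (y' : forall i, dlev (n' i)),
    (forall i (a : 'I_(n i)),
      sval r (tagnat.Rank i a) = tagnat.Rank (sval s i) (sval (t i) a)) ->
    (forall i, y' (sval s i) = drel (t i) (y i)) ->
    dgam (drel s x) y' = drel r (dgam x y);
  dunitl : forall n (r : bijection (\sum_(i < 1) n)%N n) (y : dlev n),
    (forall a : 'I_n, sval r (tagnat.Rank (p_ := fun _ : 'I_1 => n) ord0 a) = a) ->
    drel r (dgam dunit (fun _ : 'I_1 => y)) = y;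
  dunitr : forall k (r : bijection (\sum_(i < k) 1)%N k) (x : dlev k),
    (forall i, sval r (tagnat.Rank (p_ := fun _ : 'I_k => 1%N) i ord0) = i) ->
    drel r (dgam x (fun _ : 'I_k => dunit)) = x;
  dassoc : forall k (n : 'I_k -> nat) (m : forall i, 'I_(n i) -> nat)
      (r : bijection
        (\sum_(p < \sum_i n i) m (tagnat.sig1 p) (tagnat.sig2 p))%N
        (\sum_(i < k) \sum_(a < n i) m i a)%N)
      (x : dlev k) (y : forall i, dlev (n i))
      (z : forall i (a : 'I_(n i)), dlev (m i a)),
    (forall p (b : 'I_(m (tagnat.sig1 p) (tagnat.sig2 p))),
      sval r (tagnat.Rank
                (p_ := fun p => m (tagnat.sig1 p) (tagnat.sig2 p)) p b) =
      tagnat.Rank (p_ := fun i => (\sum_(a < n i) m i a)%N) (tagnat.sig1 p)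
        (tagnat.Rank (p_ := m (tagnat.sig1 p)) (tagnat.sig2 p) b)) ->
    drel r (dgam (dgam x y) (fun p => z (tagnat.sig1 p) (tagnat.sig2 p))) =
    dgam x (fun i => dgam (y i) (z i)) }.

Section DiscreteMaps.
Context (gT : finGroupType).

Record dgop_map (D D' : dgop gT) := DGopMap {
  dmap_fun :> forall n, D n -> D' n;
  dmap_act : forall g n (x : D n), dmap_fun (dact g x) = dact g (dmap_fun x);
  dmap_rel : forall m n (s : bijection m n) (x : D m),
    dmap_fun (drel s x) = drel s (dmap_fun x);
  dmap_unit : dmap_fun (dunit D) = dunit D';
  dmap_gam : forall k (n : 'I_k -> nat) (x : D k) (y : forall i, D (n i)),
    dmap_fun (dgam x y) = dgam (dmap_fun x) (fun i => dmap_fun (y i)) }.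

Definition dmap_id (D : dgop gT) : dgop_map D D.
Proof. by refine (@DGopMap D D (fun n x => x) _ _ _ _). Defined.

Definition dmap_comp (D D' D'' : dgop gT) (f' : dgop_map D' D'') (f : dgop_map D D') :
  dgop_map D D''.
Proof.
refine (@DGopMap D D'' (fun n x => f' n (f n x)) _ _ _ _).
- by move=> *; rewrite !dmap_act.
- by move=> *; rewrite !dmap_rel.
- by rewrite !dmap_unit.
- by move=> *; rewrite !dmap_gam.
Defined.

Definition dprod (D D' : dgop gT) : dgop gT.
Proof.
refine (@DGop gT (fun n => (D n * D' n)%type)
  (fun g n x => (dact g x.1, dact g x.2))
  (fun m n s x => (drel s x.1, drel s x.2)) (dunit D, dunit D')
  (fun k n x y => (dgam x.1 (fun i => (y i).1), dgam x.2 (fun i => (y i).2)))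
  _ _ _ _ _ _ _ _ _ _ _).
- by move=> n [x x']; rewrite !dact1.
- by move=> g h n [x x']; rewrite !dactM.
- by move=> n [x x']; rewrite !drel1.
- by move=> l m n t s [x x']; rewrite !drelM.
- by move=> g m n s [x x']; rewrite !dact_rel.
- by move=> g; rewrite !dact_unit.
- by move=> g k n x y; rewrite !dact_gam.
- move=> k k' n n' s t r x y y' rE yE.
  by congr pair; apply: (dequivariance _ rE) => i; rewrite yE.
- by move=> n r [y y'] rE /=; congr pair; exact: dunitl.
- by move=> n r [y y'] rE /=; congr pair; exact: dunitr.
- move=> k n m r x y z rE /=.
  by congr pair; [rewrite -(dassoc _ _ (fun i a => (z i a).1) rE)
    | rewrite -(dassoc _ _ (fun i a => (z i a).2) rE)].
Defined.

Definition dpair (D D' D'' : dgop gT) (f : dgop_map D D') (f' : dgop_map D D'') :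
  dgop_map D (dprod D' D'').
Proof.
refine (@DGopMap D (dprod D' D'') (fun n x => (f n x, f' n x)) _ _ _ _).
- by move=> *; rewrite !dmap_act.
- by move=> *; rewrite !dmap_rel.
- by rewrite !dmap_unit.
- by move=> *; rewrite !dmap_gam.
Defined.

Definition dfst (D D' : dgop gT) : dgop_map (dprod D D') D.
Proof. by refine (@DGopMap (dprod D D') D (fun n x => x.1) _ _ _ _). Defined.

Definition dsnd (D D' : dgop gT) : dgop_map (dprod D D') D'.
Proof. by refine (@DGopMap (dprod D D') D' (fun n x => x.2) _ _ _ _). Defined.

Definition dfixed (D : dgop gT) n (Gamma : {set gT * symg n}) (x : D n) :=
  forall p, p \in Gamma -> dact p.1 (drel (sym_bij p.2) x) = x.

(** The discrete counterpart of [has_fixed_points], in which only the existence of a fixed operation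
    matters. *)
Definition realizes (D : dgop gT) (F : collection gT) :=
  forall n (Gamma : {group gT * symg n}),
    Gamma \in F n <-> exists x : D n, dfixed Gamma x.

End DiscreteMaps.

(** * Points of G-operads and codiscrete G-operads *)

Section OperadPoints.
Context (gT : finGroupType) (V : spaces) (C : codisc V).

Local Notation U := (cpts C).

Lemma pts_map_elem_gamma (O : nat -> V)
    (gamma : forall k (n : 'I_k -> nat),
      hom (prd (O k) (iprd (fun i => O (n i)))) (O (\sum_i n i)%N))
    (S T : V) k (n : 'I_k -> nat) (x : hom T (O k)) (y : forall i, hom T (O (n i)))
    (f : hom S T) :
  elem_gamma gamma x y ∘ f = elem_gamma gamma (x ∘ f) (fun i => y i ∘ f).
Proof.
rewrite /elem_gamma -compmA; congr (_ ∘ _); apply: prd_uniq.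
  by rewrite compmA !prd_fstE.
rewrite compmA !prd_sndE; apply: iprd_uniq => i.
by rewrite compmA !iprd_projE.
Qed.

Lemma gact_gam (O : goperad gT V) g (T : V) k (n : 'I_k -> nat)
    (x : hom T (goperad_level O k)) (y : forall i, hom T (goperad_level O (n i))) :
  sval (gact O g) _ ∘ elem_gamma (op_gamma (gobj O)) x y =
  elem_gamma (op_gamma (gobj O)) (sval (gact O g) k ∘ x)
    (fun i => sval (gact O g) (n i) ∘ y i).
Proof. exact: (opmap_gamma (svalP (gact O g))). Qed.

Lemma bang_one : bang (one V) = idm (one V).
Proof. by rewrite [RHS]bang_uniq. Qed.

Lemma op_unit_bang (O : operad V) : op_unit O ∘ bang (one V) = op_unit O.
Proof. by rewrite bang_one compm1. Qed.

(** The laws are those of the G-operad O at generalized elements with source the terminal object. *)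
Definition dpts (O : goperad gT V) : dgop gT.
Proof.
pose L n := pts U (goperad_level O n).
refine (@DGop gT L (fun g n => pts_map (sval (gact O g) n))
  (fun m n s => pts_map (relabel (gobj O) s)) (unpt U (op_unit (gobj O)))
  (fun k n x y => unpt U (elem_gamma (op_gamma (gobj O)) (pt x) (fun i => pt (y i))))
  _ _ _ _ _ _ _ _ _ _ _).
- by move=> n x; rewrite gact1 /= pts_map1.
- by move=> g h n x; rewrite gactM /= pts_mapM.
- by move=> n x; rewrite relabel1 pts_map1.
- by move=> l m n t s x; rewrite relabelM pts_mapM.
- by move=> g m n s x; rewrite -!pts_mapM (opmap_relabel (svalP (gact O g))).
- by move=> g; apply: pt_inj; rewrite pt_pts_map !unptK (opmap_unit (svalP (gact O g))).
- move=> g k n x y; apply: pt_inj; rewrite pt_pts_map !unptK gact_gam.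
  by congr elem_gamma; apply: functional_extensionality_dep => i; rewrite pt_pts_map.
- move=> k k' n n' s t r x y y' rE yE; apply: pt_inj; rewrite !pt_pts_map !unptK.
  by apply: (op_equivariance _ rE) => i; rewrite yE pt_pts_map.
- move=> n r y rE; apply: pt_inj; rewrite pt_pts_map !unptK.
  have := op_unitl (o := gobj O) (pt y) rE.
  by rewrite op_unit_bang.
- move=> k r x rE; apply: pt_inj; rewrite pt_pts_map !unptK.
  have := op_unitr (o := gobj O) (pt x) rE.
  by rewrite op_unit_bang.
- move=> k n m r x y z rE; apply: pt_inj; rewrite pt_pts_map !unptK.
  rewrite (op_assoc (pt x) (fun i => pt (y i)) (fun i a => pt (z i a)) rE).
  by congr elem_gamma; apply: functional_extensionality_dep => i; rewrite unptK.
Defined.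

Section Codiscrete.
Context (D : dgop gT).

Definition cod_map (X Y : Type) (f : X -> Y) : hom (cod C X) (cod C Y) :=
  sval (cid2 (codiscrete_cod (c := C) (fun x => cod_elem C (f (cod_val x))))).

Lemma cod_mapE X Y (f : X -> Y) x : cod_val (pts_map (cod_map f) x) = f (cod_val x).
Proof.
by rewrite /cod_map; case: cid2 => h /= hE _; rewrite hE cod_elemK.
Qed.

Lemma cod_ext (T : V) X (f g : hom T (cod C X)) :
  (forall t : pts U T, cod_val (pts_map f t) = cod_val (pts_map g t)) -> f = g.
Proof.
move=> fg; apply: (codiscrete_ext (U := U)); first exact: codiscrete_cod.
by move=> t; apply: (can_inj (@cod_valK V C X)).
Qed.

Definition cod_unit : hom (one V) (cod C (D 1%N)) := pt (cod_elem C (dunit D)).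

Lemma cod_unitE t : cod_val (pts_map cod_unit t) = dunit D.
Proof.
rewrite /pts_map (_ : pt t = idm (one V)) ?compm1; first by rewrite ptK cod_elemK.
by rewrite [LHS]bang_uniq bang_one.
Qed.

Definition cod_gamma k (n : 'I_k -> nat) :
    hom (prd (cod C (D k)) (iprd (fun i => cod C (D (n i))))) (cod C (D (\sum_i n i)%N)) :=
  sval (cid2 (codiscrete_cod (c := C) (fun q =>
    cod_elem C (dgam (cod_val (pts_map (prd_fst _ _) q))
      (fun i => cod_val (pts_map (iprd_proj (fun i => cod C (D (n i))) i)
        (pts_map (prd_snd _ _) q))))))).

Lemma cod_gammaE (T : V) k (n : 'I_k -> nat) (x : hom T (cod C (D k)))
    (y : forall i, hom T (cod C (D (n i)))) t :
  cod_val (pts_map (elem_gamma (O := fun n => cod C (D n)) cod_gamma x y) t) =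
  dgam (cod_val (pts_map x t)) (fun i => cod_val (pts_map (y i) t)).
Proof.
rewrite /elem_gamma pts_mapM /cod_gamma; case: cid2 => h /= hE _.
rewrite hE cod_elemK -!pts_mapM prd_fstE; congr dgam.
apply: functional_extensionality_dep => i.
by rewrite -!pts_mapM prd_sndE iprd_projE.
Qed.

Definition cod_operad : operad V.
Proof.
refine (@Operad V (fun n => cod C (D n)) (fun m n s => cod_map (@drel gT D m n s)) _ _
  cod_unit cod_gamma _ _ _ _).
- by move=> n; apply: cod_ext => t; rewrite cod_mapE pts_map1 drel1.
- by move=> l m n s t; apply: cod_ext => x; rewrite pts_mapM !cod_mapE drelM.
- move=> T k k' n n' s t r x y y' rE yE; apply: cod_ext => u.
  rewrite cod_gammaE 2!pts_mapM !cod_mapE cod_gammaE.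
  by apply: (dequivariance _ rE) => i; rewrite yE pts_mapM cod_mapE.
- move=> T n r y rE; apply: cod_ext => t.
  by rewrite pts_mapM cod_mapE cod_gammaE pts_mapM cod_unitE dunitl.
- move=> T k r x rE; apply: cod_ext => t.
  rewrite pts_mapM cod_mapE cod_gammaE.
  have -> : (fun i : 'I_k => cod_val (pts_map (cod_unit ∘ bang T) t)) = (fun _ => dunit D).
    by apply/funext => i; rewrite pts_mapM cod_unitE.
  exact: dunitr.
- move=> T k n m r x y z rE; apply: cod_ext => t.
  rewrite pts_mapM cod_mapE !cod_gammaE.
  rewrite (dassoc _ _ (fun i a => cod_val (pts_map (z i a) t)) rE).
  by congr dgam; apply: functional_extensionality_dep => i; rewrite cod_gammaE.
Defined.

Lemma cod_act_subproof g :
  @is_operad_map V cod_operad cod_operad (fun n => cod_map (@dact gT D g n)).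
Proof.
split.
- by move=> m n s; apply: cod_ext => t; rewrite !pts_mapM !cod_mapE dact_rel.
- by apply: cod_ext => t; rewrite !pts_mapM !cod_mapE !cod_unitE dact_unit.
- move=> T k n x y; apply: cod_ext => t.
  rewrite pts_mapM cod_mapE !cod_gammaE dact_gam pts_mapM cod_mapE.
  congr dgam; apply: functional_extensionality_dep => i.
  by rewrite pts_mapM cod_mapE.
Qed.

(** Maps into codiscrete objects are compared on points, where the required identities are the laws
    of D. *)
Definition cod_goperad : goperad gT V.
Proof.
refine (@GObject gT (operad_category V) cod_operad
  (fun g => exist _ _ (cod_act_subproof g)) _ _).
- by apply: operad_mapP => n; apply: cod_ext => t; rewrite /= cod_mapE pts_map1 dact1.
- move=> g h; apply: operad_mapP => n; apply: cod_ext => t.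
  by rewrite /= pts_mapM !cod_mapE dactM.
Defined.

(** The counit of the adjunction with left adjoint [dpts] and right adjoint [cod_goperad]. *)
Definition cod_counit : dgop_map (dpts cod_goperad) D.
Proof.
refine (@DGopMap gT (dpts cod_goperad) D (fun n x => cod_val x) _ _ _ _).
- by move=> g n x; rewrite /= cod_mapE.
- by move=> m n s x; rewrite /= cod_mapE.
- by rewrite /= ptK cod_elemK.
- move=> k n x y /=.
  have := cod_gammaE (pt x) (fun i => pt (y i)) (unpt U (idm (one V))).
  rewrite /pts_map !unptK !compm1 ptK => ->; congr dgam.
  by apply: functional_extensionality_dep => i; rewrite !compm1 ptK.
Defined.

Context (O : goperad gT V) (f : dgop_map (dpts O) D).

Definition transpose_fun n : hom (goperad_level O n) (goperad_level cod_goperad n) :=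
  sval (cid2 (codiscrete_cod (c := C) (fun x => cod_elem C (f n x)))).

Lemma transpose_funE n (x : pts U (goperad_level O n)) :
  cod_val (pts_map (transpose_fun n) x) = f n x.
Proof. by rewrite /transpose_fun; case: cid2 => h /= hE _; rewrite hE cod_elemK. Qed.

Lemma transpose_is_operad_map : @is_operad_map V (gobj O) cod_operad transpose_fun.
Proof.
split.
- move=> m n s; apply: cod_ext => t.
  by rewrite !pts_mapM cod_mapE !transpose_funE (dmap_rel f).
- apply: cod_ext => t; rewrite pts_mapM transpose_funE cod_unitE.
  rewrite -(dmap_unit f); congr (f _ _); rewrite /= /pts_map; congr (unpt U _).
  by rewrite (bang_uniq (pt t)) op_unit_bang.
- move=> T k n x y; apply: cod_ext => t.
  rewrite pts_mapM transpose_funE cod_gammaE [in RHS]pts_mapM transpose_funE.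
  have -> : (fun i => cod_val (pts_map (transpose_fun (n i) ∘ y i) t)) =
     (fun i => f (n i) (pts_map (y i) t)).
    by apply: functional_extensionality_dep => i; rewrite pts_mapM transpose_funE.
  rewrite -(dmap_gam f); congr (f _ _); rewrite /= /pts_map; congr (unpt U _).
  rewrite pts_map_elem_gamma unptK.
  by congr elem_gamma; apply: functional_extensionality_dep => i; rewrite unptK.
Qed.

Lemma transpose_equivariant g :
  @compm (operad_category V) _ _ _ (gact cod_goperad g) (exist _ _ transpose_is_operad_map) =
  @compm (operad_category V) _ _ _ (exist _ _ transpose_is_operad_map) (gact O g).
Proof.
apply: operad_mapP => n /=; apply: cod_ext => t.
by rewrite !pts_mapM cod_mapE !transpose_funE (dmap_act f).
Qed.

(** The adjunct of f; for f the identity of [dpts O] this is the unit of the adjunction. *)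
Definition transpose : @hom (goperad_category gT V) O cod_goperad :=
  exist _ _ transpose_equivariant.

Lemma transposeE n (x : pts U (goperad_level O n)) :
  cod_val (pts_map (sval (sval transpose) n) x) = f n x.
Proof. exact: transpose_funE. Qed.

End Codiscrete.

Lemma goperad_hom_cod_ext (D : dgop gT) (O : goperad gT V)
    (a b : @hom (goperad_category gT V) O (cod_goperad D)) :
  (forall n (x : pts U (goperad_level O n)),
    cod_val (pts_map (sval (sval a) n : hom _ (cod C (D n))) x) =
    cod_val (pts_map (sval (sval b) n : hom _ (cod C (D n))) x)) ->
  a = b.
Proof.
by move=> ab; apply: ghomP; apply: operad_mapP => n; apply: cod_ext; exact: ab.
Qed.

Definition dpts_map (O P : goperad gT V) (f : @hom (goperad_category gT V) O P) :
  dgop_map (dpts O) (dpts P).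
Proof.
refine (@DGopMap gT (dpts O) (dpts P) (fun n => pts_map (sval (sval f) n)) _ _ _ _).
- move=> g n x; rewrite /= -!pts_mapM; congr (pts_map _ x).
  exact: esym (f_equal (fun h : operad_map _ _ => sval h n) (svalP f g)).
- by move=> m n s x; rewrite /= -!pts_mapM (opmap_relabel (svalP (sval f))).
- by apply: pt_inj; rewrite /= pt_pts_map !unptK (opmap_unit (svalP (sval f))).
- move=> k n x y; apply: pt_inj; rewrite /= pt_pts_map !unptK.
  rewrite (opmap_gamma (svalP (sval f))).
  by congr elem_gamma; apply: functional_extensionality_dep => i; rewrite pt_pts_map.
Defined.

Lemma fixed_pointsP (O : goperad gT V) n (Gamma : {set gT * symg n}) :
  (exists x : dpts O n, dfixed Gamma x) <-> inhabited (pts U (fixed_points O Gamma)).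
Proof.
rewrite -pts_fixp; split=> -[x xE]; exists x.
  by case=> p pG; rewrite /gsym_act pts_mapM; exact: xE.
by move=> p pG; have := xE (exist _ p pG); rewrite /gsym_act pts_mapM.
Qed.

Lemma has_fixed_points_realizes (F : collection gT) (O : goperad gT V) :
  has_fixed_points F O -> realizes (dpts O) F.
Proof.
move=> FO n Gamma; rewrite fixed_pointsP; split=> [/(FO n Gamma).1|iO].
  exact: contractible_pts.
by apply: contrapT => /negP /(FO n Gamma).2 /(is_emptyE C); apply.
Qed.

(** If Gamma is in F'_n, both fixed-point objects are weakly contractible. Otherwise that of P is
    empty, and so is that of O, which maps to it. In either case any map is a weak equivalence. *)
Lemma has_fixed_points_weq (F F' : collection gT) (O P : goperad gT V)
    (f : @hom (goperad_category gT V) O P) :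
  has_fixed_points F O -> has_fixed_points F' P ->
  (forall n Gamma, Gamma \in F' n -> Gamma \in F n) ->
  forall n (Gamma : {group gT * symg n}), weq (fixed_map f Gamma).
Proof.
move=> FO FP F'F n Gamma.
have [GF'|GF'] := boolP (Gamma \in F' n).
  apply: (weq_contractible C); last exact: (FP _ _).1.
  by apply: (FO _ _).1; exact: F'F.
have P0 := (is_emptyE C _).1 ((FP _ _).2 GF').
have O0 : ~ inhabited (pts U (fixed_points O Gamma)).
  by move=> [x]; apply: P0; constructor; exact: pts_map (fixed_map f Gamma) x.
apply: (@weq_empty V C _ _ (fixed_map f Gamma)) => x; [exact: O0|exact: P0].
Qed.

(** Fixed points of a codiscrete object are codiscrete, hence weakly contractible as soon as they
    have a point. *)
Lemma realizes_has_fixed_points (F : collection gT) (D : dgop gT) :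
  realizes D F -> has_fixed_points F (cod_goperad D).
Proof.
move=> DF n Gamma.
have fE : inhabited (pts U (fixed_points (cod_goperad D) Gamma)) <-> Gamma \in F n.
  rewrite -fixed_pointsP DF; split=> -[x xE].
    by exists (cod_counit D n x) => p /xE {2}<-; rewrite dmap_act dmap_rel.
  exists (cod_elem C x) => p /xE pE; apply: (can_inj (@cod_valK V C (D n))).
  by rewrite /= !cod_mapE cod_elemK.
split=> [/fE[x]|GF].
  apply: codiscrete_contractible x; apply: codiscrete_fixp.
  exact: codiscrete_cod.
by apply/is_emptyE => /fE; exact/negP.
Qed.

End OperadPoints.

(** * Sieves of G-corollas *)

Section Graphs.
Context (gT : finGroupType) (n : nat).
Local Open Scope group_scope.

Lemma graph_subgroup_uniq (Gamma : {group gT * symg n}) g (s t : symg n) :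
  graph_subgroup Gamma -> (g, s) \in Gamma -> (g, t) \in Gamma -> s = t.
Proof.
move=> gr sG tG; have := groupM (groupVr sG) tG.
have -> : (g, s)^-1 * (g, t) = (1, s^-1 * t) by congr pair; exact: mulVg.
by move/gr/eqP; rewrite -eq_mulVg1 => /eqP.
Qed.

(** The projection to G is injective on Gamma; H is its image and phi reads off the second
    component, with default value 1 outside H. *)
Lemma graph_subgroup_morphism (Gamma : {group gT * symg n}) :
  graph_subgroup Gamma ->
  exists (H : {group gT}) (phi : {morphism H >-> symg n}),
    (Gamma : {set _}) = [set (h, phi h) | h in H].
Proof.
move=> gr; pose A := [set p.1 | p in Gamma].
have gA : group_set A.
  apply/group_setP; split; first by apply/imsetP; exists 1; rewrite ?group1.
  move=> _ _ /imsetP[p pG ->] /imsetP[q qG ->].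
  by apply/imsetP; exists (p * q); rewrite ?groupM.
pose H := Group gA.
pose phi h : symg n := odflt 1 [pick s | (h, s) \in Gamma].
have phiP h : h \in H -> (h, phi h) \in Gamma.
  case/imsetP => -[g s] pG -> /=; rewrite /phi; case: pickP => //= noS.
  by have := noS s; rewrite pG.
have phiM : {in H &, {morph phi : g h / g * h}}.
  move=> g h gH hH; apply: (graph_subgroup_uniq (g := g * h)) gr _ _.
    by apply: phiP; rewrite groupM.
  exact: (groupM (phiP _ gH) (phiP _ hH)).
exists H, (Morphism phiM); apply/setP => -[g s]; apply/idP/imsetP => /=.
  move=> pG; have gH : g \in H by apply/imsetP; exists (g, s).
  by exists g => //; congr pair; apply: graph_subgroup_uniq gr pG (phiP _ gH).
by case=> h hH [-> ->]; exact: phiP.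
Qed.

End Graphs.

Section SieveCorolla.
Context (gT : finGroupType) (X : finType) (iact : gT -> X -> X).
Context (iact1 : forall x, iact 1%g x = x).
Context (iactM : forall g h x, iact (g * h)%g x = iact g (iact h x)).
Context (iact_transitive : exists x, forall y, exists g, iact g x = y).
Context (A : X -> finType) (act : forall g x, A x -> A (iact g x)).
Context (act1 : forall x (a : A x),
  Tagged (fun x => A x : Type) (act 1%g a) = Tagged (fun x => A x : Type) a).
Context (actM : forall g h x (a : A x),
  Tagged (fun x => A x : Type) (act (g * h)%g a) =
  Tagged (fun x => A x : Type) (act g (act h a))).

Let T := gcorolla iact1 iactM iact_transitive act1 actM.
Let tag_in x (a : A x) := Tagged (fun x => A x : Type) a.
Local Open Scope group_scope.

Lemma edge_in_Some x y (a : A x) (b : A y) :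
  tag_in a = tag_in b -> edge_in T (Some a : T x) = edge_in T (Some b : T y).
Proof.
exact: (f_equal (fun u : {x & A x} => edge_in T (Some (tagged u) : T (tag u)))).
Qed.

Lemma edge_in_None x y : x = y -> edge_in T (None : T x) = edge_in T (None : T y).
Proof. by move=> ->. Qed.

Section Point.
Context (F : collection gT) (x : X) (n : nat) (l : 'I_n -> A x).
Context (Gamma : {group gT * symg n}).
Hypothesis l_bij : bijective l.
Hypothesis Gamma_stab : forall p, p \in Gamma ->
  iact p.1 x = x /\ forall i, tag_in (act p.1 (l i)) = tag_in (l (sym_fun p.2 i)).

(** An isomorphism with an induced corolla carries the stabilizer of x to a conjugate of H and the
    numbering l to a renumbering of the leaves. So Gamma lies in a conjugate of the graph [G0]. *)
Lemma in_sieve_gcorolla :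
  (forall m, is_family (F m)) -> in_sieve F T -> Gamma \in F n.
Proof.
move=> Ffam [m [H [phi [G0 [G0F G0E [f0 [f [f0_bij f0_act f_iso f_act]]]]]]]].
have [x' xE] : exists x', f0 x' = x by case: f0_bij => g _ gK; exists (g x).
subst x; have [fx_bij fx_root _ _] := f_iso x'.
pose fx : option 'I_m -> option (A (f0 x')) := f x'.
have fx_inj : injective fx := bij_inj fx_bij.
have tauP (i : 'I_m) : exists j : 'I_n, fx (Some i) = Some (l j).
  case E : (fx (Some i)) => [a|]; last by have := fx_inj _ None (etrans E (esym fx_root)).
  by case: l_bij => k _ lK; exists (k a); rewrite lK.
(* [tau] compares the numbering of the leaves of the induced corolla with l; the root cannot be hit,
   since f preserves roots. *)
have {tauP}[tau tauE] := choice tauP.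
have tau_inj : injective tau.
  by move=> i j ij; have := tauE i; rewrite ij -tauE => /fx_inj[].
have tau_surj j : exists i, tau i = j.
  have [k _ fxK] := fx_bij; case E : (k (Some (l j) : T (f0 x'))) => [i|].
    exists i; have := tauE i; rewrite -[Some i]E /fx fxK => -[] /(bij_inj l_bij) //.
  by have := fxK (Some (l j)); rewrite E fx_root.
have mn : m = n.
  apply/eqP; rewrite eqn_leq; apply/andP; split.
    by rewrite -[m]card_ord -[n]card_ord; exact: leq_card tau_inj.
  have [k kK] := choice tau_surj.
  by rewrite -[m]card_ord -[n]card_ord; exact: leq_card (can_inj kK).
subst m; pose s0 : symg n := perm tau_inj.
have s0E i : sym_fun s0 i = tau i by rewrite /sym_fun permE.
set r := repr (sval x').
(* Conjugation by r moves the stabilizer of the coset x' to H, and conjugation by s0 passes from one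
   numbering to the other. *)
have sub : Gamma \subset (G0 :^ (r, s0)^-1)%G.
  apply/fintype.subsetP => -[g s] pG; rewrite /= mem_conjgV.
  have [gx gl] := Gamma_stab pG; rewrite /= in gx gl.
  have gx' : cosets_act g x' = x' by apply: (bij_inj f0_bij); rewrite f0_act.
  have cH := repr_coset_act g x'; rewrite gx' -/r in cH.
  set c := _ * g * r in cH.
  suff sE : s = s0 * phi c * s0^-1.
    have -> : (g, s) ^ (r, s0) = (c, phi c).
      congr pair; first by rewrite /c -mulgA.
      by rewrite /= sE mulgKV mulKg.
    by rewrite G0E; apply/imsetP; exists c.
  apply/(canRL (mulgK _)); apply/permP => i.
  rewrite -![LHS]/(sym_fun _ i) -![RHS]/(sym_fun _ i) !sym_funM !s0E.
  have := f_act g x' (Some i).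
  rewrite (_ : f x' (Some i) = Some (l (tau i))); last exact: tauE.
  rewrite [X in _ = X -> _](edge_in_Some (gl _)) => E.
  have : edge_in T (f x' (Some (sym_fun (phi c) i))) =
         edge_in T (Some (l (sym_fun s (tau i))) : T (f0 x')).
    rewrite -E /= /induced_act gx' -/r -/c.
    (* The component index [cosets_act g x'] is replaced by x', after which both sides live in the
       same fibre. *)
    by case: _ / (esym gx').
  move/edge_in_inj; rewrite -[f x' _]/(fx _) tauE => -[] /(bij_inj l_bij) //.
have [Fsub Fconj] := Ffam n.
exact: Fsub (Fconj _ _ G0F) sub.
Qed.

(** The orbit-stabilizer theorem: Gamma is the graph of the action of the stabilizer H of x on the
    leaves over x, and the coset B goes to [repr B] applied to x. *)
Lemma gcorolla_in_sieve :
  Gamma \in F n -> graph_subgroup Gamma ->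
  (forall g, iact g x = x -> exists s, (g, s) \in Gamma) -> in_sieve F T.
Proof.
move=> GF /graph_subgroup_morphism[H [phi GE]] stab.
have HE g : (g \in H) = (iact g x == x).
  apply/idP/eqP => [gH|/stab[s]].
    have pG : (g, phi g) \in Gamma by rewrite GE; apply/imsetP; exists g.
    by have [] := Gamma_stab pG.
  by rewrite GE => /imsetP[h hH [-> _]].
have phiE g : g \in H -> forall i, tag_in (act g (l i)) = tag_in (l (sym_fun (phi g) i)).
  move=> gH; have pG : (g, phi g) \in Gamma by rewrite GE; apply/imsetP; exists g.
  by have [] := Gamma_stab pG.
exists n, H, phi, Gamma; split=> //.
pose f0 (B : cosets H) := iact (repr (sval B)) x.
(* The representative of gB and g times that of B differ by an element of H, which fixes x. *)
have f0_act g B : f0 (cosets_act g B) = iact g (f0 B).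
  rewrite /f0 -iactM; have := repr_coset_act g B; rewrite HE => /eqP E.
  by rewrite -[in LHS]E -iactM !mulgA mulgV mul1g.
have cosetE (B : cosets H) : sval B = repr (sval B) *: H.
  case: B => B /= /lcosetsP[y _ ->].
  have : repr (y *: H) \in y *: H by apply: (mem_repr y); exact: lcoset_refl.
  by move/lcoset_eqP.
exists f0, (fun B => omap (fun i => act (repr (sval B)) (l i))); split.
- apply: inj_card_bij.
    move=> B C BC; apply: val_inj; rewrite /= [LHS]cosetE [RHS]cosetE.
    apply/lcoset_eqP; rewrite mem_lcoset HE iactM -[iact (repr (sval B)) x]/(f0 B) BC /f0.
    by rewrite -iactM mulVg iact1.
  have gP y : exists g, iact g x = y.
    have [x0 x0P] := iact_transitive.
    have [[g gE] [h hE]] := (x0P y, x0P x).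
    by exists (g * h^-1); rewrite -hE -iactM mulgKV.
  have [g gE] := choice gP.
  have Hc y : g y *: H \in lcosets H [set: gT].
    by apply/lcosetsP; exists (g y); rewrite ?inE.
  apply: (@leq_card _ _ (fun y => exist _ (g y *: H) (Hc y) : cosets H)).
  move=> y z /(congr1 sval) /= /lcoset_eqP; rewrite mem_lcoset HE iactM gE => /eqP E.
  by rewrite -[RHS]gE -E -iactM mulgV iact1.
- exact: f0_act.
- move=> B; have lB_inj : injective (fun i => act (repr (sval B)) (l i)).
    by move=> i j /(gcorolla_act_inj act1 actM)/(bij_inj l_bij).
  split=> [|//|[i|]|[i|]] //.
  + apply: inj_card_bij => [[i|] [j|] //= [/lB_inj -> //]|].
    rewrite !card_option ltnS.
    have -> : #|'I_n| = #|A x| by apply: bij_eq_card l_bij.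
    have := leq_card _ (@gcorolla_act_inj _ _ _ _ _ act1 actM (repr (sval B))^-1 (f0 B)).
    by rewrite /f0 -iactM mulVg iact1.
  + by rewrite /= !mem_imset //; exact: Some_inj.
  + by apply/imsetP/imsetP => -[].
- move=> g B [i|]; last by apply: edge_in_None; exact: f0_act.
  apply: edge_in_Some.
  have cH := repr_coset_act g B.
  pose tact h (u : {x & A x}) := tag_in (act h (tagged u)).
  (* The element of H that compares the two representatives acts on the labels through [phi]; this
     relation is translated by the representative of gB. *)
  have E := congr1 (tact (repr (sval (cosets_act g B)))) (phiE _ cH i).
  apply: etrans (esym E) _; rewrite /tact /tag_in /= -!actM.
  by rewrite !mulgA mulgV mul1g.
Qed.

End Point.
End SieveCorolla.

(** * Composition along trees *)

Section TagnatComplements.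
Context (k : nat) (n : 'I_k -> nat).

Lemma tagnat_Rank_ind (P : 'I_(\sum_i n i)%N -> Prop) :
  (forall i (a : 'I_(n i)), P (tagnat.Rank i a)) -> forall p, P p.
Proof. by move=> PR p; rewrite -[p]tagnat.sig2K; exact: PR. Qed.

Lemma tagnat_sig_Rank (X : Type) (f : forall i, 'I_(n i) -> X) i (a : 'I_(n i)) :
  f (tagnat.sig1 (tagnat.Rank i a)) (tagnat.sig2 (tagnat.Rank i a)) = f i a.
Proof.
exact: (f_equal (fun u : {i & 'I_(n i)} => f (tag u) (tagged u)) (tagnat.rankK _)).
Qed.

End TagnatComplements.

Lemma bijectionP m n (r s : bijection m n) : sval r =1 sval s -> r = s.
Proof.
by move=> rs; apply: eq_sig_hprop => [h|]; [exact: Prop_irrelevance|exact/funext].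
Qed.

Lemma inj_surj_bijective (I J : Type) (f : I -> J) :
  injective f -> (forall j, exists i, f i = j) -> bijective f.
Proof. by move=> finj /choice[g gK]; exists g => // i; apply: finj; rewrite gK. Qed.

(** Provides the bijection r over which the equivariance law quantifies: s permutes the blocks and t
    i acts inside them. *)
Lemma block_bijection k k' (n : 'I_k -> nat) (n' : 'I_k' -> nat) (s : bijection k k')
    (t : forall i, bijection (n i) (n' (sval s i))) :
  exists r : bijection (\sum_i n i)%N (\sum_i n' i)%N, forall i (a : 'I_(n i)),
    sval r (tagnat.Rank i a) = tagnat.Rank (sval s i) (sval (t i) a).
Proof.
pose f p : 'I_(\sum_i n' i)%N := tagnat.Rank _ (sval (t (tagnat.sig1 p)) (tagnat.sig2 p)).
have fE i a : f (tagnat.Rank i a) = tagnat.Rank (sval s i) (sval (t i) a).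
  exact: (tagnat_sig_Rank (fun i a => tagnat.Rank (sval s i) (sval (t i) a))).
have f_bij : bijective f.
  apply: inj_surj_bijective.
    apply: tagnat_Rank_ind => i a; apply: tagnat_Rank_ind => j b.
    rewrite !fE => /(congr1 val)/eqP; rewrite tagnat.eq_Rank => /andP[/eqP ij].
    have {ij} : i = j by apply: bij_inj ij; exact: svalP s.
    move=> ij; case: _ / ij in b * => /eqP/val_inj ab.
    by congr tagnat.Rank; apply: bij_inj ab; exact: svalP (t i).
  apply: tagnat_Rank_ind => j b.
  have [i ij] : exists i, sval s i = j by case: (svalP s) => g _ gK; exists (g j).
  case: _ / ij in b *.
  have [a <-] : exists a, sval (t i) a = b by case: (svalP (t i)) => g _ gK; exists (g b).
  by exists (tagnat.Rank i a).
by exists (exist _ f f_bij).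
Qed.

Lemma finite_perm_of (X : Type) n (l : 'I_n -> X) (f : X -> X) :
  injective l -> injective f -> (forall i, exists j, f (l i) = l j) ->
  exists s : symg n, forall i, f (l i) = l (sym_fun s i).
Proof.
move=> linj finj /choice[t tE].
have tinj : injective t by move=> i j ij; apply: linj; apply: finj; rewrite !tE ij.
by exists (perm tinj) => i; rewrite tE /sym_fun permE.
Qed.

Section RealizedFamilies.
Context (gT : finGroupType) (D : dgop gT).
Local Open Scope group_scope.

Definition dsym n (p : gT * symg n) (x : D n) : D n :=
  dact p.1 (drel (sym_bij p.2) x).

Lemma dsymM n (p q : gT * symg n) (x : D n) : dsym (p * q) x = dsym p (dsym q x).
Proof.
rewrite /dsym -dact_rel -dactM -drelM; congr (dact _ (drel _ x)).
by apply: bijectionP => i; exact: sym_funM.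
Qed.

Lemma realizes_family (F : collection gT) : realizes D F -> forall n, is_family (F n).
Proof.
move=> DF n; split=> [Gamma Delta /DF[x xE] /fintype.subsetP DG|Gamma q /DF[x xE]].
  by apply/DF; exists x => p /DG; exact: xE.
(* The elements of [Gamma :^ q] are the q^-1 p q, so they fix q^-1 x when Gamma fixes x. *)
apply/DF; exists (dsym q^-1 x) => p; rewrite mem_conjg => pG.
rewrite -/(dsym p _) -dsymM.
have -> : p * q^-1 = q^-1 * (p ^ q^-1) by rewrite /conjg invgK !mulgA mulVg mul1g.
by rewrite dsymM [dsym (p ^ _) x](xE _ pG).
Qed.

End RealizedFamilies.

Section LabelledOperations.
Context (gT : finGroupType) (D : dgop gT) (E : Type) (ea : gT -> E -> E).
Context (eaM : forall g h e, ea (g * h)%g e = ea g (ea h e)).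

(** Operations with inputs labelled in E, considered up to [lop_eq], form the extension
    of D from finite ordinals to finite subsets of E. *)
Record lop := Lop { arity : nat; oper : D arity; lab : 'I_arity -> E }.

Definition lop_eq (u v : lop) := exists r : bijection (arity u) (arity v),
  drel r (oper u) = oper v /\ forall i, lab (sval r i) = lab i.

Definition lop_act g (u : lop) := Lop (dact g (oper u)) (fun i => ea g (lab i)).

Definition lop_unit (e : E) := Lop (dunit D) (fun _ => e).

Definition lop_gam (u : lop) (w : 'I_(arity u) -> lop) :=
  Lop (dgam (oper u) (fun i => oper (w i)))
    (fun p => lab (l := w (tagnat.sig1 p)) (tagnat.sig2 p)).

Lemma lop_eq_refl u : lop_eq u u.
Proof. by exists (bijection_id _); rewrite drel1. Qed.

Lemma lop_eq_act g u v : lop_eq u v -> lop_eq (lop_act g u) (lop_act g v).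
Proof.
by case=> r [rE lE]; exists r; split=> [|i] /=; [rewrite -dact_rel rE|rewrite lE].
Qed.

Lemma lop_actM g h u : lop_act g (lop_act h u) = lop_act (g * h)%g u.
Proof. by rewrite /lop_act dactM; congr Lop; apply/funext => i; rewrite eaM. Qed.

Lemma lop_act_unit g e : lop_act g (lop_unit e) = lop_unit (ea g e).
Proof. by rewrite /lop_act dact_unit. Qed.

Lemma lop_act_gam g u (w : 'I_(arity u) -> lop) :
  lop_act g (lop_gam w) = lop_gam (u := lop_act g u) (fun i => lop_act g (w i)).
Proof. by rewrite /lop_act dact_gam. Qed.

(** This is the equivariance law, with r assembled blockwise from s and from the bijections that
    identify each w i with its counterpart. *)
Lemma lop_gam_eq u v (w : 'I_(arity u) -> lop) (w' : 'I_(arity v) -> lop)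
    (s : bijection (arity u) (arity v)) :
  drel s (oper u) = oper v -> (forall i, lop_eq (w i) (w' (sval s i))) ->
  lop_eq (lop_gam w) (lop_gam w').
Proof.
move=> sE ww'.
pose t i := sval (cid (ww' i)); have tE i := svalP (cid (ww' i)).
have [r rE] := block_bijection (n' := fun j => arity (w' j)) t.
exists r; split=> /=.
  rewrite -sE; apply: esym; apply: (dequivariance _ rE) => i.
  by rewrite (tE i).1.
apply: tagnat_Rank_ind => i a; rewrite /= rE.
rewrite (tagnat_sig_Rank (fun i a => lab (l := w' i) a)).
rewrite (tagnat_sig_Rank (fun i a => lab (l := w i) a)).
exact: (tE i).2.
Qed.

Lemma lab_gam_Rank u (w : 'I_(arity u) -> lop) i (a : 'I_(arity (w i))) :
  lab (l := lop_gam w) (tagnat.Rank i a) = lab a.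
Proof. exact: (tagnat_sig_Rank (fun i a => lab (l := w i) a)). Qed.

End LabelledOperations.

(** * The order on the edges of a G-tree *)

Section TreeEdges.
Context (gT : finGroupType) (T : gtree gT).
Local Open Scope group_scope.
Local Notation vertexT := (@is_vertex gT T).

Definition outT (d : edges T) : edges T := edge_in T (out (tagged d)).
Definition rootT (d : edges T) : bool := tagged d == root (T (tag d)).
Definition inputT (e d : edges T) : bool := ~~ rootT d && (outT d == e).

Lemma edges_act_inj g : injective (@edges_act gT T g).
Proof.
by apply: (can_inj (g := edges_act g^-1)) => e; rewrite -edges_actM mulVg edges_act1.
Qed.

Lemma rootT_act g d : rootT (edges_act g d) = rootT d.
Proof.
case: d => x d; have [bij rt _ _] := eact_iso g x.
by rewrite /rootT /edges_act /= -rt (inj_eq (bij_inj bij)).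
Qed.

Lemma outT_act g d : outT (edges_act g d) = edges_act g (outT d).
Proof.
case: d => x d; have [_ _ _ o] := eact_iso g x.
by rewrite /outT /edges_act /= o.
Qed.

Lemma inputT_act g e d : inputT (edges_act g e) (edges_act g d) = inputT e d.
Proof. by rewrite /inputT rootT_act outT_act (inj_eq (@edges_act_inj g)). Qed.

Lemma vertexT_act g d : vertexT (edges_act g d) = vertexT d.
Proof.
case: d => x d; have [_ _ lv _] := eact_iso g x.
by rewrite /is_vertex /edges_act /= lv.
Qed.

Lemma depth_subproof (d : edges T) :
  exists k, iter k (@out _) (tagged d) == root (T (tag d)).
Proof. by have [k kE] := out_connected (tagged d); exists k; apply/eqP. Qed.

Definition depth (d : edges T) := ex_minn (depth_subproof d).

Lemma depth_out d : ~~ rootT d -> depth d = (depth (outT d)).+1.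
Proof.
move=> d_root; rewrite /depth; case: ex_minnP => k /= kE kmin.
case: ex_minnP => j /= jE jmin; apply/eqP; rewrite eqn_leq.
rewrite kmin ?iterSr //=; case: k kE kmin => [dE _|k]; first by rewrite /rootT dE in d_root.
by rewrite iterSr ltnS => /jmin ->.
Qed.

(** The tree order. The condition on d excludes the loop of [out] at the root, so every step lowers
    the depth. *)
Inductive above (e : edges T) : edges T -> Prop :=
| above_refl : above e e
| above_out d : ~~ rootT d -> above e (outT d) -> above e d.

Lemma above_input e i d : inputT e i -> above i d -> above e d.
Proof.
move=> /andP[i_root /eqP iE]; elim=> [|{}d d_root _ ed]; last exact: above_out.
by apply: above_out => //; rewrite iE; exact: above_refl.
Qed.

Lemma above_split e d : above e d -> d = e \/ exists2 i, inputT e i & above i d.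
Proof.
elim=> [|{}d d_root _ IH]; first by left.
right; case: IH => [dE|[i ei id]].
  by exists d; [rewrite /inputT d_root dE eqxx|exact: above_refl].
by exists i => //; exact: above_out.
Qed.

Lemma above_depth e d : above e d -> depth e <= depth d.
Proof. by elim=> // {}d d_root _ ed; rewrite (depth_out d_root) (leq_trans ed). Qed.

Lemma above_inv e d : above e d -> d = e \/ ~~ rootT d /\ above e (outT d).
Proof. by case=> [|{}d d_root ed]; [left|right]. Qed.

(** The edges below d form a chain along which the depth drops by one at each step. *)
Lemma above_uniq e e' d : above e d -> above e' d -> depth e = depth e' -> e = e'.
Proof.
move=> ed; elim: ed e' => [|{}d d_root ed IH] e' /above_inv[<-//|[d'_root e'd]].
  have := above_depth e'd; rewrite (depth_out d'_root) => le1 E.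
  by move: le1; rewrite -E ltnn.
  by move/above_depth: ed => /[swap] ->; rewrite (depth_out d_root) ltnn.
exact: IH.
Qed.

Lemma above_root x d : tag d = x -> above (edge_in T (root (T x))) d.
Proof.
move: {2}(depth d) (erefl (depth d)) => k; elim: k d => [|k IH] d.
  move=> + <-; have [dr _|d_root] := boolP (rootT d); last by rewrite depth_out.
  by case: d dr => y d /= /eqP /= ->; exact: above_refl.
move=> dk dx; have [dr|d_root] := boolP (rootT d).
  by case: d dr dx {dk} => y d /= /eqP /= -> <-; exact: above_refl.
by apply: above_out => //; apply: IH => //; move: dk; rewrite depth_out // => -[].
Qed.

Lemma above_tag e d : above e d -> tag d = tag e.
Proof. by elim=> // {}d _ _; case: d. Qed.

Lemma inputT_tag e d : inputT e d -> tag d = tag e.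
Proof. by case/andP => _ /eqP <-. Qed.

Lemma inputT_vertex e d : inputT e d -> vertexT e.
Proof.
case/andP => d_root /eqP <-; rewrite /is_vertex /=.
exact: out_notin_leaves.
Qed.

End TreeEdges.

Section TreeComposition.
Context (gT : finGroupType) (D : dgop gT) (T : gtree gT).
Local Notation E := (edges T).
Local Notation vertexT := (@is_vertex gT T).
Local Notation lact := (lop_act (D := D) (@edges_act gT T)).
Context (X : E -> lop D E).
Hypothesis X_act : forall g v, vertexT v -> lop_eq (lact g (X v)) (X (edges_act g v)).
Hypothesis X_inj : forall v, vertexT v -> injective (@lab _ _ _ (X v)).
Hypothesis X_inputs : forall v, vertexT v -> forall d,
  inputT v d <-> exists i : 'I_(arity (X v)), lab i = d.

(** [k] is fuel, bounding the height of the tree above [e]. *)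
Fixpoint tree_comp k (e : E) : lop D E :=
  if k is k.+1 then
    if vertexT e then lop_gam (u := X e) (fun i => tree_comp k (lab i))
    else lop_unit D e
  else lop_unit D e.

Lemma tree_comp_act k g e : lop_eq (lact g (tree_comp k e)) (tree_comp k (edges_act g e)).
Proof.
elim: k e => [|k IH] e /=; first by rewrite lop_act_unit; exact: lop_eq_refl.
rewrite vertexT_act; case: ifP => [ve|_]; last first.
  by rewrite lop_act_unit; exact: lop_eq_refl.
have [s [sE lE]] := X_act g ve.
rewrite lop_act_gam; apply: (lop_gam_eq (u := lact g (X e)) (s := s)) => // i.
by rewrite lE; exact: IH.
Qed.

(** The labels of the composite are the leaves above e, without repetition, since subtrees over
    distinct inputs are disjoint by [above_uniq]. The bound on N guarantees enough fuel: k = 0 would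
    force an edge of depth at least N. *)
Lemma tree_comp_lab N k e : (forall d : E, depth d < N) -> N <= k + depth e ->
  injective (@lab _ _ _ (tree_comp k e)) /\
  forall d, above e d /\ ~~ vertexT d <->
    exists i : 'I_(arity (tree_comp k e)), lab i = d.
Proof.
move=> dN; elim: k e => [|k IH] e.
  by rewrite add0n leqNgt dN.
move=> Nk /=; case: ifP => ve; last first.
  split=> [i j _|d]; first by rewrite [i]ord1 [j]ord1.
  split=> [[ed dv]|[_ <-] /=]; last by split; [exact: above_refl|rewrite ve].
  have [->|[i /inputT_vertex]] := above_split ed; last by rewrite ve.
  by exists ord0.
have Xin i : inputT e (lab (l := X e) i) by apply/(X_inputs ve); exists i.
have Xdep i : depth (lab (l := X e) i) = (depth e).+1.
  by case/andP: (Xin i) => nr /eqP oE; rewrite depth_out // oE.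
have le i : N <= k + depth (lab (l := X e) i) by rewrite Xdep addnS -addSn.
have IHi i := IH (lab (l := X e) i) (le i).
split.
  apply: tagnat_Rank_ind => i a; apply: tagnat_Rank_ind => j b.
  rewrite !lab_gam_Rank => ab.
  have [aa _] : above (lab (l := X e) i) (lab a) /\ ~~ vertexT (lab a).
    by apply/(IHi i).2; exists a.
  have [bb _] : above (lab (l := X e) j) (lab b) /\ ~~ vertexT (lab b).
    by apply/(IHi j).2; exists b.
  have ij : i = j.
    by apply: (X_inj ve); rewrite -ab in bb; apply: above_uniq aa bb _; rewrite !Xdep.
  case: _ / ij in b ab bb *.
  by congr tagnat.Rank; exact: (IHi i).1 ab.
move=> d; split=> [[ed dv]|[p]].
  have [dE|[i ei id]] := above_split ed; first by rewrite dE ve in dv.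
  have /(X_inputs ve)[j jE] := ei; subst i.
  have /(IHi j).2[a aE] : above (lab (l := X e) j) d /\ ~~ vertexT d by [].
  by exists (tagnat.Rank j a); rewrite lab_gam_Rank.
elim/(@tagnat_Rank_ind): p => i a; rewrite lab_gam_Rank => <-.
have [aa av] : above (lab (l := X e) i) (lab a) /\ ~~ vertexT (lab a).
  by apply/(IHi i).2; exists a.
by split=> //; apply: above_input aa.
Qed.

End TreeComposition.

Section LabelStabilizer.
Context (gT : finGroupType) (E : Type) (ea : gT -> E -> E).
Context (ea1 : forall e, ea 1%g e = e).
Context (eaM : forall g h e, ea (g * h)%g e = ea g (ea h e)).
Context (e0 : E) (n : nat) (l : 'I_n -> E).
Local Open Scope group_scope.

(** When l numbers the inputs of the corolla at e0, this is the graph of the action of the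
    stabilizer of e0 on them. *)
Definition label_stab_set : {set gT * symg n} :=
  [set p | `[< ea p.1 e0 = e0 /\ forall i, ea p.1 (l i) = l (sym_fun p.2 i) >]].

Lemma label_stab_group_set : group_set label_stab_set.
Proof.
apply/group_setP; split.
  by rewrite !inE; split=> [|i] /=; rewrite ea1 ?sym_fun1.
move=> p q; rewrite !inE => -[pe pl] [qe ql].
split=> [|i] /=; rewrite eaM; first by rewrite qe pe.
by rewrite ql pl sym_funM.
Qed.

Definition label_stab : {group gT * symg n} := Group label_stab_group_set.

Lemma label_stabP p : reflect
  (ea p.1 e0 = e0 /\ forall i, ea p.1 (l i) = l (sym_fun p.2 i)) (p \in label_stab).
Proof. by apply: (iffP idP); rewrite !inE. Qed.

Lemma label_stab_graph : injective l -> graph_subgroup label_stab.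
Proof.
move=> linj s /label_stabP[_ ls]; apply/permP => i; apply: linj.
by rewrite -[s i]/(sym_fun s i) -ls ea1 /= perm1.
Qed.

End LabelStabilizer.

(** * Operations at the vertices of an F-tree and their composite *)

Section RealizedSieve.
Context (gT : finGroupType) (D : dgop gT) (F : collection gT).
Hypothesis DF : realizes D F.
Context (T : gtree gT).
Local Notation E := (edges T).
Local Notation vertexT := (@is_vertex gT T).
Local Notation eactT := (@edges_act gT T).
Local Notation lact := (lop_act (D := D) eactT).

Lemma edge_orbit_refl (v : E) : v \in edge_orbit v.
Proof. by apply/imsetP; exists 1%g; rewrite ?edges_act1. Qed.

Lemma edge_in_tagged (v : E) : edge_in T (tagged v) = v.
Proof. by case: v. Qed.

(** Number the inputs of v. The graph of the action of its stabilizer is in F by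
    [in_sieve_gcorolla], so D has an operation fixed by it; labelled by the inputs, this operation
    is invariant under the stabilizer. *)
Lemma vertex_operation (v : E) : in_sieve F (vertex_gcorolla v) ->
  exists u : lop D E, [/\ injective (@lab _ _ _ u),
    forall d, inputT v d <-> exists i : 'I_(arity u), lab i = d
    & forall g, eactT g v = v -> lop_eq (lact g u) u].
Proof.
move=> Fv; pose x : {p | p \in edge_orbit v} := exist _ v (edge_orbit_refl v).
pose A := {d : T (tag v) | d \in orbit_inputs x}.
pose n := #|{: A}|; pose l0 : 'I_n -> A := enum_val.
pose l i : E := edge_in T (sval (l0 i)).
have l_inj : injective l.
  by move=> i j /edge_in_inj ij; apply: enum_val_inj; apply: val_inj.
have l_inputs d : inputT v d <-> exists i, l i = d.
  split=> [vd|[i <-]]; last first.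
    have := svalP (l0 i); rewrite /orbit_inputs inE /inputT /rootT /outT /= => /andP[-> /eqP->].
    by apply/eqP; exact: edge_in_tagged.
  have dx := inputT_tag vd.
  have [d' dE] : exists d' : T (tag v), d = edge_in T d'.
    by case: d dx vd => y d /= yE _; subst y; exists d.
  subst d; case/andP: vd => nr /eqP oE.
  have d'in : d' \in orbit_inputs x.
    rewrite /orbit_inputs inE; apply/andP; split; first exact: nr.
    apply/eqP/(@edge_in_inj _ T); rewrite -[LHS]/(outT (edge_in T d')) oE.
    exact/esym/edge_in_tagged.
  by exists (enum_rank (exist _ d' d'in : A)); rewrite /l /l0 enum_rankK.
have Ffam := realizes_family DF.
pose Gamma := label_stab (@edges_act1 gT T) (@edges_actM gT T) v l.
have GF : Gamma \in F n.
  apply: (in_sieve_gcorolla (x := x) (l := l0)) Ffam Fv; first exact: enum_val_bij.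
  move=> p /label_stabP[pv pl].
  have px : orbit_act p.1 x = x by apply: val_inj.
  split=> // i.
  by apply: (@edge_in_sub _ _ _ (fun p => tag (sval p)) (@orbit_inputs _ T v)) => //; exact: pl.
have /DF[y yE] := GF.
exists (Lop y l); split=> // g gv.
have [s sE] : exists s : symg n, forall i, eactT g (l i) = l (sym_fun s i).
  apply: finite_perm_of => //; first exact: edges_act_inj.
  move=> i; have /l_inputs[j jE] : inputT v (eactT g (l i)).
    by rewrite -gv inputT_act; apply/l_inputs; exists i.
  by exists j.
exists (sym_bij s); split=> [|i]; last by rewrite /= sE.
have pG : (g, s) \in Gamma by apply/label_stabP.
by rewrite /= -[RHS](yE _ pG) dact_rel.
Qed.

Lemma edge_orbit_act g (v : E) : edge_orbit (eactT g v) = edge_orbit v.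
Proof.
apply/setP => d; apply/imsetP/imsetP => -[h _ ->].
  by exists (h * g)%g; rewrite ?edges_actM.
by exists (h * g^-1)%g => //; rewrite -edges_actM mulgKV.
Qed.

(** Choose an invariant operation at one vertex of each orbit and transport it along the orbit;
    invariance makes the result independent of the transporting element, up to [lop_eq]. *)
Lemma vertex_operations : F_tree F T ->
  exists X : E -> lop D E,
    [/\ forall g v, vertexT v -> lop_eq (lact g (X v)) (X (eactT g v)),
        forall v, vertexT v -> injective (@lab _ _ _ (X v))
      & forall v, vertexT v -> forall d,
          inputT v d <-> exists i : 'I_(arity (X v)), lab i = d].
Proof.
move=> FT.
have opP (v : E) : exists u : lop D E, vertexT v -> [/\ injective (@lab _ _ _ u),
    forall d, inputT v d <-> exists i : 'I_(arity u), lab i = d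
    & forall g, eactT g v = v -> lop_eq (lact g u) u].
  have [vv|_] := boolP (vertexT v); last by exists (lop_unit D v).
  by have [u uP] := vertex_operation (FT v vv); exists u.
have [Y YP] := choice opP.
(* [pick] sees only the orbit as a set, so [rep] is constant on orbits; the default v is never
   reached. *)
pose rep (v : E) : E := odflt v [pick q in @edge_orbit gT T v].
have rep_act g v : rep (eactT g v) = rep v.
  rewrite /rep edge_orbit_act; case: pickP => //= nv.
  by have := nv v; rewrite edge_orbit_refl.
have repP v : exists h, eactT h (rep v) = v.
  rewrite /rep; case: pickP => [q /imsetP[h _ ->]|nv] /=.
    by exists h^-1%g; rewrite -edges_actM mulVg edges_act1.
  by have := nv v; rewrite edge_orbit_refl.
have [h hE] := choice repP.
have vrep v : vertexT v -> vertexT (rep v) by rewrite -{1}(hE v) vertexT_act.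
exists (fun v => lact (h v) (Y (rep v))); split.
- move=> g v /vrep vv; have [_ _ Yst] := YP _ vv.
  rewrite rep_act lop_actM; last exact: edges_actM.
  (* The two ways to reach gv from the representative differ by c, which fixes the
     representative. *)
  pose c := ((h (eactT g v))^-1 * (g * h v))%g.
  have -> : (g * h v)%g = (h (eactT g v) * c)%g by rewrite mulKVg.
  rewrite -lop_actM; last exact: edges_actM.
  apply: lop_eq_act; apply: Yst.
  by rewrite /c edges_actM edges_actM hE -{2}(hE (eactT g v)) rep_act -edges_actM mulVg edges_act1.
- move=> v /vrep vv; have [Yinj _ _] := YP _ vv.
  by move=> i j /= /edges_act_inj /Yinj.
- move=> v /vrep vv d; have [_ Yin _] := YP _ vv.
  rewrite -{1}(hE v) -[d](edges_act1) -(mulgV (h v)) edges_actM inputT_act Yin.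
  split=> -[i iE]; exists i; first by rewrite /= iE.
  by apply: (@edges_act_inj _ _ (h v)).
Qed.

(** The composite along the component at x0 is labelled by its leaves. By equivariance it is fixed
    by the graph of the action of the stabilizer of x0 on these leaves, which is the graph subgroup
    of [lr T]. *)
Lemma lr_in_sieve : F_tree F T -> in_sieve F (lr T).
Proof.
move=> /vertex_operations[X [Xact Xinj Xin]].
have [x0 _] := iact_transitive T.
pose e0 : E := edge_in T (root (T x0)).
(* Strictly larger than every depth, as the fuel requires. *)
pose N := (\max_(d : E) depth d).+1.
have dN (d : E) : depth d < N by rewrite ltnS; exact: leq_bigmax.
pose u := tree_comp X N e0.
have [u_inj u_lab] := tree_comp_lab Xinj Xin dN (leq_addr (depth e0) N).
have l0P (i : 'I_(arity u)) : exists a : {e : T x0 | e \in leaves (T x0)},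
    lab i = edge_in T (sval a).
  have [ed dv] : above e0 (lab i) /\ ~~ vertexT (lab i) by apply/u_lab; exists i.
  have := above_tag ed; case: (lab i) dv => y d; rewrite /is_vertex negbK /= => dl yE.
  by subst y; exists (exist _ d dl).
have [l0 l0E] := choice l0P.
have l0_bij : bijective l0.
  apply: inj_surj_bijective => [i j ij|[a al]].
    by apply: u_inj; rewrite !l0E ij.
  have /u_lab[i iE] : above e0 (edge_in T a) /\ ~~ vertexT (edge_in T a).
    by split; [exact: above_root|rewrite /is_vertex /= al].
  by exists i; apply: val_inj; apply: (@edge_in_inj _ T x0); rewrite -l0E.
pose Gamma := label_stab (@edges_act1 gT T) (@edges_actM gT T) e0 (@lab _ _ _ u).
have e0_act g : eactT g e0 = e0 <-> iact g x0 = x0.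
  split=> [/(congr1 tag) //|gx]; have [_ rt _ _] := eact_iso g x0.
  by rewrite /e0 /edges_act /= rt gx.
have u_act g : iact g x0 = x0 -> exists2 r : bijection (arity u) (arity u),
    drel r (dact g (oper u)) = oper u & forall i, eactT g (lab i) = lab (sval r i).
  move=> /e0_act gx; have := tree_comp_act Xact N g e0.
  by rewrite gx => -[r [rE lE]]; exists r => // i; rewrite lE.
have GF : Gamma \in F (arity u).
  apply/DF; exists (oper u) => -[g s] /label_stabP[/= /e0_act gx gl].
  have [r rE lE] := u_act g gx.
  rewrite dact_rel -[RHS]rE; congr (drel _ _).
  by apply: bijectionP => i; apply: u_inj; rewrite -lE -gl.
apply: (@gcorolla_in_sieve gT _ _ _ _ _ _ _ _ _ F x0 _ l0 Gamma) => //.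
- move=> p /label_stabP[/e0_act px pl]; split=> // i.
  apply: (@edge_in_sub _ _ _ id (fun x => leaves (T x))) => //.
  by have := pl i; rewrite !l0E.
- exact: label_stab_graph.
- move=> g gx; have [r rE lE] := u_act g gx.
  exists (perm (bij_inj (svalP r))); apply/label_stabP; split; first exact/e0_act.
  by move=> i /=; rewrite lE /sym_fun permE.
Qed.

End RealizedSieve.

Lemma realizes_weak_indexing_system (gT : finGroupType) (D : dgop gT) (F : collection gT) :
  realizes D F -> consists_of_graph_subgroups F -> weak_indexing_system F.
Proof.
move=> DF Fgr; split=> //; first exact: realizes_family DF.
by move=> T; exact: lr_in_sieve.
Qed.

(** * Induced G-trees *)

Section InducedTree.
Context (gT : finGroupType) (H : {group gT}) (T0 : tree) (rho : gT -> T0 -> T0).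
Local Open Scope group_scope.
Hypothesis rho1 : forall e, rho 1 e = e.
Hypothesis rhoM : {in H &, forall g h e, rho (g * h) e = rho g (rho h e)}.
Hypothesis rho_iso : forall h, h \in H -> tree_iso (rho h).

Definition induced_eact g (A : cosets H) (e : T0) : T0 :=
  rho ((repr (sval (cosets_act g A)))^-1 * g * repr (sval A)) e.

(** G ._H T0, with H acting through [rho]. As in [induced_gcorolla], g acts through the element of H
    that compares the representatives of the cosets. *)
Definition induced_gtree : gtree gT.
Proof.
refine (@GTree gT (cosets H) (@cosets_act gT H) (@cosets_act1 gT H) (@cosets_actM gT H)
  (cosets_act_transitive H) (fun _ => T0) induced_eact _ _ _).
- by move=> g A; apply: rho_iso; exact: repr_coset_act.
- move=> A e.
  have -> : induced_eact 1 A e = e by rewrite /induced_eact cosets_act1 mulg1 mulVg rho1.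
  by rewrite cosets_act1.
- move=> g h A e.
  have -> : induced_eact (g * h) A e = induced_eact g (cosets_act h A) (induced_eact h A e).
    rewrite /induced_eact -rhoM ?repr_coset_act // -cosets_actM.
    by rewrite !mulgA mulgK.
  by rewrite cosets_actM.
Defined.

Let T := induced_gtree.

Lemma coset_one_subproof : (H : {set gT}) \in lcosets H [set: gT].
Proof. by apply/lcosetsP; exists 1; rewrite ?inE // lcoset1. Qed.

Definition coset_one : cosets H := exist _ (H : {set gT}) coset_one_subproof.

Let base (e : T0) : edges T := @edge_in _ T coset_one e.

Lemma cosets_act_one g : (cosets_act g coset_one == coset_one) = (g \in H).
Proof.
rewrite -val_eqE /=; apply/eqP/idP => [gH|gH]; last exact: lcoset_id.
by rewrite -gH lcoset_refl.
Qed.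

Lemma induced_eact_one h e : h \in H -> induced_eact h coset_one e = rho h e.
Proof.
move=> hH; have /eqP E := etrans (cosets_act_one h) hH.
by rewrite /induced_eact E /= repr_group invg1 mul1g mulg1.
Qed.

Lemma edges_act_base h e : h \in H -> edges_act h (base e) = base (rho h e).
Proof.
move=> hH; rewrite /edges_act /base /= induced_eact_one //.
by have /eqP -> := etrans (cosets_act_one h) hH.
Qed.

(** Allows all conditions on G-vertices to be checked on the component at the coset H. *)
Lemma base_orbit (v : edges T) : exists g e, base e = edges_act g v.
Proof.
case: v => A e; exists (repr (sval A))^-1.
have E : cosets_act (repr (sval A))^-1 A = coset_one.
  apply: val_inj => /=; case: A {e} => A /= /lcosetsP[x _ ->].
  have /lcosetP[h hH ->] : repr (x *: H) \in x *: H.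
    by apply: (mem_repr x); exact: lcoset_refl.
  by rewrite -lcosetM invMg mulgKV lcoset_id // groupV.
exists (induced_eact (repr (sval A))^-1 A e); rewrite /edges_act /=.
by rewrite E.
Qed.

Context (F : collection gT).
Hypothesis Fwis : weak_indexing_system F.

Hypothesis vertices : forall e, e \notin leaves T0 ->
  exists n (l : 'I_n -> T0) (Gamma : {group gT * symg n}),
    [/\ Gamma \in F n, injective l, forall d, d \in inputs e <-> exists i, l i = d,
        forall g, g \in H -> rho g e = e -> exists s, (g, s) \in Gamma
      & forall p, p \in Gamma -> [/\ p.1 \in H, rho p.1 e = e
          & forall i, rho p.1 (l i) = l (sym_fun p.2 i)]].

(** Each orbit of vertices meets the component at H; there the group given by [vertices] is the
    graph of the action of the stabilizer on the inputs, and [gcorolla_in_sieve] applies. *)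
Lemma induced_F_tree : F_tree F T.
Proof.
move=> v vv; have [g0 [e eE]] := base_orbit v.
have ev : e \notin leaves T0.
  by have := vv; rewrite -(vertexT_act g0) -eE.
have [n [l [Gamma [GF l_inj l_in stab GP]]]] := vertices ev.
have xP : base e \in edge_orbit v by rewrite eE; apply/imsetP; exists g0.
pose x : {p | p \in edge_orbit v} := exist _ (base e) xP.
have l0P i : (l i : T (tag (sval x))) \in orbit_inputs x by apply/l_in; exists i.
pose l0 i : {d : T (tag (sval x)) | d \in orbit_inputs x} := exist _ (l i : T0) (l0P i).
have [_ Fgr _] := Fwis.
apply: (@gcorolla_in_sieve _ _ _ _ _ _ _ _ _ _ F x n l0 Gamma) => //.
- apply: inj_surj_bijective => [i j /(congr1 val) /l_inj //|[d dx]].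
  have /l_in[i iE] := dx.
  by exists i; apply: val_inj.
- move=> p /GP[pH pe pl].
  have px : orbit_act p.1 x = x.
    by apply: val_inj; rewrite /= edges_act_base // pe.
  split=> // i.
  apply: (@edge_in_sub _ T _ (fun p => tag (sval p)) (@orbit_inputs _ T v)) => //.
  by have := edges_act_base (l i) pH; rewrite pl.
- exact: Fgr GF.
- move=> g /(congr1 val) /= gx.
  have gH : g \in H by rewrite -cosets_act_one; apply/eqP; exact: (congr1 tag gx).
  apply: stab => //; move: gx; rewrite edges_act_base //.
  exact: (@edge_in_inj _ T coset_one).
Qed.

(** Closure under [lr] for the induced tree, read off at the component of the coset H by means of
    [in_sieve_gcorolla]. *)
Lemma induced_closed n (l : 'I_n -> T0) (Gamma : {group gT * symg n}) :
  injective l -> (forall d, d \in leaves T0 <-> exists i, l i = d) ->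
  (forall p, p \in Gamma -> p.1 \in H /\ forall i, rho p.1 (l i) = l (sym_fun p.2 i)) ->
  Gamma \in F n.
Proof.
move=> l_inj l_lv GP.
have [Ffam _ /(_ T induced_F_tree) FT] := Fwis.
have l0P i : (l i : T coset_one) \in leaves (T coset_one) by apply/l_lv; exists i.
pose l0 i : {e : T coset_one | e \in leaves (T coset_one)} := exist _ (l i : T0) (l0P i).
apply: (in_sieve_gcorolla (x := coset_one) (l := l0)) Ffam FT.
- apply: inj_surj_bijective => [i j /(congr1 val) /l_inj //|[d dx]].
  have /l_lv[i iE] := dx.
  by exists i; apply: val_inj.
- move=> p /GP[pH pl].
  have px : cosets_act p.1 coset_one = coset_one by apply/eqP; rewrite cosets_act_one.
  split=> // i.
  apply: (@edge_in_sub _ T _ id (fun x => leaves (T x))) => //.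
  by have := edges_act_base (l i) pH; rewrite pl.
Qed.

End InducedTree.

(** * Closure of weak indexing systems under trees of height at most two *)

Section ClosureProperties.
Context (gT : finGroupType) (F : collection gT).
Hypothesis Fwis : weak_indexing_system F.
Local Open Scope group_scope.

Definition edge_tree : tree.
Proof.
by refine (@Tree unit tt [set: unit] (fun _ => tt) erefl _ _) => -[] //; exists 0%N.
Defined.

(** The tree without vertices is an F-tree. *)
Lemma mem_family_one (Gamma : {group gT * symg 1%N}) : Gamma \in F 1%N.
Proof.
apply: (@induced_closed gT [set: gT]%G edge_tree (fun _ e => e) _ _ _ _ Fwis _ _ (fun _ => tt)) => //=.
- by move=> h _; split=> //; exists id.
- by move=> e; rewrite inE.
- by move=> i j _; rewrite [i]ord1 [j]ord1.
- by move=> []; rewrite inE; split=> // _; exists ord0.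
Qed.

Section TwoLevel.
Context (k n : nat) (f : 'I_n -> 'I_k).

Let edge2 := option ('I_k + 'I_n).

Definition out2 (e : edge2) : edge2 :=
  match e with Some (inr a) => Some (inl (f a)) | _ => None end.

(** The root vertex has k inputs, and the vertex over the input i has the fibre of f at i as its
    leaves. An empty fibre gives a vertex without inputs. *)
Definition tree2 : tree.
Proof.
refine (@Tree (edge2 : finType) None [set Some (inr a) | a in 'I_n] out2 erefl _ _).
- by move=> e; exists 2%N; case: e => [[]|].
- by move=> e _; apply/imsetP => -[a _]; case: e => [[]|].
Defined.

Definition act2 (t : symg k) (s : symg n) (e : edge2) : edge2 :=
  match e with
  | Some (inl i) => Some (inl (sym_fun t i))
  | Some (inr a) => Some (inr (sym_fun s a))
  | None => None
  end.

Lemma act2_iso (t : symg k) (s : symg n) :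
  (forall a, f (sym_fun s a) = sym_fun t (f a)) -> @tree_iso tree2 tree2 (act2 t s).
Proof.
move=> fE; split=> //=.
- exists (act2 t^-1 s^-1) => -[[i|a]|] //=; rewrite -sym_funM ?mulVg ?mulgV sym_fun1 //.
- move=> [[i|a]|] /=.
  + by apply/imsetP/imsetP => -[].
  + by rewrite !mem_imset // => ? ? [].
  + by apply/imsetP/imsetP => -[].
- by move=> [[i|a]|] //=; rewrite fE.
Qed.

(** Let H be the projection of Gamma to G. It acts on the two-level tree, through Gamma on the
    leaves and through K on the middle edges; [induced_closed] for this tree gives the claim. *)
Lemma two_level_closed (Gamma : {group gT * symg n}) (K : {group gT * symg k}) :
  graph_subgroup Gamma -> K \in F k ->
  (forall p, p \in Gamma -> exists t, (p.1, t) \in K /\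
    forall a, f (sym_fun p.2 a) = sym_fun t (f a)) ->
  (forall i m (l : 'I_m -> 'I_n) (Delta : {group gT * symg m}), injective l ->
    (forall a, f a = i <-> exists b, l b = a) ->
    (forall p, p \in Delta -> exists s t, [/\ (p.1, s) \in Gamma, (p.1, t) \in K,
      sym_fun t i = i & forall b, sym_fun s (l b) = l (sym_fun p.2 b)]) ->
    Delta \in F m) ->
  Gamma \in F n.
Proof.
move=> Ggr KF GK fib.
have [Ffam Fgr _] := Fwis; have Kgr := Fgr _ _ KF.
have [H [phi GE]] := graph_subgroup_morphism Ggr.
have [J [psi KE]] := graph_subgroup_morphism Kgr.
have phiG h : h \in H -> (h, phi h) \in Gamma by rewrite GE => hH; apply/imsetP; exists h.
have GH g s : (g, s) \in Gamma -> g \in H /\ s = phi g.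
  by rewrite GE => /imsetP[h hH [-> ->]].
have KJ g s : (g, s) \in K -> g \in J /\ s = psi g.
  by rewrite KE => /imsetP[h hH [-> ->]].
have psiP h : h \in H -> [/\ h \in J, (h, psi h) \in K
    & forall a, f (sym_fun (phi h) a) = sym_fun (psi h) (f a)].
  by move=> /phiG/GK[t [/[dup] tK /KJ[hJ tE]]]; subst t.
pose rho h := act2 (psi h) (phi h) : tree2 -> tree2.
have rhoM : {in H &, forall g h e, rho (g * h) e = rho g (rho h e)}.
  move=> g h gH hH; have [[gJ _ _] [hJ _ _]] := (psiP g gH, psiP h hH).
  by rewrite /rho !morphM //; case=> [[i|a]|] //=; rewrite sym_funM.
have rho1 e : rho 1 e = e.
  by rewrite /rho !morph1; case: e => [[i|a]|] //=; rewrite sym_fun1.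
have rho_iso h : h \in H -> tree_iso (rho h).
  by move=> /psiP[_ _ fE]; exact: act2_iso.
apply: (@induced_closed gT H tree2 rho rho1 rhoM rho_iso F Fwis _ n (fun a => Some (inr a))).
- case=> [[i|a]|] ev.
  (* At an upper vertex the required group is the graph of the action on the fibre of f at i of
     those elements of H that fix i; it is in F by the hypothesis on fibres. *)
  + pose A := [set a | f a == i]; pose m := #|A|; pose l : 'I_m -> 'I_n := enum_val.
    pose D := [set p : gT * symg m | [&& p.1 \in H, sym_fun (psi p.1) i == i
      & [forall b, sym_fun (phi p.1) (l b) == l (sym_fun p.2 b)]]].
    have Dgr : group_set D.
      apply/group_setP; split.
        rewrite inE /= group1 !morph1 sym_fun1 eqxx /=.
        by apply/forallP => b; rewrite !sym_fun1.
      move=> p q; rewrite !inE => /and3P[pH /eqP pi /forallP pl] /and3P[qH /eqP qi /forallP ql].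
      have [[pJ _ _] [qJ _ _]] := (psiP _ pH, psiP _ qH).
      rewrite /= groupM //= !morphM // sym_funM qi pi eqxx /=.
      by apply/forallP => b; rewrite !sym_funM (eqP (ql b)) (eqP (pl _)).
    pose Delta : {group gT * symg m} := Group Dgr.
    have l_inj : injective l by exact: enum_val_inj.
    have lP a : f a = i <-> exists b, l b = a.
      split=> [fa|[b <-]]; last by have := enum_valP b; rewrite inE => /eqP.
      have aA : a \in A by rewrite inE fa.
      by exists (enum_rank_in aA a); rewrite /l enum_rankK_in.
    have DP p : p \in Delta -> [/\ p.1 \in H, sym_fun (psi p.1) i = i
        & forall b, sym_fun (phi p.1) (l b) = l (sym_fun p.2 b)].
      by rewrite inE => /and3P[pH /eqP pi /forallP pl]; split=> // b; exact/eqP.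
    exists m, (fun b => Some (inr (l b))), Delta; split.
    * apply: (fib i m l) => // p /DP[pH pi pl].
      have [_ pK _] := psiP _ pH.
      by exists (phi p.1), (psi p.1); split=> //; exact: phiG.
    * by move=> a b [] /l_inj.
    * move=> d; rewrite inE; split=> [|[b <-] /=].
        case: d => [[j|a]|] //= /eqP[fa].
        by have /lP[b <-] := fa; exists b.
      by rewrite (lP (l b)).2 ?eqxx //; exists b.
    * move=> g gH [gi].
      have [s sE] : exists s : symg m, forall b, sym_fun (phi g) (l b) = l (sym_fun s b).
        apply: finite_perm_of => //; first exact: perm_inj.
        move=> b; have [_ _ fE] := psiP _ gH.
        have /lP[c cE] : f (sym_fun (phi g) (l b)) = i.
          by rewrite fE (lP (l b)).2 //; exists b.
        by exists c.
      exists s; rewrite inE /= gH gi eqxx /=.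
      by apply/forallP => b; rewrite sE.
    * by move=> p /DP[pH pi pl]; split=> //= [|b]; rewrite ?pi ?pl.
  + by case/negP: ev; apply/imsetP; exists a.
  (* At the root vertex the group is K restricted to H. *)
  + pose L := (K :&: setX_group H [set: symg k]%G)%G.
    have LP p : p \in L -> p.1 \in H /\ p.2 = psi p.1.
      by case: p => g t; rewrite !inE andbT => /andP[/KJ[_ ->] gH].
    exists k, (fun i => Some (inl i)), L; split.
    * by apply: (Ffam k).1 KF _; exact: subsetIl.
    * by move=> i j [].
    * move=> d; rewrite inE; split=> [|[i <-] //].
      by case: d => [[i|a]|] //= _; exists i.
    * move=> g gH _; have [_ gK _] := psiP _ gH.
      by exists (psi g); rewrite !inE gK gH.
    * by move=> p /LP[pH pE]; split=> // i; rewrite /rho /= pE.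
- by move=> a b [].
- move=> d; split=> [/imsetP[a _ ->]|[a <-]]; first by exists a.
  by apply/imsetP; exists a.
- by case=> g s /GH[gH ->].
Qed.

End TwoLevel.
End ClosureProperties.

(** * The free operad on the symbols with stabilizers in F *)

Section Terms.
Context (gT : finGroupType).
Local Open Scope group_scope.

(** The group acts on its subsets by left translation, and a subgroup Gamma is its own stabilizer;
    hence every required stabilizer occurs. *)
Definition symbol n := {set gT * symg n}.
Definition gmove n (g : gT) (A : symbol n) : symbol n := (g, 1) *: A.
Definition smove n (s : symg n) (A : symbol n) : symbol n := (1, s) *: A.

Lemma gsmoveC n g s (A : symbol n) : gmove g (smove s A) = smove s (gmove g A).
Proof. by rewrite /gmove /smove -!lcosetM; congr (_ *: _); congr pair; rewrite /= ?mulg1 ?mul1g. Qed.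

Lemma gmoveM n g h (A : symbol n) : gmove (g * h) A = gmove g (gmove h A).
Proof. by rewrite /gmove -lcosetM; congr (_ *: _); congr pair; rewrite /= mulg1. Qed.

Lemma smoveM n s t (A : symbol n) : smove (s * t) A = smove s (smove t A).
Proof. by rewrite /smove -lcosetM; congr (_ *: _); congr pair; rewrite /= mulg1. Qed.

Lemma gmove1 n (A : symbol n) : gmove 1 A = A. Proof. exact: lcoset1. Qed.
Lemma smove1 n (A : symbol n) : smove 1 A = A. Proof. exact: lcoset1. Qed.

Lemma gsmoveE n g s (A : symbol n) : (g, s) *: A = gmove g (smove s A).
Proof. by rewrite /gmove /smove -lcosetM; congr (_ *: _); congr pair; rewrite /= ?mulg1 ?mul1g. Qed.

Lemma gmoveK n g (A : symbol n) : gmove g^-1 (gmove g A) = A.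
Proof. by rewrite -gmoveM mulVg gmove1. Qed.

Lemma gmoveVK n g (A : symbol n) : gmove g (gmove g^-1 A) = A.
Proof. by rewrite -gmoveM mulgV gmove1. Qed.

(** The node with symbol s and subterms x_i is identified with the node with symbol
    ts and subterms x_(t^-1 i), for t in Sigma_n. It is represented by
    [Node d t], where d is the Sigma_n-orbit of s and [t] sends ts to the family of
    subterms x_(t^-1 i), and to [Bot] all symbols outside the orbit. *)
Inductive term (V : Type) : Type :=
| Var (v : V)
| Bot
| Node n (d : symbol n -> Prop) (t : symbol n -> 'I_n -> term V).
Arguments Bot {V}.

Fixpoint bind V W (t : term V) (f : V -> term W) : term W :=
  match t with
  | Var v => f v
  | Bot => Bot
  | Node n d t => Node d (fun A i => bind (t A i) f)
  end.

Definition tmap V W (f : V -> W) (t : term V) := bind t (fun v => Var (f v)).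

Fixpoint tact V (g : gT) (t : term V) : term V :=
  match t with
  | Var v => Var v
  | Bot => Bot
  | Node n d t =>
      Node (fun A => d (gmove g^-1 A)) (fun A i => tact g (t (gmove g^-1 A) i))
  end.

Fixpoint occurs V (t : term V) (v : V) : Prop :=
  match t with
  | Var u => u = v
  | Bot => False
  | Node n d t => exists A i, occurs (t A i) v
  end.

Lemma Node_ext V n (d d' : symbol n -> Prop) (t t' : symbol n -> 'I_n -> term V) :
  (forall A, d A <-> d' A) -> (forall A i, t A i = t' A i) -> Node d t = Node d' t'.
Proof.
move=> dd' tt'; have -> : d = d' by apply/funext => A; apply/propext.
by congr Node; apply/funext => A; apply/funext.
Qed.

(** The arity is an index of the data, so injectivity needs the decidability of equality on nat. *)
Lemma Node_inj V n (d d' : symbol n -> Prop) (t t' : symbol n -> 'I_n -> term V) :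
  Node d t = Node d' t' -> d = d' /\ t = t'.
Proof.
case=> dd' tt'.
by split; [move: dd' | move: tt'];
  exact: (Eqdep_dec.inj_pair2_eq_dec _ PeanoNat.Nat.eq_dec).
Qed.

Lemma bind_ext V W (t : term V) (f f' : V -> term W) :
  f =1 f' -> bind t f = bind t f'.
Proof. by move=> /funext ->. Qed.

Lemma bind_Var V (t : term V) : bind t (@Var V) = t.
Proof. by elim: t => //= n d t IH; apply: Node_ext => [A|A i]. Qed.

Lemma bindA V W X (t : term V) (f : V -> term W) (h : W -> term X) :
  bind (bind t f) h = bind t (fun v => bind (f v) h).
Proof. by elim: t => //= n d t IH; apply: Node_ext => [A|A i]. Qed.

Lemma tact_bind V W g (t : term V) (f : V -> term W) :
  tact g (bind t f) = bind (tact g t) (fun v => tact g (f v)).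
Proof. by elim: t => //= n d t IH; apply: Node_ext => [A|A i]. Qed.

Lemma tact_tmap V W g (f : V -> W) (t : term V) : tact g (tmap f t) = tmap f (tact g t).
Proof. exact: tact_bind. Qed.

Lemma tact1 V (t : term V) : tact 1 t = t.
Proof.
by elim: t => //= n d t IH; apply: Node_ext => [A|A i]; rewrite invg1 gmove1.
Qed.

Lemma tactM V g h (t : term V) : tact (g * h) t = tact g (tact h t).
Proof.
by elim: t => //= n d t IH; apply: Node_ext => [A|A i]; rewrite invMg gmoveM.
Qed.

Lemma occurs_bind V W (t : term V) (f : V -> term W) w :
  occurs (bind t f) w <-> exists2 v, occurs t v & occurs (f v) w.
Proof.
elim: t => [v||n d t IH] /=.
- by split=> [vw|[u <-]] //; exists v.
- by split=> // -[].
- split=> [[A [i /IH[v tv vw]]]|[v [A [i tv]] vw]]; first by exists v => //; exists A, i.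
  by exists A, i; apply/IH; exists v.
Qed.

Lemma occurs_tmap V W (f : V -> W) (t : term V) v : occurs t v -> occurs (tmap f t) (f v).
Proof. by move=> tv; apply/occurs_bind; exists v. Qed.

Lemma occurs_tact V g (t : term V) v : occurs (tact g t) v <-> occurs t v.
Proof.
elim: t => //= n d t IH; split=> -[A [i tv]].
  by exists (gmove g^-1 A), i; apply/IH.
by exists (gmove g A), i; apply/IH; rewrite gmoveK.
Qed.

Context (F : collection gT).

(** The stabilizer of A is in F_n, stated for all the subgroups that fix A. *)
Definition admissible n (A : symbol n) :=
  forall Gamma : {group gT * symg n}, (forall p, p \in Gamma -> p *: A = A) ->
    Gamma \in F n.

(** The symbol A0 is a base point of the orbit d: the subterms at A0 determine those at its
    translates, and their sets of variables are disjoint. *)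
Definition node_at V n (d : symbol n -> Prop) (t : symbol n -> 'I_n -> term V)
    (A0 : symbol n) :=
  [/\ admissible A0, forall A, d A <-> exists s, A = smove s A0,
      forall s i, t (smove s A0) (sym_fun s i) = t A0 i,
      forall A i, ~ d A -> t A i = Bot
    & forall i j v, occurs (t A0 i) v -> occurs (t A0 j) v -> i = j].

Fixpoint linear V (t : term V) : Prop :=
  match t with
  | Var _ => True
  | Bot => False
  | Node n d t => exists2 A0, node_at d t A0 & forall i, linear (t A0 i)
  end.

Section NodeAt.
Context (V : Type) (n : nat) (d : symbol n -> Prop) (t : symbol n -> 'I_n -> term V).
Context (A0 : symbol n).
Hypothesis tA0 : node_at d t A0.

Lemma node_at_orbit : d A0.
Proof. by have [_ dE _ _ _] := tA0; apply/dE; exists 1; rewrite smove1. Qed.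

Lemma node_at_occurs v : occurs (Node d t) v <-> exists i, occurs (t A0 i) v.
Proof.
have [_ dE tE tB _] := tA0; split=> [[A [i tv]]|[i tv]]; last by exists A0, i.
have dA : d A by apply: contrapT => /(tB A i) E; rewrite E in tv.
have [s sE] := (dE A).1 dA; exists (sym_fun s^-1 i).
by rewrite -(tE s) -sE -sym_funM mulgV sym_fun1.
Qed.

End NodeAt.

Lemma linear_bind V W (t : term V) (f : V -> term W) : linear t ->
  (forall v, occurs t v -> linear (f v)) ->
  (forall v v' w, occurs t v -> occurs t v' -> occurs (f v) w -> occurs (f v') w -> v = v') ->
  linear (bind t f).
Proof.
elim: t => [v||n d t IH] //= => [_|[A0 tA0 tl]] fl finj; first exact: fl.
exists A0; last first.
  by move=> i; apply: IH => // [v tv|v v' w tv tv']; [apply: fl|apply: finj]; exists A0, i.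
have [adm dE tE tB tdisj] := tA0; split=> // [s i|A i|i j w].
- by rewrite tE.
- by move=> /(tB _ i) ->.
- move=> /occurs_bind[v vi vw] /occurs_bind[v' vj vw'].
  have vv' : v = v' by apply: finj vw vw'; [exists A0, i|exists A0, j].
  by rewrite -vv' in vj; exact: tdisj vi vj.
Qed.

Lemma linear_tmap V W (f : V -> W) (t : term V) :
  injective f -> linear t -> linear (tmap f t).
Proof.
by move=> finj tl; apply: linear_bind => // v v' w _ _ /= <- /finj.
Qed.

Hypothesis Fwis : weak_indexing_system F.

(** The stabilizer of gA is conjugate to that of A. *)
Lemma admissible_gmove n g (A : symbol n) : admissible A -> admissible (gmove g A).
Proof.
move=> Aadm Gamma GA; have [Ffam _ _] := Fwis; have [_ Fconj] := Ffam n.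
pose q : gT * symg n := (g, 1).
suff GF : (Gamma :^ q)%G \in F n.
  have -> : Gamma = ((Gamma :^ q) :^ q^-1)%G.
    by apply: group_inj; rewrite /= conjsgK.
  exact: Fconj.
apply: Aadm => p; rewrite /= mem_conjg => /GA.
rewrite /gmove -/q -lcosetM conjgE invgK => /(congr1 (fun B => q^-1 *: B)).
by rewrite -!lcosetM !mulgA mulVg mul1g mulgKV lcoset1.
Qed.

Lemma linear_tact V g (t : term V) : linear t -> linear (tact g t).
Proof.
elim: t => //= n d t IH [A0 [adm dE tE tB tdisj] tl].
exists (gmove g A0); last by move=> i; rewrite gmoveK; exact: IH.
split.
- exact: admissible_gmove.
- move=> A; rewrite dE; split=> -[s sE]; exists s.
    by rewrite -gsmoveC -sE gmoveVK.
  by rewrite sE gsmoveC gmoveK.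
- by move=> s i; rewrite gsmoveC !gmoveK tE.
- by move=> A i /(tB _ i) ->.
- by move=> i j v; rewrite gmoveK !occurs_tact; exact: tdisj.
Qed.

(** A node records its subterms separately for each symbol of the orbit, so a renaming that fixes
    the node fixes every subterm. *)
Lemma linear_fixed_occurs V (t : term V) (f : V -> V) :
  linear t -> tmap f t = t -> forall v, occurs t v -> f v = v.
Proof.
elim: t => [u||n d t IH] // => [_ [fu] v <- //|[A0 tA0 tl]].
move=> /Node_inj[_ tE] v /(node_at_occurs tA0)[i]; apply: (IH A0 i (tl i)).
exact: (f_equal (fun u => u A0 i) tE).
Qed.

(** If g followed by a renaming fixes the node, then g moves A0 inside its Sigma_n-orbit, and the
    permutation that brings it back describes how the subterms are permuted. *)
Lemma node_fixed V n (d : symbol n -> Prop) (t : symbol n -> 'I_n -> term V) A0 g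
    (f : V -> V) :
  node_at d t A0 -> tmap f (tact g (Node d t)) = Node d t ->
  (exists s, (g, s) *: A0 = A0) /\
  forall s, (g, s) *: A0 = A0 ->
    forall i, tmap f (tact g (t A0 i)) = t A0 (sym_fun s i).
Proof.
move=> tA0 /Node_inj[dE tE]; have [_ dP tP _ _] := tA0; split.
  have : d (gmove g^-1 A0) by rewrite [d _](f_equal (fun e => e A0) dE); exact: node_at_orbit tA0.
  by case/dP => s sE; exists s; rewrite gsmoveE -sE gmoveVK.
move=> s sA0 i; rewrite -[RHS](f_equal (fun u => u A0 (sym_fun s i)) tE) /=.
suff -> : gmove g^-1 A0 = smove s A0 by rewrite tP.
by rewrite -{1}sA0 gsmoveE gmoveK.
Qed.

(** By induction on t. At a node, [two_level_closed] applies with K the stabilizer of the root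
    symbol and f sending a variable to the index of the subterm that contains it; the induction
    hypothesis handles the fibres. *)
Lemma linear_fixed_mem V (t : term V) : linear t ->
  forall n (l : 'I_n -> V) (Gamma : {group gT * symg n}), injective l ->
  (forall v, occurs t v <-> exists i, l i = v) ->
  (forall p, p \in Gamma -> exists f : V -> V,
     tmap f (tact p.1 t) = t /\ forall i, f (l i) = l (sym_fun p.2 i)) ->
  Gamma \in F n.
Proof.
elim: t => [u||k d t IH] //.
  move=> _ n l Gamma l_inj l_occ _.
  have [i iE] := (l_occ u).1 erefl.
  (* All values of the injective l equal the single variable u. *)
  have n1 : n = 1%N.
    case: n l Gamma l_inj l_occ i iE => [|[|n]] l Gamma l_inj l_occ i iE //; first by case: i iE.
    have lu j : l j = u by apply/esym/l_occ; exists j.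
    by have := l_inj ord0 ord_max (etrans (lu _) (esym (lu _))).
  by subst n; exact: mem_family_one.
move=> tlin n l Gamma l_inj l_occ Gfix.
have [A0 tA0 tl] := tlin; have [adm dE tP tB tdisj] := tA0.
(* A pair (1, s) in Gamma is a pure renaming that fixes t, hence fixes every variable. *)
have Ggr : graph_subgroup Gamma.
  move=> s /Gfix[f [fE fl]]; rewrite [tact _ _]tact1 in fE; apply/permP => i; apply: l_inj.
  rewrite perm1 -[s i]/(sym_fun s i) -fl.
  by apply: linear_fixed_occurs fE _ _ => //; apply/l_occ; exists i.
have Kgr : group_set [set p : gT * symg k | p *: A0 == A0].
  apply/group_setP; split; first by rewrite inE lcoset1.
  by move=> p q; rewrite !inE => /eqP pA /eqP qA; rewrite lcosetM qA pA.
pose K : {group gT * symg k} := Group Kgr.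
have KP p : p \in K -> p *: A0 = A0 by rewrite inE => /eqP.
have fP a : exists i, occurs (t A0 i) (l a).
  by apply/(node_at_occurs tA0)/l_occ; exists a.
have [f fE] := choice fP.
have f_uniq a i : occurs (t A0 i) (l a) -> f a = i by apply: tdisj.
apply: (two_level_closed Fwis (f := f) (K := K)) => //; first exact: adm.
- case=> g s /Gfix[h [hE hl]].
  have [[t' t'E] tfix] := node_fixed tA0 hE.
  exists t'; split=> [|a]; first by rewrite inE; apply/eqP.
  apply: f_uniq; rewrite -tfix // -hl.
  by apply: occurs_tmap; apply/occurs_tact.
- move=> i m l' Delta l'_inj l'_im DP.
  apply: (IH A0 i (tl i) m (l \o l')) => [|v|p /DP[s [t' [sG tK ti sl]]]].
  + exact: inj_comp.
  + split=> [tv|[b <-] /=].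
      have [a aE] : exists a, l a = v by apply/l_occ/(node_at_occurs tA0); exists i.
      have [b bE] : exists b, l' b = a by apply/l'_im; apply: f_uniq; rewrite aE.
      by exists b; rewrite /= bE.
    by rewrite -((l'_im (l' b)).2 (ex_intro _ b erefl)); exact: fE.
  + have [h [hE hl]] := Gfix _ sG.
    have [_ tfix] := node_fixed tA0 hE.
    exists h; split=> [|b /=]; last by rewrite hl sl.
    by rewrite (tfix t') ?ti //; exact: KP tK.
Qed.

Definition op_term n := {t : term 'I_n | linear t /\ forall i, occurs t i}.

Lemma op_termP n (x y : op_term n) : sval x = sval y -> x = y.
Proof. by move=> xy; apply: eq_sig_hprop => // *; exact: Prop_irrelevance. Qed.

Lemma op_act_subproof g n (x : op_term n) :
  linear (tact g (sval x)) /\ forall i, occurs (tact g (sval x)) i.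
Proof.
case: x => x /= [xl xo]; split; first exact: linear_tact.
by move=> i; apply/occurs_tact.
Qed.

Definition op_act g n (x : op_term n) : op_term n := exist _ _ (op_act_subproof g x).

Lemma op_rel_subproof m n (s : bijection m n) (x : op_term m) :
  linear (tmap (sval s) (sval x)) /\ forall i, occurs (tmap (sval s) (sval x)) i.
Proof.
case: x => x /= [xl xo]; split; first exact/linear_tmap/xl/bij_inj/(svalP s).
by move=> i; have [s' _ sK] := svalP s; rewrite -[i]sK; apply: occurs_tmap.
Qed.

Definition op_rel m n (s : bijection m n) (x : op_term m) : op_term n :=
  exist _ _ (op_rel_subproof s x).

Lemma op_one_subproof : linear (Var (@ord0 0)) /\ forall i, occurs (Var (@ord0 0)) i.
Proof. by split=> // i; rewrite [i]ord1. Qed.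

Definition op_one : op_term 1%N := exist _ _ op_one_subproof.

Lemma op_comp_subproof k (n : 'I_k -> nat) (x : op_term k) (y : forall i, op_term (n i)) :
  let t := bind (sval x) (fun i => tmap (@tagnat.Rank k n i) (sval (y i))) in
  linear t /\ forall i, occurs t i.
Proof.
case: x => x /= [xl xo]; split.
  apply: linear_bind => // [i _|i j p _ _].
    apply: linear_tmap; last exact: (svalP (y i)).1.
    by move=> a b /(congr1 val)/eqP; rewrite tagnat.eq_Rank eqxx => /eqP/val_inj.
  move=> /occurs_bind[a _ /= <-] /occurs_bind[b _ /= /esym/(congr1 val)/eqP].
  by rewrite tagnat.eq_Rank => /andP[/eqP].
apply: tagnat_Rank_ind => i a; apply/occurs_bind; exists i => //.
by apply: occurs_tmap; exact: (svalP (y i)).2.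
Qed.

Definition op_comp k (n : 'I_k -> nat) (x : op_term k) (y : forall i, op_term (n i)) :
  op_term (\sum_i n i)%N := exist _ _ (op_comp_subproof x y).

Lemma tmap_comp V W X (h : W -> X) (f : V -> W) (t : term V) :
  tmap h (tmap f t) = tmap (fun v => h (f v)) t.
Proof. exact: bindA. Qed.

Lemma tmap_ext V W (f f' : V -> W) (t : term V) : f =1 f' -> tmap f t = tmap f' t.
Proof. by move=> /funext ->. Qed.

Lemma tmap_bind V W X (h : W -> X) (t : term V) (f : V -> term W) :
  tmap h (bind t f) = bind t (fun v => tmap h (f v)).
Proof. exact: bindA. Qed.

Lemma bind_tmap V W X (f : V -> W) (t : term V) (h : W -> term X) :
  bind (tmap f t) h = bind t (fun v => h (f v)).
Proof. exact: bindA. Qed.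

(** On underlying terms the laws reduce to the monad laws of [bind] and its compatibility with
    [tact]. *)
Definition free_dgop : dgop gT.
Proof.
refine (@DGop gT op_term op_act op_rel op_one op_comp _ _ _ _ _ _ _ _ _ _ _).
- by move=> n x; apply: op_termP; exact: tact1.
- by move=> g h n x; apply: op_termP; exact: tactM.
- by move=> n x; apply: op_termP; exact: bind_Var.
- by move=> l m n t s x; apply: op_termP; rewrite /= tmap_comp.
- by move=> g m n s x; apply: op_termP; exact: tact_tmap.
- by move=> g; apply: op_termP.
- move=> g k n x y; apply: op_termP; rewrite /= tact_bind.
  by apply: bind_ext => i; rewrite tact_tmap.
- move=> k k' n n' s t r x y y' rE yE; apply: op_termP; rewrite /= tmap_bind bind_tmap.
  apply: bind_ext => i; rewrite yE /= !tmap_comp.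
  by apply: tmap_ext => a; rewrite rE.
- move=> n r y rE; apply: op_termP; rewrite /= tmap_comp -[RHS]bind_Var.
  by apply: bind_ext => a; rewrite rE.
- move=> k r x rE; apply: op_termP; rewrite /= tmap_bind -[RHS]bind_Var.
  by apply: bind_ext => i; rewrite /tmap /= rE.
- move=> k n m r x y z rE; apply: op_termP; rewrite /= tmap_bind bindA.
  apply: bind_ext => i; rewrite bind_tmap tmap_bind; apply: bind_ext => a.
  rewrite !tmap_comp.
  (* Stated as a family over pairs (i, a), so that [tagnat_sig_Rank] can replace the decoded indices
     all at once. *)
  pose q i (a : 'I_(n i)) := tmap (fun b => tagnat.Rank
     (p_ := fun i => (\sum_(a < n i) m i a)%N) i (tagnat.Rank (p_ := m i) a b)) (sval (z i a)).
  rewrite -[RHS]/(q i a) -(tagnat_sig_Rank q); apply: tmap_ext => b.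
  by rewrite rE.
Defined.

(** Sigma_n acts freely on the cosets of a graph subgroup. *)
Lemma graph_symbol_uniq n (Gamma : {group gT * symg n}) (s t : symg n) :
  graph_subgroup Gamma -> smove s Gamma = smove t Gamma -> s = t.
Proof.
move=> Ggr /lcoset_eqP; rewrite mem_lcoset => stG.
have /Ggr/eqP : (1, t^-1 * s) \in Gamma.
  by rewrite (_ : (1, _) = (1, t)^-1 * (1, s) :> gT * symg n) //; congr pair; rewrite /= mulVg.
by rewrite -eq_mulVg1 => /eqP.
Qed.

Section GenericOperation.
Context (n : nat) (Gamma : {group gT * symg n}).
Hypothesis GF : Gamma \in F n.

Definition generic_orbit (A : symbol n) := exists s, A = smove s Gamma.

(** Together with [generic_orbit] this represents the symbol Gamma applied to the variables in
    order; s is unique by [graph_symbol_uniq]. *)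
Definition generic_args (A : symbol n) (i : 'I_n) : term 'I_n :=
  if [pick s | A == smove s Gamma] is Some s then Var (sym_fun s^-1 i) else Bot.

Lemma generic_argsE s i : generic_args (smove s Gamma) i = Var (sym_fun s^-1 i).
Proof.
have [_ Fgr _] := Fwis.
rewrite /generic_args; case: pickP => [t /eqP /(graph_symbol_uniq (Fgr _ _ GF)) -> //|].
by move/(_ s); rewrite eqxx.
Qed.

Lemma generic_args_Bot A i : ~ generic_orbit A -> generic_args A i = Bot.
Proof.
by move=> nA; rewrite /generic_args; case: pickP => // s /eqP sE; case: nA; exists s.
Qed.

Lemma generic_argsE1 i : generic_args Gamma i = Var i.
Proof. by rewrite -[X in generic_args X](smove1 Gamma) generic_argsE invg1 sym_fun1. Qed.

Lemma generic_linear : linear (Node generic_orbit generic_args) /\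
  forall i, occurs (Node generic_orbit generic_args) i.
Proof.
split; last by move=> i; exists (Gamma : {set _}), i; rewrite generic_argsE1.
exists (Gamma : {set _}); last by move=> i; rewrite generic_argsE1.
split=> //.
(* A subgroup that fixes the set Gamma by translation lies in Gamma, because Gamma contains 1. *)
- move=> Delta DG; have [Ffam _ _] := Fwis; apply: (Ffam n).1 GF _.
  by apply/fintype.subsetP => p /DG <-; exact: lcoset_refl.
- by move=> s i; rewrite generic_argsE -sym_funM mulVg sym_fun1 generic_argsE1.
- by move=> A i; exact: generic_args_Bot.
- by move=> i j v; rewrite !generic_argsE1 /= => -> ->.
Qed.

Definition generic_op : op_term n := exist _ _ generic_linear.

(** For (g, s) in Gamma the translates of Gamma by g^-1 and by s coincide, so the action of g
    cancels the renaming by s. *)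
Lemma generic_op_fixed p : p \in Gamma -> op_act p.1 (op_rel (sym_bij p.2) generic_op) = generic_op.
Proof.
case: p => g s pG; apply: op_termP.
have sG : gmove g^-1 Gamma = smove s Gamma.
  have E : (g, s) *: Gamma = Gamma by exact: lcoset_id.
  by rewrite -[in LHS]E gsmoveE gmoveK.
have moveE t : gmove g^-1 (smove t Gamma) = smove (t * s) Gamma.
  by rewrite gsmoveC sG smoveM.
have orbitE A : generic_orbit (gmove g^-1 A) <-> generic_orbit A.
  split=> -[t tE]; last by exists (t * s); rewrite tE moveE.
  exists (t * s^-1); rewrite -[A](gmoveVK g) tE.
  by rewrite -[X in smove X _](mulgKV s) -moveE gmoveVK.
apply: Node_ext => [//|A i].
have [[t tE]|nA] := pselect (generic_orbit A).
  rewrite tE moveE !generic_argsE /=; congr Var.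
  by rewrite invMg -[LHS]sym_funM mulKVg.
by rewrite !generic_args_Bot // orbitE.
Qed.

End GenericOperation.

Lemma free_dgop_realizes : realizes free_dgop F.
Proof.
move=> n Gamma; split=> [GF|[[x [xl xo]] xfix]].
  by exists (generic_op GF) => p; exact: generic_op_fixed.
apply: (linear_fixed_mem (t := x) xl (l := id)) => // [v|p pG].
  by split=> // _; exists v.
exists (sym_fun p.2); split=> //.
by rewrite -tact_tmap; exact: (congr1 sval (xfix p pG)).
Qed.

Lemma free_dgop_sym_free n (s : symg n) (x : free_dgop n) :
  drel (sym_bij s) x = x -> s = 1.
Proof.
case: x => x [xl xo] /(congr1 sval) /= xs; apply/permP => i.
by rewrite perm1; exact: linear_fixed_occurs xs _ (xo i).
Qed.

End Terms.

(** * The homotopy category *)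

Section LocalizationTheory.
Context (C : category) (W : forall a b : C, hom a b -> Prop).

Local Notation Loc := (localization W).

(** The identity, which spares the costly unification of the objects of C with those
    of its localization *)
Definition loc_ob (a : C) : Loc := a.

Definition loc_map (a b : C) (f : hom a b) : @hom Loc a b :=
  loc_class (zz_fwd f (zz_nil W a)).

Definition loc_inv (a b : C) (w : hom a b) (Ww : W w) : @hom Loc b a :=
  loc_class (zz_bwd Ww (zz_nil W b)).

Lemma loc_class_comp (a b c : C) (z : zigzag W b c) (y : zigzag W a b) :
  (loc_class z : @hom Loc b c) ∘ (loc_class y : @hom Loc a b) = loc_class (zz_cat z y).
Proof. by apply/loc_classP; apply: zz_cat_congr; exact: loc_repr_class. Qed.

Lemma loc_map1 (a : C) : loc_map (idm a) = idm (a : Loc).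
Proof. by apply/loc_classP; exact: zz_fwd_id. Qed.

Lemma loc_mapM (a b c : C) (g : hom b c) (f : hom a b) :
  loc_map (g ∘ f) = loc_map g ∘ loc_map f.
Proof. by rewrite [RHS]loc_class_comp; apply/loc_classP; exact: zz_fwd_comp. Qed.

Lemma loc_invl (a b : C) (w : hom a b) (Ww : W w) :
  loc_inv Ww ∘ loc_map w = idm (a : Loc).
Proof. by rewrite [LHS]loc_class_comp; apply/loc_classP; exact: zz_bwd_fwd. Qed.

Lemma loc_invr (a b : C) (w : hom a b) (Ww : W w) :
  loc_map w ∘ loc_inv Ww = idm (b : Loc).
Proof. by rewrite [LHS]loc_class_comp; apply/loc_classP; exact: zz_fwd_bwd. Qed.

Lemma loc_mapI (a b c : C) (w : hom b c) (Ww : W w) (f g : @hom Loc a b) :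
  @compm Loc _ _ _ (loc_map w) f = @compm Loc _ _ _ (loc_map w) g -> f = g.
Proof.
by move=> E; rewrite -[f]comp1m -[g]comp1m -(loc_invl Ww) -!compmA E.
Qed.

(** [E] is a reflection of the objects of C by maps [eta] in W, and [p], [q] make
    [B a b] a span from [E a] to [E b], playing the role of a product. *)
Section UniqueMorphisms.
Context (R : C -> C -> Prop) (E : C -> C) (B : C -> C -> C).
Context (eta : forall a, hom a (E a)).
Context (p : forall a b, hom (B a b) (E a)) (q : forall a b, hom (B a b) (E b)).
Hypothesis Rrefl : forall a, R a a.
Hypothesis Rfwd : forall a b d (f : hom b d), R a b -> R a d.
Hypothesis Rbwd : forall a b d (w : hom d b), W w -> R a b -> R a d.
Hypothesis eta_W : forall a, W (eta a).
Hypothesis p_W : forall a b, R a b -> W (p a b).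
Hypothesis diagonal : forall a, exists d : hom (E a) (B a a),
  p a a ∘ d = idm (E a) /\ q a a ∘ d = idm (E a).
Hypothesis naturality : forall a b d (f : hom b d),
  exists (ef : hom (E b) (E d)) (bf : hom (B a b) (B a d)),
    [/\ eta d ∘ f = ef ∘ eta b, p a d ∘ bf = p a b & q a d ∘ bf = ef ∘ q a b].

(** The class of the zigzag a -> E a <- B a b -> E b <- b. *)
Definition loc_canon (a b : C) (r : R a b) : @hom Loc a b :=
  @compm Loc _ _ _ (loc_inv (eta_W b)) (@compm Loc _ _ _ (loc_map (q a b))
    (@compm Loc _ _ _ (loc_inv (p_W r)) (loc_map (eta a)))).

Lemma loc_canon_refl (a : C) (r : R a a) : loc_canon r = idm (a : Loc).
Proof.
have [d [pd qd]] := diagonal a.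
(* The diagonal is a section of p, hence its inverse in the localization. *)
have invE : loc_inv (p_W r) = loc_map d.
  by apply: (loc_mapI (p_W r)); rewrite loc_invr -loc_mapM pd loc_map1.
rewrite /loc_canon invE [X in @compm Loc _ _ _ _ X]compmA -loc_mapM qd loc_map1 comp1m.
exact: loc_invl.
Qed.

Lemma loc_canon_fwd (a b d : C) (f : hom b d) (r : R a b) (s : R a d) :
  @compm Loc _ _ _ (loc_map f) (loc_canon r) = loc_canon s.
Proof.
have [ef [bf [etaE pE qE]]] := naturality a f.
have E1 : loc_inv (p_W s) = @compm Loc _ _ _ (loc_map bf) (loc_inv (p_W r)).
  by apply: (loc_mapI (p_W s)); rewrite loc_invr compmA -loc_mapM pE loc_invr.
apply: (loc_mapI (eta_W d)).
rewrite /loc_canon E1 !compmA loc_invr comp1m -!loc_mapM etaE qE !loc_mapM.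
congr (@compm Loc _ _ _ _ _); congr (@compm Loc _ _ _ _ _); congr (@compm Loc _ _ _ _ _).
by rewrite -compmA loc_invr compm1.
Qed.

Lemma loc_class_rel (a b : C) (z : zigzag W a b) : R a b.
Proof.
elim: z => [|b' d f z IH|b' d w Ww z IH]; [exact: Rrefl|exact: Rfwd f IH|exact: Rbwd Ww IH].
Qed.

(** By induction on the zigzag; [loc_canon_fwd] absorbs a forward arrow, and also a backward one
    after cancelling it against its inverse. *)
Lemma loc_class_eq (a b : C) (z : zigzag W a b) (r : R a b) :
  (loc_class z : @hom Loc a b) = loc_canon r.
Proof.
elim: z r => [|b' d f z IH|b' d w Ww z IH] r; first by rewrite loc_canon_refl.
- have r' := loc_class_rel z.
  have -> : loc_class (zz_fwd f z) =
      @compm Loc _ _ _ (loc_map f) (loc_class z : @hom Loc a b').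
    by rewrite [RHS]loc_class_comp.
  by rewrite (IH r'); exact: loc_canon_fwd.
- have r' := loc_class_rel z.
  have -> : loc_class (zz_bwd Ww z) =
      @compm Loc _ _ _ (loc_inv Ww) (loc_class z : @hom Loc a b').
    by rewrite [RHS]loc_class_comp.
  by rewrite (IH r') -(loc_canon_fwd w r r') compmA loc_invl comp1m.
Qed.

Lemma loc_hom_rel (a b : C) : @hom Loc a b -> R a b.
Proof. by move=> f; exact: loc_class_rel (loc_repr f). Qed.

Lemma loc_hom_uniq (a b : C) (f g : @hom Loc a b) : f = g.
Proof.
have r := loc_hom_rel f.
by rewrite -[f]loc_reprK -[g]loc_reprK [LHS](loc_class_eq _ r) [RHS](loc_class_eq _ r).
Qed.

Section ThinEquivalence.
Context (I : category) (I_thin : forall (x y : I) (f g : hom x y), f = g).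
Context (phi : C -> I) (phi_hom : forall a b, R a b -> hom (phi a) (phi b)).
Context (psi : I -> C) (psi_rel : forall x y, hom x y -> R (psi x) (psi y)).
Hypothesis psi_phi : forall a, R (psi (phi a)) a /\ R a (psi (phi a)).
Context (phi_psi : forall x, hom (phi (psi x)) x) (phi_psi' : forall x, hom x (phi (psi x))).

Definition loc_functor : functor Loc I.
Proof.
refine (@Functor Loc I phi (fun a b f => phi_hom (loc_hom_rel f)) _ _);
  by move=> *; exact: I_thin.
Defined.

Definition loc_inverse : functor I Loc.
Proof.
refine (@Functor I Loc psi (fun x y f => loc_canon (psi_rel f)) _ _);
  by move=> *; exact: loc_hom_uniq.
Defined.

(** Both categories are thin, so functor laws and naturality are automatic, and only morphisms in
    both directions have to be provided. *)
Lemma loc_thin_equivalence : exists Phi : functor Loc I,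
  (forall a : C, Phi (loc_ob a) = phi a) /\ is_equivalence Phi.
Proof.
exists loc_functor; split=> //; exists loc_inverse; split.
  exists (fun a : Loc => loc_canon (psi_phi a).1); split=> [a|a b f]; last exact: loc_hom_uniq.
  by exists (loc_canon (psi_phi a).2); split; exact: loc_hom_uniq.
exists phi_psi; split=> [x|x y f]; last exact: I_thin.
by exists (phi_psi' x); split; exact: I_thin.
Qed.

End ThinEquivalence.
End UniqueMorphisms.
End LocalizationTheory.

(** * Families of N-infinity operads and their codiscrete replacements *)

Section NInftyOperads.
Context (gT : finGroupType) (V : spaces) (C : codisc V).

Definition sym_free (D : dgop gT) :=
  forall n (s : symg n) (x : D n), drel (sym_bij s) x = x -> s = 1%g.

Lemma realizes_uniq (D : dgop gT) (F F' : collection gT) :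
  realizes D F -> realizes D F' -> F = F'.
Proof.
move=> DF DF'; apply: functional_extensionality_dep => n; apply/setP => Gamma.
by apply/idP/idP; rewrite DF DF'.
Qed.

Lemma sym_free_graph (D : dgop gT) (F : collection gT) :
  realizes D F -> sym_free D -> consists_of_graph_subgroups F.
Proof.
move=> DF Dfree n Gamma /DF[x xE] s sG; apply: (Dfree _ _ x).
by have := xE _ sG; rewrite dact1.
Qed.

Lemma realizes_indexing (D : dgop gT) (F : collection gT) :
  realizes D F -> sym_free D -> (forall n H, trivial_graph n H \in F n) ->
  indexing_system F.
Proof.
move=> DF Dfree Ftriv; split=> //; apply: (realizes_weak_indexing_system DF).
exact: sym_free_graph DF Dfree.
Qed.

Lemma cod_goperad_Ninfty (D : dgop gT) (F : collection gT) :
  realizes D F -> sym_free D -> (forall n H, trivial_graph n H \in F n) ->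
  is_Ninfty (cod_goperad C D).
Proof.
move=> DF Dfree Ftriv; split.
- apply: (codiscrete_gcontractible (c := C)); first exact: codiscrete_cod.
  (* The trivial graph of the whole group G in arity 0 provides a G-fixed operation. *)
  have /DF[x xE] := Ftriv 0%N [set: gT]%G.
  exists (cod_elem C x) => g; apply: (can_inj (@cod_valK V C (D 0%N))).
  rewrite /= cod_mapE cod_elemK.
  have gG : (g, 1%g) \in trivial_graph 0 [set: gT]%G by apply/setXP; rewrite /= !inE eqxx.
  have := xE _ gG; rewrite /= (_ : sym_bij _ = bijection_id 0) ?drel1 //.
  by apply: bijectionP => i; exact: sym_fun1.
- move=> n s s1; apply/(is_emptyE C); move/(pts_fixp C) => [x xE].
  case/eqP: s1; apply: (Dfree _ _ (cod_val x)).
  by rewrite -[RHS]/(cod_val x) -[in RHS](xE tt) /= cod_mapE.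
- by exists F; split=> //; [exact: realizes_family DF|exact: realizes_has_fixed_points].
Qed.

Lemma Ninfty_sym_free (O : goperad gT V) : is_Ninfty O -> sym_free (dpts C O).
Proof.
case=> _ Ofree _ n s x xs; apply: contrapT => /eqP /(Ofree n) /(is_emptyE C); apply.
by apply/(pts_fixp C); exists x.
Qed.

(** Freeness of the symmetric actions makes the members of F graph subgroups; closure under [lr]
    then follows by composing points of O along trees. *)
Lemma Ninfty_fixed (O : goperad gT V) : is_Ninfty O ->
  exists F : collection gT, indexing_system F /\ has_fixed_points F O.
Proof.
move=> ON; have [_ _ [F [Ffam Ftriv FO]]] := ON; exists F; split=> //.
apply: (realizes_indexing (D := dpts C O)) Ftriv; last exact: Ninfty_sym_free.
exact: has_fixed_points_realizes FO.
Qed.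

Lemma realizes_prod (D D' : dgop gT) (F F' : collection gT) :
  realizes D F -> realizes D' F' -> realizes (dprod D D') (fun n => F n :&: F' n).
Proof.
move=> DF DF' n Gamma; rewrite inE; split=> [/andP[/DF[x xE] /DF'[y yE]]|[[x y] xyE]].
  by exists (x, y) => p pG; rewrite /= xE // yE.
apply/andP; split.
  by apply/DF; exists x => p /xyE /(congr1 fst).
by apply/DF'; exists y => p /xyE /(congr1 snd).
Qed.

Lemma sym_free_prod (D D' : dgop gT) : sym_free D -> sym_free (dprod D D').
Proof. by move=> Dfree n s [x y] /(congr1 fst) /Dfree. Qed.

Local Notation Op := (goperad_category gT V).

Lemma pts_map_hom_comp (O P Q : goperad gT V) (g : @hom Op P Q) (f : @hom Op O P) n
    (x : pts C (goperad_level O n)) :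
  pts_map (sval (sval (g ∘ f)) n) x =
  pts_map (sval (sval g) n) (pts_map (sval (sval f) n) x).
Proof. by rewrite /= pts_mapM. Qed.

Lemma pts_map_hom_id (O : goperad gT V) n (x : pts C (goperad_level O n)) :
  pts_map (sval (sval (idm (O : Op))) n) x = x.
Proof. by rewrite /= pts_map1. Qed.

Definition cod_fmap (X Y : dgop gT) (f : dgop_map X Y) :
    @hom Op (cod_goperad C X) (cod_goperad C Y) :=
  transpose (dmap_comp f (cod_counit C X)).

Lemma cod_fmapE (X Y : dgop gT) (f : dgop_map X Y) n
    (x : pts C (goperad_level (cod_goperad C X) n)) :
  cod_val (pts_map (sval (sval (cod_fmap f)) n) x) = f n (cod_val x).
Proof. exact: transposeE. Qed.

Definition cod_eta (O : goperad gT V) : @hom Op O (cod_goperad C (dpts C O)) :=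
  transpose (dmap_id (dpts C O)).

Lemma cod_etaE (O : goperad gT V) n (x : pts C (goperad_level O n)) :
  cod_val (pts_map (sval (sval (cod_eta O)) n) x) = x.
Proof. exact: transposeE. Qed.

Lemma cod_fmap_diagonal (X : dgop gT) :
  exists d : @hom Op (cod_goperad C X) (cod_goperad C (dprod X X)),
    cod_fmap (dfst X X) ∘ d = idm (cod_goperad C X : Op) /\
    cod_fmap (dsnd X X) ∘ d = idm (cod_goperad C X : Op).
Proof.
pose d := cod_fmap (dpair (dmap_id X) (dmap_id X)).
exists d; split; apply: goperad_hom_cod_ext => n x.
- apply: etrans (congr1 _ (pts_map_hom_comp (cod_fmap (dfst X X)) d x)) _.
  by rewrite !cod_fmapE pts_map_hom_id.
- apply: etrans (congr1 _ (pts_map_hom_comp (cod_fmap (dsnd X X)) d x)) _.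
  by rewrite !cod_fmapE pts_map_hom_id.
Qed.

Lemma cod_fmap_naturality (X : dgop gT) (P Q : goperad gT V) (f : @hom Op P Q) :
  exists (ef : @hom Op (cod_goperad C (dpts C P)) (cod_goperad C (dpts C Q)))
         (bf : @hom Op (cod_goperad C (dprod X (dpts C P))) (cod_goperad C (dprod X (dpts C Q)))),
    [/\ cod_eta Q ∘ f = ef ∘ cod_eta P,
        cod_fmap (dfst X (dpts C Q)) ∘ bf = cod_fmap (dfst X (dpts C P))
      & cod_fmap (dsnd X (dpts C Q)) ∘ bf = ef ∘ cod_fmap (dsnd X (dpts C P))].
Proof.
pose ef := cod_fmap (dpts_map C f).
pose bf := cod_fmap (dpair (dfst X (dpts C P))
  (dmap_comp (dpts_map C f) (dsnd X (dpts C P)))).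
exists ef, bf; split; apply: goperad_hom_cod_ext => n x.
- apply: etrans (congr1 _ (pts_map_hom_comp (cod_eta Q) f x)) _.
  apply: etrans (cod_etaE _) _; apply/esym.
  apply: etrans (congr1 _ (pts_map_hom_comp ef (cod_eta P) x)) _.
  by rewrite cod_fmapE cod_etaE.
- apply: etrans (congr1 _ (pts_map_hom_comp (cod_fmap (dfst X (dpts C Q))) bf x)) _.
  by rewrite !cod_fmapE.
- apply: etrans (congr1 _ (pts_map_hom_comp (cod_fmap (dsnd X (dpts C Q))) bf x)) _.
  apply/esym.
  apply: etrans (congr1 _ (pts_map_hom_comp ef (cod_fmap (dsnd X (dpts C P))) x)) _.
  by rewrite !cod_fmapE.
Qed.

Local Notation N := (Ninfty_category gT V).
Local Notation Ho := (Ho_Ninfty gT V).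

Definition fam (O : N) : collection gT := sval (cid (Ninfty_fixed (svalP O))).

Lemma fam_indexing O : indexing_system (fam O).
Proof. by rewrite /fam; case: cid => F []. Qed.

Lemma fam_fixed O : has_fixed_points (fam O) (sval O).
Proof. by rewrite /fam; case: cid => F []. Qed.

Local Notation D O := (dpts C (sval O)).

Lemma fam_realizes (O : N) : realizes (D O) (fam O).
Proof. exact: has_fixed_points_realizes (fam_fixed O). Qed.

Lemma fam_uniq (O : N) F : has_fixed_points F (sval O) -> fam O = F.
Proof.
move=> FO; apply: realizes_uniq (fam_realizes O) _.
exact: has_fixed_points_realizes FO.
Qed.

Definition fam_le (O P : N) := forall n, fam O n \subset fam P n.

Lemma fam_le_refl O : fam_le O O. Proof. by move=> n; exact: subxx. Qed.

Lemma hom_fam_le (O P : N) (f : hom O P) : fam_le O P.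
Proof.
move=> n; apply/fintype.subsetP => Gamma /fam_realizes[x xE].
apply/fam_realizes; exists (dpts_map C f n x) => p /xE pE.
by rewrite -dmap_rel -dmap_act pE.
Qed.

(** A weak equivalence reflects nonemptiness of fixed points. *)
Lemma weq_fam_le (O P : N) (w : hom O P) : Ninfty_weq w -> fam_le P O.
Proof.
move=> Ww n; apply/fintype.subsetP => Gamma GP.
apply/fam_realizes/fixed_pointsP/(weq_pts (c := C) (Ww n Gamma)).
exact: contractible_pts ((fam_fixed P Gamma).1 GP).
Qed.

Lemma fam_le_weq (O P : N) (f : hom O P) : fam_le P O -> Ninfty_weq f.
Proof.
move=> PO n Gamma; apply: (has_fixed_points_weq C f (fam_fixed O) (fam_fixed P)).
by move=> m Delta; exact/fintype.subsetP.
Qed.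

Lemma dpts_Ninfty (O : N) : is_Ninfty (cod_goperad C (D O)).
Proof.
apply: (cod_goperad_Ninfty (F := fam O)); first exact: fam_realizes.
  exact: Ninfty_sym_free (svalP O).
exact: (fam_indexing O).2.
Qed.

Lemma dprod_Ninfty (O P : N) : is_Ninfty (cod_goperad C (dprod (D O) (D P))).
Proof.
apply: (cod_goperad_Ninfty (F := fun n => fam O n :&: fam P n)).
- exact: realizes_prod (fam_realizes O) (fam_realizes P).
- exact/sym_free_prod/Ninfty_sym_free/(svalP O).
- by move=> n H; rewrite inE (fam_indexing O).2 (fam_indexing P).2.
Qed.

Definition EU (O : N) : N := exist _ _ (dpts_Ninfty O).
Definition EP (O P : N) : N := exist _ _ (dprod_Ninfty O P).

Lemma fam_EU O : fam (EU O) = fam O.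
Proof. by apply: fam_uniq; apply: realizes_has_fixed_points; exact: fam_realizes. Qed.

Lemma fam_EP O P : fam (EP O P) = (fun n => fam O n :&: fam P n).
Proof.
apply: fam_uniq; apply: realizes_has_fixed_points.
exact: realizes_prod (fam_realizes O) (fam_realizes P).
Qed.

Definition eta (O : N) : @hom N O (EU O) := cod_eta (sval O).
Definition efst (O P : N) : @hom N (EP O P) (EU O) := cod_fmap (dfst (D O) (D P)).
Definition esnd (O P : N) : @hom N (EP O P) (EU P) := cod_fmap (dsnd (D O) (D P)).

Lemma eta_weq O : Ninfty_weq (eta O).
Proof. by apply: fam_le_weq => n; rewrite fam_EU. Qed.

Lemma efst_weq O P : fam_le O P -> Ninfty_weq (efst O P).
Proof. by move=> OP; apply: fam_le_weq => n; rewrite fam_EU fam_EP finset.subsetI subxx OP. Qed.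

Lemma E_diagonal (O : N) : exists d : @hom N (EU O) (EP O O),
  efst O O ∘ d = idm (EU O) /\ esnd O O ∘ d = idm (EU O).
Proof. exact: (cod_fmap_diagonal (D O)). Qed.

Lemma E_naturality (O P Q : N) (f : hom P Q) :
  exists (ef : @hom N (EU P) (EU Q)) (bf : @hom N (EP O P) (EP O Q)),
    [/\ eta Q ∘ f = ef ∘ eta P, efst O Q ∘ bf = efst O P & esnd O Q ∘ bf = ef ∘ esnd O P].
Proof. exact: (cod_fmap_naturality (D O) f). Qed.

Lemma fam_le_hom (O P Q : N) (f : hom P Q) : fam_le O P -> fam_le O Q.
Proof. by move=> OP n; exact: fintype.subset_trans (OP n) (hom_fam_le f n). Qed.

Lemma fam_le_weq_inv (O P Q : N) (w : hom Q P) : Ninfty_weq w -> fam_le O P -> fam_le O Q.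
Proof. by move=> Ww OP n; exact: fintype.subset_trans (OP n) (weq_fam_le Ww n). Qed.

Local Notation I := (indexing_category gT).

Lemma I_hom_uniq (F F' : I) (f g : hom F F') : f = g.
Proof. exact: (@Prop_irrelevance (forall n, sval F n \subset sval F' n) f g). Qed.

Lemma free_realizes (F : I) : realizes (free_dgop (svalP F).1) (sval F).
Proof. exact: free_dgop_realizes. Qed.

Lemma free_Ninfty (F : I) : is_Ninfty (cod_goperad C (free_dgop (svalP F).1)).
Proof.
apply: cod_goperad_Ninfty (free_realizes F) _ (svalP F).2.
by move=> n s x; exact: free_dgop_sym_free.
Qed.

Definition free_Nop (F : I) : N := exist _ _ (free_Ninfty F).

Lemma fam_free (F : I) : fam (free_Nop F) = sval F.
Proof. by apply: fam_uniq; apply: realizes_has_fixed_points; exact: free_realizes. Qed.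

(** A morphism from O to P exists in the homotopy category exactly when [fam_le O P], and it is
    unique; the free operads provide the inverse functor. *)
Lemma Ho_Ninfty_equivalence :
  exists Phi : functor (localization (@Ninfty_weq gT V)) I,
    (forall O : N, has_fixed_points (sval (Phi (loc_ob (@Ninfty_weq gT V) O))) (sval O)) /\
    is_equivalence Phi.
Proof.
pose phi (O : N) : I := exist _ (fam O) (fam_indexing O).
have phi_hom (O P : N) : fam_le O P -> hom (phi O) (phi P) by [].
have psi_rel (F F' : I) : hom F F' -> fam_le (free_Nop F) (free_Nop F').
  by move=> FF' n; rewrite !fam_free.
have psi_phi (O : N) : fam_le (free_Nop (phi O)) O /\ fam_le O (free_Nop (phi O)).
  by split=> n; rewrite fam_free.
have phi_psi (F : I) : hom (phi (free_Nop F)) F by move=> n; rewrite /= fam_free.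
have phi_psi' (F : I) : hom F (phi (free_Nop F)) by move=> n; rewrite /= fam_free.
have [Phi [PhiE Phi_eq]] := @loc_thin_equivalence N _ fam_le EU EP eta efst esnd
  fam_le_refl fam_le_hom fam_le_weq_inv eta_weq efst_weq E_diagonal E_naturality
  I I_hom_uniq phi phi_hom free_Nop psi_rel psi_phi phi_psi phi_psi'.
by exists Phi; split=> // O; rewrite PhiE; exact: fam_fixed.
Qed.

End NInftyOperads.

Lemma NF_operads (gT : finGroupType) (V : spaces) : inhabited (codisc V) ->
  (forall F : collection gT, weak_indexing_system F ->
     exists O : goperad gT V, has_fixed_points F O) /\
  (exists Phi : functor (localization (@Ninfty_weq gT V)) (indexing_category gT),
    (forall O : Ninfty_category gT V,
       has_fixed_points (sval (Phi (loc_ob (@Ninfty_weq gT V) O))) (sval O)) /\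
    is_equivalence Phi) /\
  (forall (F : collection gT) (O' : goperad gT V),
     consists_of_graph_subgroups F -> has_fixed_points F O' -> weak_indexing_system F).
Proof.
case=> C; split; first move=> F Fwis.
  exists (cod_goperad C (free_dgop Fwis)).
  exact/realizes_has_fixed_points/free_dgop_realizes.
split; first exact: Ho_Ninfty_equivalence C.
move=> F O' Fgr FO'; apply: realizes_weak_indexing_system Fgr.
exact: has_fixed_points_realizes FO'.
Qed.

Lemma spaces_codisc (R : realType) (V : spaces) :
  V = sSet \/ V = Top R -> inhabited (codisc V).
Proof. by case=> ->; constructor; [exact: sset_codisc|exact: top_codisc]. Qed.

Theorem mainTheorem4 (R : realType) (gT : finGroupType) (V : spaces)
    (hV : V = sSet \/ V = Top R) :
  (forall F : collection gT, weak_indexing_system F ->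
     exists O : goperad gT V, has_fixed_points F O) /\
  (exists Phi : functor (Ho_Ninfty gT V) (indexing_category gT),
     (forall O : Ninfty_category gT V,
        has_fixed_points (sval (Phi O)) (sval O)) /\
     is_equivalence Phi) /\
  (forall (F : collection gT) (O' : goperad gT V),
     consists_of_graph_subgroups F ->
     has_fixed_points F O' -> weak_indexing_system F).
Proof.
exact (NF_operads gT (spaces_codisc hV)).
Qed.
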